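(* Let $\sum_{j=0}^\infty|a(j)|<\infty$, $\sum_{j=0}^\infty(j+1)|a(j)|^2<\infty$, $P_1,P_2>0$, and $D=D_f^0\times D_g^0$ with $$D_f^0=\left\{f:\frac1{2\pi}\int_{-\pi}^\pi f(\lambda)d\lambda\le P_1\right\},\qquad D_g^0=\left\{g:\frac1{2\pi}\int_{-\pi}^\pi g(\lambda)d\lambda\le P_2\right\}.$$ Let $f_0\in D_f^0$, $g_0\in D_g^0$ satisfy $\int_{-\pi}^\pi(f_0+g_0)^{-1}d\lambda<\infty$, put $C^0(e^{i\lambda})=\sum_{j=0}^\infty((\mathbf B^0)^{-1}\mathbf R^0\mathbf a)_je^{ij\lambda}$, and let the functions $$h_f(f_0,g_0)=\frac{|A(e^{i\lambda})g_0(\lambda)+C^0(e^{i\lambda})|^2}{(f_0(\lambda)+g_0(\lambda))^2},\qquad h_g(f_0,g_0)=\frac{|A(e^{i\lambda})f_0(\lambda)-C^0(e^{i\lambda})|^2}{(f_0(\lambda)+g_0(\lambda))^2}$$ be bounded. Suppose that for some constants $\alpha_1,\alpha_2\ge0$ $$|A(e^{i\lambda})g_0(\lambda)+C^0(e^{i\lambda})|=\alpha_1(f_0(\lambda)+g_0(\lambda)),\qquad |A(e^{i\lambda})f_0(\lambda)-C^0(e^{i\lambda})|=\alpha_2(f_0(\lambda)+g_0(\lambda)),$$ and that $(f_0,g_0)$ determines a solution to the optimization problem $$\max_{(f,g)\in D}\left(\langle\mathbf R\mathbf a,\mathbf B^{-1}\mathbf R\mathbf a\rangle+\langle\mathbf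 Q\mathbf a,\mathbf a\rangle\right)=\langle\mathbf R^0\mathbf a,(\mathbf B^0)^{-1}\mathbf R^0\mathbf a\rangle+\langle\mathbf Q^0\mathbf a,\mathbf a\rangle.$$ Then $f_0,g_0$ are least favourable in $D$ for the optimal estimation of $A\xi=\sum_{j=0}^\infty a(j)\xi(j)$ based on observations of $\xi(j)+\eta(j)$ at $j=-1,-2,\dots$, and $$h^0(e^{i\lambda})=\frac{A(e^{i\lambda})f_0(\lambda)-C^0(e^{i\lambda})}{f_0(\lambda)+g_0(\lambda)}$$ is the minimax-robust spectral characteristic of the optimal linear estimate of $A\xi$.
   Context: $\xi,\eta$ are zero mean mutually uncorrelated wide sense stationary sequences with spectral densities $f,g$ ($E\xi(j+k)\overline{\xi(j)}=\frac1{2\pi}\int e^{ik\lambda}f\,d\lambda$, etc.). $A(e^{i\lambda})=\sum_{j\ge0}a(j)e^{ij\lambda}$, $\mathbf a=(a(0),a(1),\dots)$, $\langle x,y\rangle=\sum_kx(k)\overline{y(k)}$. $\mathbf B,\mathbf R,\mathbf Q$ are the linear operators in $\ell_2$ with matrices ($j,k\ge0$) $B_{j,k}=\frac1{2\pi}\int_{-\pi}^\pi e^{-i(j-k)\lambda}\frac{1}{f+g}d\lambda$, $R_{j,k}=\frac1{2\pi}\int_{-\pi}^\pi e^{-i(j-k)\lambda}\frac{f}{f+g}d\lambda$, $Q_{j,k}=\frac1{2\pi}\int_{-\pi}^\pi e^{-i(j-k)\lambda}\frac{fg}{f+g}d\lambda$; $\mathbf B^0,\mathbf R^0,\mathbf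 Q^0$ are those for $(f_0,g_0)$. Wherever $\mathbf B^{-1}$ is used, $(f,g)$ is understood to satisfy the minimality condition $\int(f+g)^{-1}d\lambda<\infty$ and $\mathbf B$ to be a bounded operator in $\ell_2$ with bounded inverse. $L_2^0(f+g)$ is the closed span of $e^{ij\lambda}$, $j\le-1$, in $L_2(f+g)$; for $h\in L_2^0(f+g)$, $\Delta(h;f,g)=\frac1{2\pi}\int|A-h|^2f\,d\lambda+\frac1{2\pi}\int|h|^2g\,d\lambda$, and $h(f,g)$ is its minimizer. $(f_0,g_0)\in D$ is least favourable if $\Delta(h(f_0,g_0);f_0,g_0)=\max_{(f,g)\in D}\Delta(h(f,g);f,g)$. $h^0$ is minimax-robust if $h^0\in H_D=\bigcap_{(f,g)\in D}L_2^0(f+g)$ and $\min_{h\in H_D}\max_{(f,g)\in D}\Delta(h;f,g)=\sup_{(f,g)\in D}\Delta(h^0;f,g)$. *)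

(* Defs.v *)
From HB Require Import structures.
From mathcomp Require Import all_boot all_order all_algebra.
From mathcomp Require Import complex.
From mathcomp Require Import all_classical all_reals all_analysis.

Set Implicit Arguments.
Unset Strict Implicit.
Unset Printing Implicit Defensive.

Import Order.TTheory GRing.Theory Num.Theory.
Import numFieldNormedType.Exports.

Local Open Scope classical_set_scope.
Local Open Scope ring_scope.
Local Open Scope complex_scope.

Section Complex.
Context {R : realType}.

Definition cmod (z : R[i]) : R := ComplexField.Normc.normc z.

(* e^{it} *)
Definition expi (t : R) : R[i] := cos t +i* sin t.

(* The sum of a series of complex numbers, taken componentwise; meaningful only
   when the series converges. *)
Definition csum (u : nat -> R[i]) : R[i] :=
  limn (series (fun j => complex.Re (u j))) +i*
  limn (series (fun j => complex.Im (u j))).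

Definition circle : set R := `[- pi, pi].

Definition cmeasurable (h : R -> R[i]) :=
  measurable_fun circle (fun x => complex.Re (h x)) /\
  measurable_fun circle (fun x => complex.Im (h x)).

Definition cintegral (h : R -> R[i]) : R[i] :=
  (\int[lebesgue_measure]_(x in circle) complex.Re (h x)) +i*
  (\int[lebesgue_measure]_(x in circle) complex.Im (h x)).

End Complex.

Section SquareSummable.
Context {R : realType}.
Implicit Types (x y : nat -> R[i]) (M : nat -> nat -> R[i]).
Implicit Types T S : (nat -> R[i]) -> (nat -> R[i]).

Definition l2 : set (nat -> R[i]) :=
  [set x | cvgn (series (fun j => cmod (x j) ^+ 2))].

Definition l2normsq x : R := limn (series (fun j => cmod (x j) ^+ 2)).

Definition inner x y : R[i] := csum (fun k => x k * conjc (y k)).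

Definition mxact M x : nat -> R[i] := fun j => csum (fun k => M j k * x k).

(* Operators on l2 are represented by total maps on sequences; only their
   values on l2 matter. *)
Definition bounded_operator T :=
  [/\ {homo T : x / x \in l2},
      forall (z : R[i]) x y, x \in l2 -> y \in l2 ->
        forall j, T (fun k => z * x k + y k) j = z * T x j + T y j &
      exists K : R, forall x, x \in l2 -> l2normsq (T x) <= K * l2normsq x].

Definition has_matrix T M :=
  forall j k, T (fun i => (i == k)%:R) j = M j k.

Definition l2_inverse T S :=
  forall x, x \in l2 -> T (S x) = x /\ S (T x) = x.

(* M is the matrix of a bounded operator T of l2, with bounded inverse S. *)
Definition boundedly_invertible M T S :=
  [/\ bounded_operator T, has_matrix T M, bounded_operator S & l2_inverse T S].

End SquareSummable.

Section Extrapolation.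
Context {R : realType}.
Implicit Types (f g : R -> R) (h : R -> R[i]) (a : nat -> R[i]).
Implicit Types D : set ((R -> R) * (R -> R)).

Local Notation mu := (@lebesgue_measure R).

Definition spectral_density f :=
  mu.-integrable circle (EFin \o f) /\ (forall x, circle x -> 0 <= f x).

(* The inverse is that of the extended reals, where 0^-1 = +oo: the condition
   forces f + g > 0 almost everywhere. *)
Definition minimality f g :=
  (\int[mu]_(x in circle) ((f x + g x)%:E)^-1 < +oo)%E.

(* (1/2pi) \int e^{-i(j-k)x} phi(x) dx *)
Definition toeplitz (phi : R -> R) (j k : nat) : R[i] :=
  ((2 * pi)^-1)%:C *
  cintegral (fun x => expi (- ((j%:R - k%:R) * x)) * (phi x)%:C).

Definition Bmx f g := toeplitz (fun x => (f x + g x)^-1).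
Definition Rmx f g := toeplitz (fun x => f x / (f x + g x)).
Definition Qmx f g := toeplitz (fun x => f x * g x / (f x + g x)).

(* <R a, B^{-1} R a> + <Q a, a>, where Binv stands for B^{-1}. The number is
   real, B and Q being self-adjoint; Re only changes its type. *)
Definition objective a f g (Binv : (nat -> R[i]) -> (nat -> R[i])) : R :=
  complex.Re (inner (mxact (Rmx f g) a) (Binv (mxact (Rmx f g) a)) +
              inner (mxact (Qmx f g) a) a).

(* A(e^{ix}) *)
Definition Afun a (x : R) : R[i] := csum (fun j => a j * expi (j%:R * x)).

(* C(e^{ix}) = sum_j c_j e^{ijx} in L2(-pi, pi): for square summable c the
   series is only guaranteed to converge in the mean, so that C is determined
   up to a null set. *)
Definition fourier_sum (c : nat -> R[i]) (C : R -> R[i]) :=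
  cmeasurable C /\
  (fun n => \int[mu]_(x in circle)
     (cmod (C x - \sum_(j < n) c j * expi (j%:R * x)) ^+ 2)%:E)%E
    @ \oo --> 0%E.

(* L_2^0(w), the closed span of e^{ijx}, j <= -1, in L_2(w) *)
Definition L20 (w : R -> R) : set (R -> R[i]) :=
  [set h | [/\ cmeasurable h,
     (\int[mu]_(x in circle) (cmod (h x) ^+ 2 * w x)%:E < +oo)%E &
     forall e : R, 0 < e -> exists (n : nat) (c : nat -> R[i]),
       (\int[mu]_(x in circle)
          (cmod (h x - \sum_(j < n) c j * expi (- (j.+1%:R * x))) ^+ 2
           * w x)%:E < e%:E)%E]].

(* Delta(h; f, g), in the extended reals *)
Definition Delta a h f g : \bar R :=
  (((2 * pi)^-1)%:E *
     \int[mu]_(x in circle) (cmod (Afun a x - h x) ^+ 2 * f x)%:E +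
   ((2 * pi)^-1)%:E *
     \int[mu]_(x in circle) (cmod (h x) ^+ 2 * g x)%:E)%E.

(* h = h(f, g). By the projection theorem such an h exists for all spectral
   densities f, g and is unique up to equality in L_2(f + g). *)
Definition spectral_characteristic a f g h :=
  L20 (fun x => f x + g x) h /\
  forall h', L20 (fun x => f x + g x) h' -> (Delta a h f g <= Delta a h' f g)%E.

Definition least_favourable a D f0 g0 :=
  D (f0, g0) /\
  exists2 h0, spectral_characteristic a f0 g0 h0 &
    forall f g h, D (f, g) -> spectral_characteristic a f g h ->
      (Delta a h f g <= Delta a h0 f0 g0)%E.

Definition HD D : set (R -> R[i]) :=
  [set h | forall f g, D (f, g) -> L20 (fun x => f x + g x) h].

Definition worst_error a D h : \bar R :=
  ereal_sup [set Delta a h p.1 p.2 | p in D].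

Definition minimax_robust a D h0 :=
  HD D h0 /\ forall h, HD D h -> (worst_error a D h0 <= worst_error a D h)%E.

(* D_f^0 and D_g^0, for P = P_1 and P = P_2 *)
Definition power_class (P : R) : set (R -> R) :=
  [set f | spectral_density f /\
           (2 * pi)^-1 * (\int[mu]_(x in circle) f x) <= P].

End Extrapolation.

(* Main.v *)
Require Import Defs.
From HB Require Import structures.
From mathcomp Require Import all_boot all_order all_algebra.
From mathcomp Require Import complex ring lra.
From mathcomp Require Import all_classical all_reals all_analysis.
From mathcomp Require Import measurable_realfun.

Set Implicit Arguments.
Unset Strict Implicit.
Unset Printing Implicit Defensive.

Import Order.TTheory GRing.Theory Num.Theory.
Import numFieldNormedType.Exports.

Local Open Scope classical_set_scope.
Local Open Scope ring_scope.
Local Open Scope complex_scope.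

(** Write w0 = f0 + g0. Almost everywhere |A - h0| = alpha1 and |h0| = alpha2, so
    Delta(h0; f, g) depends only on the powers of f and g, and the theorem follows
    once (f0, g0, h0) is a saddle point. This needs three facts.

    The Toeplitz operator B0 being bounded, its symbol 1 / w0 is bounded (its
    Fejer means are values of the quadratic form of B0). Hence B0 c0 = R0 a says
    that the nonnegative Fourier coefficients of h0 vanish; as h0 is bounded, its
    Fejer means approximate it in L_2(w) for every integrable w, so that h0 is in
    L_2^0(w) for all of them.

    The cross term (A - h0) f0 - h0 g0 = C0 has no negative Fourier coefficients
    and |C0| <= const * w0, so h0 is the projection, that is h(f0, g0).

    If the power constraint on f is slack, f0 may be replaced by f0 + eps w0. This
    multiplies B0 by 1 / (1 + eps), so that its inverse is explicit, and the first
    order condition reads alpha1^2 \int w0 <= 0; the same holds for g0. *)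

(** Optimality of [(f0, g0)] is known only against pairs whose [B] is boundedly invertible, whereas
    the conclusion ranges over all of [D], where [f + g] may be unbounded or vanish on large sets.
    Optimality is therefore used only along [w0], added to one density at a time, where
    invertibility is inherited from [B0]; all other pairs are reached through the two modulus
    equations. The bound on [1 / w0] is forced by the meaning of [C0], a sum in mean square only.
    Reading the rows of [B0 c0 = R0 a] as Fourier coefficients of [C0 / w0] multiplies that series
    by [1 / w0], which minimality makes merely integrable; for a bounded factor the product
    converges in L1. The first order condition has an exact source: along [f0 + eps w0] the
    objective times [1 + eps] is a quadratic polynomial in [eps], and its slope minus the optimal
    value is the mean of [|A g0 + C0|^2 / w0]. *)

Arguments cmod : simpl never.
Arguments expi : simpl never.

(** * Modulus, real and imaginary parts, unimodular exponentials *)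

Section ComplexModulus.
Context {R : realType}.
Implicit Types z w : R[i].

Lemma cmod_ge0 z : 0 <= cmod z.
Proof. by case: z => x y; exact: sqrtr_ge0. Qed.

Lemma cmodM z w : cmod (z * w) = cmod z * cmod w.
Proof. exact: ComplexField.Normc.normcM. Qed.

Lemma cmodN z : cmod (- z) = cmod z.
Proof. exact: normcN. Qed.

Lemma cmodBC z w : cmod (z - w) = cmod (w - z).
Proof. by rewrite -cmodN opprB. Qed.

Lemma cmodD z w : cmod (z + w) <= cmod z + cmod w.
Proof. exact: le_normcD. Qed.

Lemma cmodB z w : cmod (z - w) <= cmod z + cmod w.
Proof. by rewrite -(cmodN w); exact: cmodD. Qed.

Lemma cmod0 : cmod (0 : R[i]) = 0.
Proof. exact: ComplexField.Normc.normc0. Qed.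

Lemma cmod0_eq0 z : cmod z = 0 -> z = 0.
Proof. exact: ComplexField.Normc.eq0_normc. Qed.

Lemma cmodV z : cmod z^-1 = (cmod z)^-1.
Proof. exact: ComplexField.Normc.normcV. Qed.

Lemma cmod_sqr z : cmod z ^+ 2 = complex.Re z ^+ 2 + complex.Im z ^+ 2.
Proof. by case: z => x y; rewrite sqr_sqrtr// addr_ge0// sqr_ge0. Qed.

Lemma cmod_real (x : R) : cmod x%:C = `|x|.
Proof. by rewrite /cmod /= expr0n /= addr0 sqrtr_sqr. Qed.

Lemma cmod_conj z : cmod (conjc z) = cmod z.
Proof. by case: z => x y; rewrite /cmod /= sqrrN. Qed.

Lemma Re_le_cmod z : `|complex.Re z| <= cmod z.
Proof.
rewrite -(@ler_pXn2r _ 2)// ?nnegrE ?cmod_ge0// cmod_sqr real_normK ?num_real//.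
by rewrite lerDl sqr_ge0.
Qed.

Lemma Im_le_cmod z : `|complex.Im z| <= cmod z.
Proof.
rewrite -(@ler_pXn2r _ 2)// ?nnegrE ?cmod_ge0// cmod_sqr real_normK ?num_real//.
by rewrite lerDr sqr_ge0.
Qed.

Lemma cmod_le_ReIm z : cmod z <= `|complex.Re z| + `|complex.Im z|.
Proof.
rewrite -(@ler_pXn2r _ 2)// ?nnegrE ?cmod_ge0 ?addr_ge0// cmod_sqr sqrrD.
by rewrite !real_normK ?num_real// lerD2r lerDl mulrn_wge0// mulr_ge0.
Qed.

Lemma mulcJ z : z * conjc z = (cmod z ^+ 2)%:C.
Proof.
by rewrite cmod_sqr; case: z => x y; apply/eqP; rewrite eq_complex /=; apply/andP; split; apply/eqP; ring.
Qed.

Lemma cmod_sum (I : Type) (r : seq I) (P : pred I) (F : I -> R[i]) :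
  cmod (\sum_(i <- r | P i) F i) <= \sum_(i <- r | P i) cmod (F i).
Proof.
apply: (big_ind2 (fun z (x : R) => cmod z <= x)) => //; first by rewrite cmod0.
by move=> z x w y zx wy; apply: (le_trans (cmodD _ _)); exact: lerD.
Qed.

Lemma ReD z w : complex.Re (z + w) = complex.Re z + complex.Re w.
Proof. by case: z; case: w. Qed.

Lemma ImD z w : complex.Im (z + w) = complex.Im z + complex.Im w.
Proof. by case: z; case: w. Qed.

Lemma ReN z : complex.Re (- z) = - complex.Re z.
Proof. by case: z. Qed.

Lemma ImN z : complex.Im (- z) = - complex.Im z.
Proof. by case: z. Qed.

Lemma ReM z w : complex.Re (z * w) =
  complex.Re z * complex.Re w - complex.Im z * complex.Im w.
Proof. by case: z; case: w. Qed.

Lemma ImM z w : complex.Im (z * w) =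
  complex.Re z * complex.Im w + complex.Im z * complex.Re w.
Proof. by case: z => a b; case: w => c d /=; rewrite addrC. Qed.

Lemma ReJ z : complex.Re (conjc z) = complex.Re z.
Proof. by case: z. Qed.

Lemma ImJ z : complex.Im (conjc z) = - complex.Im z.
Proof. by case: z. Qed.

Lemma Re_sum (I : Type) (r : seq I) (P : pred I) (F : I -> R[i]) :
  complex.Re (\sum_(i <- r | P i) F i) = \sum_(i <- r | P i) complex.Re (F i).
Proof. by apply: (big_morph _ ReD). Qed.

Lemma Im_sum (I : Type) (r : seq I) (P : pred I) (F : I -> R[i]) :
  complex.Im (\sum_(i <- r | P i) F i) = \sum_(i <- r | P i) complex.Im (F i).
Proof. by apply: (big_morph _ ImD). Qed.

Lemma complexP z w :
  complex.Re z = complex.Re w -> complex.Im z = complex.Im w -> z = w.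
Proof. by case: z => a b; case: w => c d /= -> ->. Qed.

Lemma realcM (x y : R) : (x * y)%:C = x%:C * y%:C.
Proof. exact: rmorphM. Qed.

Lemma realcD (x y : R) : (x + y)%:C = x%:C + y%:C.
Proof. exact: rmorphD. Qed.

Lemma realcB (x y : R) : (x - y)%:C = x%:C - y%:C.
Proof. exact: rmorphB. Qed.

Lemma conjcD z w : conjc (z + w) = conjc z + conjc w.
Proof. exact: rmorphD. Qed.

Lemma conjcB z w : conjc (z - w) = conjc z - conjc w.
Proof. exact: rmorphB. Qed.

Lemma conjcM z w : conjc (z * w) = conjc z * conjc w.
Proof. exact: rmorphM. Qed.

Lemma conjc_sum (I : Type) (r : seq I) (P : pred I) (F : I -> R[i]) :
  conjc (\sum_(i <- r | P i) F i) = \sum_(i <- r | P i) conjc (F i).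
Proof. exact: rmorph_sum. Qed.

(* AM-GM with a free parameter, the substitute for Cauchy-Schwarz throughout *)
Lemma mulr_le_sqr (t x y : R) : 0 < t -> x * y <= t * x ^+ 2 + t^-1 * y ^+ 2.
Proof.
move=> t0; have h : 0 <= t^-1 * (t * x - y / 2) ^+ 2 + t^-1 * y ^+ 2 * (3 / 4).
  have ? : 0 <= t^-1 by rewrite invr_ge0 ltW.
  by apply: addr_ge0; last (apply: mulr_ge0; last lra); rewrite mulr_ge0 ?sqr_ge0.
rewrite -subr_ge0; suff -> : t * x ^+ 2 + t^-1 * y ^+ 2 - x * y =
  t^-1 * (t * x - y / 2) ^+ 2 + t^-1 * y ^+ 2 * (3 / 4) by [].
by field; rewrite gt_eqF.
Qed.

Lemma expiD (s t : R) : expi (s + t) = expi s * expi t.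
Proof.
apply: complexP; first by rewrite ReM /= cosD.
by rewrite ImM /= sinD; ring.
Qed.

Lemma expi0 : expi (0 : R) = 1.
Proof. by rewrite /expi cos0 sin0. Qed.

Lemma conjc_expi (t : R) : conjc (expi t) = expi (- t).
Proof. by rewrite /expi /= cosN sinN. Qed.

Lemma cmod_expi (t : R) : cmod (expi t) = 1.
Proof. by rewrite /cmod /expi /= cos2Dsin2 sqrtr1. Qed.

(** Up to a factor 1/n this is the Fejer kernel in two forms: the square shows that it is
    nonnegative, the double sum shows its frequencies. *)
Lemma expi_sum_sqr (n : nat) (s : R) :
  ((cmod (\sum_(k < n) expi (k%:R * s))) ^+ 2)%:C =
  \sum_(j < n) \sum_(k < n) expi ((j%:R - k%:R) * s).
Proof.
rewrite -mulcJ conjc_sum mulr_suml; apply: eq_bigr => j _.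
rewrite mulr_sumr; apply: eq_bigr => k _.
by rewrite conjc_expi -expiD; congr expi; ring.
Qed.

End ComplexModulus.

(** * Convergence of complex sequences and series *)

Section ComplexSequences.
Context {R : realType}.
Implicit Types (u v x y : nat -> R[i]) (z w : R[i]).

(** Stated through the modulus, so that every limit taken below is a limit of real numbers. *)
Definition ccvg u z := (fun n => cmod (u n - z)) @ \oo --> (0 : R).

Lemma cvg_ge_near (v : nat -> R) (l M : R) :
  v @ \oo --> l -> (\forall n \near \oo, M <= v n) -> M <= l.
Proof.
by move=> vl Mv; rewrite -(cvg_lim _ vl)//; apply: limr_ge => //; exact: cvgP vl.
Qed.

Lemma ccvg_le u z (e : nat -> R) :
  (forall n, cmod (u n - z) <= e n) -> e @ \oo --> (0 : R) -> ccvg u z.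
Proof.
move=> ue e0; apply: (@squeeze_cvgr _ _ _ _ (fun=> 0) e) => //; last exact: cvg_cst.
by apply: nearW => n; rewrite cmod_ge0 ue.
Qed.


Lemma ccvg_ext u v z : ccvg u z -> (forall n, u n = v n) -> ccvg v z.
Proof. by move=> uz /funext <-. Qed.

Lemma ccvg_Re u z : ccvg u z -> (fun n => complex.Re (u n)) @ \oo --> complex.Re z.
Proof.
move=> uz; apply/subr_cvg0/norm_cvg0P.
apply: (@squeeze_cvgr _ _ _ _ (fun=> 0) _ _ _ _ _ uz); last exact: cvg_cst.
by apply: nearW => n; rewrite normr_ge0 -ReN -ReD Re_le_cmod.
Qed.

Lemma ccvg_Im u z : ccvg u z -> (fun n => complex.Im (u n)) @ \oo --> complex.Im z.
Proof.
move=> uz; apply/subr_cvg0/norm_cvg0P.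
apply: (@squeeze_cvgr _ _ _ _ (fun=> 0) _ _ _ _ _ uz); last exact: cvg_cst.
by apply: nearW => n; rewrite normr_ge0 -ImN -ImD Im_le_cmod.
Qed.

Lemma ReIm_ccvg u z : (fun n => complex.Re (u n)) @ \oo --> complex.Re z ->
  (fun n => complex.Im (u n)) @ \oo --> complex.Im z -> ccvg u z.
Proof.
move=> /subr_cvg0/cvg_norm; rewrite normr0 => h1.
move=> /subr_cvg0/cvg_norm; rewrite normr0 => h2.
apply: (@ccvg_le _ _ (fun n => `|complex.Re (u n) - complex.Re z| +
    `|complex.Im (u n) - complex.Im z|)).
  by move=> n; rewrite -ReN -ReD -ImN -ImD; exact: cmod_le_ReIm.
by rewrite -[X in _ --> X]addr0; exact: (cvgD h1 h2).
Qed.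

Lemma ccvg_unique u z w : ccvg u z -> ccvg u w -> z = w.
Proof.
move=> uz uw; apply: complexP.
  exact: (cvg_unique _ (ccvg_Re uz) (ccvg_Re uw)).
exact: (cvg_unique _ (ccvg_Im uz) (ccvg_Im uw)).
Qed.

Lemma ccvg_cst z : ccvg (fun=> z) z.
Proof. by rewrite /ccvg subrr cmod0; exact: cvg_cst. Qed.

Lemma ccvgD u v z w : ccvg u z -> ccvg v w -> ccvg (fun n => u n + v n) (z + w).
Proof.
move=> uz vw; apply: (@ccvg_le _ _ (fun n => cmod (u n - z) + cmod (v n - w))).
  by move=> n; rewrite opprD addrACA; exact: cmodD.
by rewrite -[X in _ --> X]addr0; exact: (cvgD uz vw).
Qed.

Lemma ccvgM u z w : ccvg u z -> ccvg (fun n => w * u n) (w * z).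
Proof.
move=> uz; apply: (@ccvg_le _ _ (fun n => cmod w * cmod (u n - z))).
  by move=> n; rewrite -mulrBr cmodM.
by rewrite -[X in _ --> X](mulr0 (cmod w)); apply: cvgM => //; exact: cvg_cst.
Qed.

Lemma ccvg_conj u z : ccvg u z -> ccvg (fun n => conjc (u n)) (conjc z).
Proof.
by move=> uz; apply: (ccvg_le _ uz) => n; rewrite -conjcB cmod_conj.
Qed.

(** [csum] is built from [limn], which carries no information without convergence; values of [inner]
    and [mxact] are computed through this lemma. *)
Lemma csum_eq u z : ccvg (fun n => \sum_(j < n) u j) z -> csum u = z.
Proof.
move=> uz; apply: complexP; rewrite /csum /=.
  apply/cvg_lim => //; have := ccvg_Re uz.
  by under eq_fun do rewrite Re_sum -(big_mkord xpredT (fun k => complex.Re (u k))).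
apply/cvg_lim => //; have := ccvg_Im uz.
by under eq_fun do rewrite Im_sum -(big_mkord xpredT (fun k => complex.Im (u k))).
Qed.

Lemma cvgn_seriesP (t : nat -> R) : (forall n, 0 <= t n) ->
  cvgn (series t) -> forall n, \sum_(k < n) t k <= limn (series t).
Proof.
move=> t0 ct n; rewrite -(big_mkord xpredT t).
apply: (nondecreasing_cvgn_le _ ct n).
by apply/nondecreasing_seqP => m; rewrite /series /= big_nat_recr//= lerDl.
Qed.

Lemma series_bounded (t : nat -> R) (M : R) : (forall n, 0 <= t n) ->
  (forall n, \sum_(k < n) t k <= M) ->
  cvgn (series t) /\ limn (series t) <= M.
Proof.
move=> t0 tM.
have ct : cvgn (series t).
  apply: nondecreasing_is_cvgn.
    by apply/nondecreasing_seqP => m; rewrite /series /= big_nat_recr//= lerDl.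
  by exists M => _ [n _ <-]; rewrite /series /= big_mkord.
split=> //; apply: limr_le => //; apply: nearW => n.
by rewrite /series /= big_mkord.
Qed.

Lemma series_tail_cvg0 (t : nat -> R) : cvgn (series t) ->
  (fun n => limn (series t) - \sum_(k < n) t k) @ \oo --> (0 : R).
Proof.
move=> ct; rewrite -[X in _ --> X](subrr (limn (series t))).
apply: cvgB; first exact: cvg_cst.
have -> : (fun n => \sum_(k < n) t k) = series t.
  by apply/funext => n; rewrite /series /= big_mkord.
exact: ct.
Qed.

(** The explicit tail bound is what later makes the series of [A] converge uniformly in the
    angle. *)
Lemma csum_cvg u : cvgn (series (fun j => cmod (u j))) ->
  ccvg (fun n => \sum_(j < n) u j) (csum u) /\
  forall n, cmod (csum u - \sum_(j < n) u j) <=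
    limn (series (fun j => cmod (u j))) - \sum_(j < n) cmod (u j).
Proof.
move=> cu; have cu' : forall f : R[i] -> R, (forall z, `|f z| <= cmod z) ->
    cvgn (series (fun j => f (u j))).
  move=> f fz; apply: normed_cvg.
  apply: (series_le_cvg _ _ _ cu) => n //=; exact: cmod_ge0.
have h : ccvg (fun n => \sum_(j < n) u j) (csum u).
  apply: ReIm_ccvg; rewrite /csum /=.
    under eq_fun do rewrite Re_sum -(big_mkord xpredT (fun k => complex.Re (u k))).
    exact: (cu' _ Re_le_cmod).
  under eq_fun do rewrite Im_sum -(big_mkord xpredT (fun k => complex.Im (u k))).
  exact: (cu' _ Im_le_cmod).
split=> // n.

rewrite -subr_le0; set tl := limn _ - _.
(* For [m >= n] the error at [n] is at most the error at [m], which tends to 0, plus the absolute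
   terms between [n] and [m]. *)
apply: (cvg_ge_near h); exists n => // m /= nm.
rewrite lerBlDr; apply: (@le_trans _ _ (cmod (csum u - \sum_(j < m) u j) +
    cmod (\sum_(j < m) u j - \sum_(j < n) u j))).
  by apply: le_trans (cmodD _ _); rewrite addrA subrK.
rewrite [X in X + _ <= _]cmodBC lerD2l /tl lerBrDr.
apply: le_trans (cvgn_seriesP (fun k => cmod_ge0 (u k)) cu m).
rewrite -(big_mkord xpredT (fun k => cmod (u k))) -(big_mkord xpredT u).
rewrite -(big_mkord xpredT (fun k => cmod (u k))) -(big_mkord xpredT u).
rewrite [X in cmod X](_ : _ = \sum_(n <= i < m) u i); last first.
  by rewrite (big_cat_nat (leq0n n) nm)//= addrAC subrr add0r.
rewrite [leRHS](big_cat_nat (leq0n n) nm) /= [leLHS]addrC lerD2l.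
exact: cmod_sum.
Qed.

End ComplexSequences.

(** * Square summable sequences, truncation, inner product *)

Section L2.
Context {R : realType}.
Implicit Types (x y : nat -> R[i]) (z w : R[i]).

Lemma l2_partial x n : l2 x -> \sum_(j < n) cmod (x j) ^+ 2 <= l2normsq x.
Proof. by move=> lx; apply: cvgn_seriesP => // k; exact: sqr_ge0. Qed.

Lemma l2normsq_ge0 x : l2 x -> 0 <= l2normsq x.
Proof. by move=> /(l2_partial 0); rewrite big_ord0. Qed.

Lemma cmod_le_l2normsq x j : l2 x -> cmod (x j) ^+ 2 <= l2normsq x.
Proof.
move=> /(l2_partial j.+1); apply: le_trans.
by rewrite big_ord_recr /= lerDr sumr_ge0// => k _; exact: sqr_ge0.
Qed.

Lemma l2_bounded x (M : R) : (forall n, \sum_(j < n) cmod (x j) ^+ 2 <= M) ->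
  l2 x /\ l2normsq x <= M.
Proof. by move=> xM; apply: series_bounded => // n; exact: sqr_ge0. Qed.

Lemma l2_lin z x y : l2 x -> l2 y -> l2 (fun k => z * x k + y k).
Proof.
move=> lx ly.
apply: (proj1 (@l2_bounded _ (2 * cmod z ^+ 2 * l2normsq x + 2 * l2normsq y) _)) => n.
apply: (@le_trans _ _ (\sum_(j < n)
    (2 * cmod z ^+ 2 * cmod (x j) ^+ 2 + 2 * cmod (y j) ^+ 2))).
  apply: ler_sum => j _.
  apply: (@le_trans _ _ ((cmod z * cmod (x j) + cmod (y j)) ^+ 2)).
    rewrite ler_pXn2r ?nnegrE ?cmod_ge0 ?addr_ge0 ?mulr_ge0 ?cmod_ge0//.
    by rewrite -cmodM; exact: cmodD.
  rewrite -subr_ge0; apply: le_trans (sqr_ge0 (cmod z * cmod (x j) - cmod (y j))) _.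
  by rewrite le_eqVlt; apply/orP; left; apply/eqP; ring.
rewrite big_split /= -!mulr_sumr lerD// ler_wpM2l ?l2_partial//.
by rewrite mulr_ge0// sqr_ge0.
Qed.

Lemma l2_zero : l2 (fun=> 0 : R[i]).
Proof.
by apply: (proj1 (@l2_bounded _ 0 _)) => n; rewrite big1// => j _; rewrite cmod0 expr0n.
Qed.

(** Truncations are finite combinations of unit sequences, the only inputs on which a matrix
    determines its operator directly. *)
Definition trunc n x : nat -> R[i] := fun k => if (k < n)%N then x k else 0.

Lemma trunc_l2normsq n x :
  l2 (trunc n x) /\ l2normsq (trunc n x) <= \sum_(j < n) cmod (x j) ^+ 2.
Proof.
apply: l2_bounded => m.
rewrite -(big_mkord xpredT (fun j => cmod (x j) ^+ 2)).
rewrite -(big_mkord xpredT (fun j => cmod (trunc n x j) ^+ 2)).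
have h0 j : (n <= j)%N -> cmod (trunc n x j) ^+ 2 = 0.
  by move=> nj; rewrite /trunc ltnNge nj /= cmod0 expr0n.
have h1 j : (j < n)%N -> cmod (trunc n x j) ^+ 2 = cmod (x j) ^+ 2.
  by rewrite /trunc => ->.
have [mn|/ltnW nm] := leqP m n.
  rewrite (big_cat_nat (leq0n m) mn)//= -[leLHS]addr0 lerD//; last first.
    by rewrite sumr_ge0// => k _; exact: sqr_ge0.
  by apply: ler_sum_nat => k /andP[_ km]; rewrite h1// (leq_trans km).
rewrite (big_cat_nat (leq0n n) nm)//= -[leRHS]addr0 lerD//.
  by apply: ler_sum_nat => k /andP[_ km]; rewrite h1.
by rewrite big_nat_cond big1// => k /andP[/andP[nk _] _]; rewrite h0.
Qed.

Lemma trunc_l2 n x : l2 (trunc n x).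
Proof. exact: (trunc_l2normsq n x).1. Qed.

Lemma sub_trunc_l2 n x : l2 x -> l2 (fun k => x k - trunc n x k) /\
  l2normsq (fun k => x k - trunc n x k) <=
  l2normsq x - \sum_(j < n) cmod (x j) ^+ 2.
Proof.
move=> lx; apply: l2_bounded => m; rewrite lerBrDr.
(* The index [m + n] exceeds both [m] and [n], so one partial sum of [x] contains the head below [n]
   and the tail up to [m]. *)
apply: le_trans (l2_partial (m + n) lx).
rewrite -(big_mkord xpredT (fun j => cmod (x j - trunc n x j) ^+ 2)).
rewrite -!(big_mkord xpredT (fun j => cmod (x j) ^+ 2)).
rewrite (big_cat_nat (leq0n n) (leq_addl m n)) /= [leLHS]addrC lerD2l.
have h j : cmod (x j - trunc n x j) ^+ 2 <= cmod (x j) ^+ 2.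
  rewrite /trunc; case: ifP => _; last by rewrite subr0.
  by rewrite subrr cmod0 expr0n sqr_ge0.
have h1 j : (j < n)%N -> cmod (x j - trunc n x j) ^+ 2 = 0.
  by rewrite /trunc => ->; rewrite subrr cmod0 expr0n.
have [mn|/ltnW nm] := leqP m n.
  rewrite big_nat_cond big1 ?sumr_ge0// => [k _|k /andP[/andP[_ km] _]]; first exact: sqr_ge0.
  by rewrite h1// (leq_trans km).
rewrite (big_cat_nat (leq0n n) nm)//= big_nat_cond big1 ?add0r; last first.
  by move=> k /andP[/andP[_ km] _]; rewrite h1.
apply: (@le_trans _ _ (\sum_(n <= i < m) cmod (x i) ^+ 2)).
  by apply: ler_sum_nat => k _; exact: h.
rewrite (big_cat_nat nm (leq_addr n m))//= lerDl.
by rewrite sumr_ge0// => k _; exact: sqr_ge0.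
Qed.

(** Convergence uses the bound at [t = 1]. The free [t] serves limits: for fixed [t] one factor is
    sent to 0, then [t] grows to remove the other. *)
Lemma inner_cvg x y : l2 x -> l2 y ->
  ccvg (fun n => \sum_(k < n) x k * conjc (y k)) (inner x y) /\
  forall t : R, 0 < t -> cmod (inner x y) <= t * l2normsq x + t^-1 * l2normsq y.
Proof.
move=> lx ly.
have h n t : 0 < t -> \sum_(k < n) cmod (x k * conjc (y k)) <=
    t * l2normsq x + t^-1 * l2normsq y.
  move=> t0; apply: (@le_trans _ _ (\sum_(k < n)
      (t * cmod (x k) ^+ 2 + t^-1 * cmod (y k) ^+ 2))).
    by apply: ler_sum => k _; rewrite cmodM cmod_conj mulr_le_sqr.
  have ? : 0 <= t^-1 by rewrite invr_ge0 ltW.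
  by rewrite big_split /= -!mulr_sumr lerD// ler_wpM2l ?l2_partial// ltW.
have [cs _] := series_bounded (fun n => cmod_ge0 (x n * conjc (y n)))
  (fun n => h n 1 ltr01).
have [cv ti] := csum_cvg cs; split=> // t t0.
have := ti 0%N; rewrite !big_ord0 !subr0 => /le_trans; apply.
by apply: (proj2 (series_bounded (fun n => cmod_ge0 _) (fun n => h n t t0))).
Qed.

Lemma inner_linl z x y (w : nat -> R[i]) : l2 x -> l2 y -> l2 w ->
  inner (fun k => z * x k + y k) w = z * inner x w + inner y w.
Proof.
move=> lx ly lw; apply: csum_eq.
apply: (ccvg_ext (ccvgD (ccvgM z (inner_cvg lx lw).1) (inner_cvg ly lw).1)) => n.
by rewrite mulr_sumr -big_split /=; apply: eq_bigr => k _; ring.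
Qed.

Lemma inner_conj x y : l2 x -> l2 y -> inner y x = conjc (inner x y).
Proof.
move=> lx ly; apply: csum_eq.
apply: (ccvg_ext (ccvg_conj (inner_cvg lx ly).1)) => n.
by rewrite conjc_sum; apply: eq_bigr => k _; rewrite conjcM conjcK mulrC.
Qed.

Lemma l1_l2 x : cvgn (series (fun j => cmod (x j))) -> l2 x.
Proof.
move=> cx; set M := limn (series (fun j => cmod (x j))).
have xM j : cmod (x j) <= M.
  apply: le_trans (cvgn_seriesP (fun k => cmod_ge0 (x k)) cx j.+1).
  by rewrite big_ord_recr /= lerDr sumr_ge0// => k _; exact: cmod_ge0.
apply: (proj1 (@l2_bounded _ (M * M) _)) => n.
apply: (@le_trans _ _ (\sum_(j < n) M * cmod (x j))).
  by apply: ler_sum => j _; rewrite expr2 ler_wpM2r ?cmod_ge0.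
rewrite -mulr_sumr ler_wpM2l ?(le_trans (cmod_ge0 _) (xM 0%N))//.
exact: cvgn_seriesP (fun k => cmod_ge0 (x k)) cx n.
Qed.

End L2.

(** * Bounded operators of l2 and their matrices *)

Section BoundedOperators.
Context {R : realType}.
Implicit Types (x y : nat -> R[i]) (z w : R[i]).
Variables (T : (nat -> R[i]) -> (nat -> R[i])) (M : nat -> nat -> R[i]).
Hypotheses (Tb : bounded_operator T) (TM : has_matrix T M).

Lemma bop_l2 x : l2 x -> l2 (T x).
Proof. by case: Tb => h _ _ lx; have := h x (mem_set lx); rewrite inE. Qed.

Lemma bop_lin z x y : l2 x -> l2 y ->
  T (fun k => z * x k + y k) = fun j => z * T x j + T y j.
Proof. by case: Tb => _ h _ lx ly; apply/funext => j; apply: h; exact/mem_set. Qed.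

Lemma bop_bound : exists2 K : R, 0 <= K & forall x, l2 x -> l2normsq (T x) <= K * l2normsq x.
Proof.
case: Tb => _ _ [K h]; exists `|K| => // x lx; apply: (le_trans (h x (mem_set lx))).
by rewrite ler_wpM2r ?l2normsq_ge0 ?ler_norm.
Qed.

Lemma bop_zero : T (fun=> 0) = fun=> 0.
Proof.
apply/funext => j.
have := congr1 (fun f => f j) (bop_lin (-1) (@l2_zero R) (@l2_zero R)).
by under eq_fun do rewrite mulr0 addr0; rewrite mulN1r addNr.
Qed.

Lemma unit_seq_l2 n : l2 (fun i => (i == n)%:R : R[i]).
Proof.
have -> : (fun i => (i == n)%:R : R[i]) = trunc n.+1 (fun i => (i == n)%:R).
  apply/funext => i; rewrite /trunc ltnS; case: leqP => // ni.
  by rewrite gtn_eqF.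
exact: trunc_l2.
Qed.

Lemma truncS n x :
  trunc n.+1 x = fun k => x n * (k == n)%:R + trunc n x k.
Proof.
apply/funext => k; rewrite /trunc ltnS leq_eqVlt.
have [->|kn] /= := eqVneq k n; first by rewrite ltnn mulr1 addr0.
by rewrite mulr0 add0r.
Qed.

Lemma trunc0 x : trunc 0 x = fun=> 0.
Proof. exact/funext. Qed.

Lemma bop_trunc n x j : T (trunc n x) j = \sum_(k < n) M j k * x k.
Proof.
elim: n => [|n ih]; first by rewrite trunc0 bop_zero big_ord0.
rewrite truncS bop_lin; [|exact: unit_seq_l2|exact: trunc_l2].
by rewrite ih big_ord_recr /= addrC TM mulrC.
Qed.

Lemma bop_sub_trunc n x : l2 x ->
  T (fun k => x k - trunc n x k) = fun j => T x j - T (trunc n x) j.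
Proof.
move=> lx; have := bop_lin (-1) (@trunc_l2 R n x) lx.
under eq_fun do rewrite mulN1r addrC; move=> ->.
by apply/funext => j; rewrite mulN1r addrC.
Qed.

(** The partial row sum is [T] of a truncation, and boundedness of [T], applied to the tail of [x],
    controls the error in every coordinate. *)
Lemma bop_row x j : l2 x -> ccvg (fun n => \sum_(k < n) M j k * x k) (T x j).
Proof.
move=> lx; have [K K0 TK] := bop_bound.
pose e n := K * (l2normsq x - \sum_(k < n) cmod (x k) ^+ 2).
apply: (@ccvg_le _ _ _ (fun n => Num.sqrt (e n))).
  move=> n; rewrite -bop_trunc cmodBC.
  rewrite -[leLHS]ger0_norm ?cmod_ge0// -sqrtr_sqr ler_wsqrtr//.
  have [lt tle] := sub_trunc_l2 n lx.
  have := cmod_le_l2normsq j (bop_l2 lt); rewrite bop_sub_trunc// => /le_trans; apply.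
  rewrite -bop_sub_trunc//.
  by apply: (le_trans (TK _ lt)); rewrite ler_wpM2l.
rewrite -[X in _ --> X](@sqrtr0 R); apply: (@continuous_cvg _ _ _ _ _ _ Num.sqrt).
  exact: sqrt_continuous.
rewrite -[X in _ --> X](mulr0 K); apply: cvgM; first exact: cvg_cst.
exact: series_tail_cvg0.
Qed.

(** The last move of the arguments with a free parameter. If [d > 0], the choice [t = 2B/d] yields
    [d <= d/2]. *)
Lemma le0_inv_bound (d B : R) : (forall t, 0 < t -> d <= t^-1 * B) -> d <= 0.
Proof.
move=> h; have [//|d0] := leP d 0.
have B0 : 0 < B by have := h 1 ltr01; rewrite invr1 mul1r; exact: lt_le_trans.
have := h (2 * B / d); rewrite !mulr_gt0 ?invr_gt0// => /(_ isT).
have -> : (2 * B / d)^-1 * B = d / 2 by field; rewrite !gt_eqF.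
by move=> ?; lra.
Qed.

Hypothesis Mh : forall j k, conjc (M j k) = M k j.

(** On truncations of [x] this is finite algebra with the columns of [M]; the tail of [x] is removed
    by boundedness of [T]. *)
Lemma bop_sym x y : l2 x -> l2 y -> inner (T x) y = inner x (T y).
Proof.
move=> lx ly; have [K K0 TK] := bop_bound.
(* By hermitian symmetry column [n] is the conjugate of row [n], whose series against [y] converges
   by [bop_row]. *)
have Te n : inner (fun j => M j n) y = conjc (T y n).
  apply: csum_eq; apply: (ccvg_ext (ccvg_conj (bop_row n ly))) => m.
  by rewrite conjc_sum; apply: eq_bigr => k _; rewrite conjcM Mh.
have Tn n : inner (T (trunc n x)) y = \sum_(k < n) x k * conjc (T y k).
  elim: n => [|n ih].
    rewrite trunc0 bop_zero big_ord0; apply: csum_eq.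
    apply: (ccvg_ext (@ccvg_cst R 0)) => n; rewrite big1// => k _.
    by rewrite mul0r.
  rewrite truncS bop_lin; [|exact: unit_seq_l2|exact: trunc_l2].
  rewrite inner_linl//; [|exact: bop_l2 (@unit_seq_l2 n)|exact: bop_l2 (@trunc_l2 R n x)].
  rewrite ih big_ord_recr /= addrC -Te; congr (_ + _).
  by have -> : T (fun i => (i == n)%:R) = fun j => M j n by apply/funext => j; exact: TM.
have [c1 _] := inner_cvg lx (bop_l2 ly).
apply/eqP; rewrite -subr_eq0; apply/eqP/cmod0_eq0/eqP.
rewrite eq_le cmod_ge0 andbT; apply: (@le0_inv_bound _ (l2normsq y)) => t t0.
have h n : cmod (inner (T x) y - \sum_(k < n) x k * conjc (T y k)) <=
    t * (K * (l2normsq x - \sum_(k < n) cmod (x k) ^+ 2)) + t^-1 * l2normsq y.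
  have [lt tle] := sub_trunc_l2 n lx.
  rewrite -Tn; have -> : inner (T x) y - inner (T (trunc n x)) y =
      inner (T (fun k => x k - trunc n x k)) y.
    rewrite bop_sub_trunc//.
    have := inner_linl (-1) (bop_l2 (@trunc_l2 R n x)) (bop_l2 lx) ly.
    under [X in inner X]eq_fun do rewrite mulN1r addrC.
    by move=> ->; rewrite mulN1r addrC.
  apply: (le_trans ((inner_cvg (bop_l2 lt) ly).2 t t0)).
  rewrite lerD2r; apply: (ler_wpM2l (ltW t0)); apply: (le_trans (TK _ lt)).
  apply: (ler_wpM2l K0).
  exact: tle.
rewrite -subr_le0.
have l0 : (fun n => cmod (\sum_(k < n) x k * conjc (T y k) - inner x (T y)) +
    t * (K * (l2normsq x - \sum_(k < n) cmod (x k) ^+ 2))) @ \oo --> (0 : R).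
  rewrite -[X in _ --> X]addr0; apply: cvgD => //.
  rewrite -[X in _ --> X](mulr0 t); apply: cvgM; first exact: cvg_cst.
  rewrite -[X in _ --> X](mulr0 K); apply: cvgM; first exact: cvg_cst.
  exact: series_tail_cvg0.
apply: (cvg_ge_near l0); apply: nearW => n.
rewrite lerBlDr -addrA; apply: le_trans (lerD (lexx _) (h n)).
by apply: le_trans (cmodD _ _); rewrite [X in _ <= cmod X]addrC addrA subrK.
Qed.

End BoundedOperators.

(** At a vector of exponentials the quadratic form of a Toeplitz matrix is [n] times a Fejer mean of
    its symbol, so a bound linear in [n] bounds the means. *)
Lemma bop_quad (R : realType) (T : (nat -> R[i]) -> nat -> R[i]) M :
  bounded_operator T -> has_matrix T M ->
  exists2 K : R, 0 <= K & forall n (y : nat -> R[i]), (forall k, cmod (y k) = 1) ->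
    cmod (\sum_(j < n) \sum_(k < n) conjc (y j) * (M j k * y k)) <= K * n%:R.
Proof.
move=> Tb TM; have [K K0 TK] := bop_bound Tb.
exists (K + 1) => [|n y y1]; first by rewrite addr_ge0.
set v := T (trunc n y).
have ln : l2normsq (trunc n y) <= n%:R.
  apply: (le_trans (trunc_l2normsq n y).2).
  under eq_bigr do rewrite y1 expr1n.
  by rewrite sumr_const card_ord.
(* The linear term is bounded by [|v_j| <= |v_j|^2 + 1]: the squares sum to at most [K n] and the
   ones to [n], hence [K + 1]. *)
apply: (@le_trans _ _ (\sum_(j < n) (cmod (v j) ^+ 2 + 1))).
  apply: (le_trans (cmod_sum _ _ _)); apply: ler_sum => j _.
  rewrite -mulr_sumr cmodM cmod_conj y1 mul1r -(bop_trunc Tb TM) -/v.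
  have := mulr_le_sqr (cmod (v j)) 1 ltr01.
  by rewrite mulr1 invr1 !mul1r expr1n.
rewrite big_split /= sumr_const card_ord mulrDl mul1r lerD2r.
apply: (le_trans (l2_partial n (bop_l2 Tb (@trunc_l2 R n y)))).
by apply: (le_trans (TK _ (@trunc_l2 R n y))); rewrite ler_wpM2l.
Qed.

(** * Real integrals over the circle, with almost everywhere comparison *)

Section RealIntegral.
Context {R : realType}.
Implicit Types (u v w : R -> R) (P Q : R -> Prop).
Local Notation mu := (@lebesgue_measure R).

#[export] Instance ae_lebesgue_filter : Filter (nbhs (almost_everywhere mu)) :=
  ae_filter_ringOfSetsType mu.

Definition aecirc P := {ae mu, forall x, circle x -> P x}.

Lemma aecirc_all P : (forall x, circle x -> P x) -> aecirc P.
Proof. by move=> h; rewrite /aecirc; apply: aeW. Qed.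

Lemma aecirc1 P Q : (forall x, circle x -> P x -> Q x) -> aecirc P -> aecirc Q.
Proof. by move=> h; rewrite /aecirc; apply: filterS => x Px cx; exact: h (Px cx). Qed.

Lemma aecirc2 P1 P2 Q : (forall x, circle x -> P1 x -> P2 x -> Q x) ->
  aecirc P1 -> aecirc P2 -> aecirc Q.
Proof. by move=> h; rewrite /aecirc; apply: filterS2 => x h1 h2 cx; exact: h (h1 cx) (h2 cx). Qed.

Lemma measurable_circle : measurable (circle : set R).
Proof. by rewrite /circle; exact: measurable_itv. Qed.
#[local] Hint Resolve measurable_circle : core.

Lemma circle_measure : mu circle = (2 * pi)%:E.
Proof.
rewrite /circle lebesgue_measure_itv /= lte_fin gtrN ?pi_gt0// -EFinD; congr _%:E.
by ring.
Qed.

Definition integ u := mu.-integrable circle (EFin \o u).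
Definition rint u : R := \int[mu]_(x in circle) u x.

Lemma integ_meas u : integ u -> measurable_fun circle u.
Proof. by move=> /measurable_int /measurable_EFinP. Qed.

Lemma integral_EFin u : integ u ->
  (\int[mu]_(x in circle) (u x)%:E)%E = (rint u)%:E.
Proof. by move=> iu; rewrite /rint /Rintegral fineK// integrable_fin_num. Qed.

Lemma integD u v : integ u -> integ v -> integ (fun x => u x + v x).
Proof.
move=> iu iv; rewrite /integ (_ : _ \o _ = ((EFin \o u) \+ (EFin \o v))%E)//.
exact: integrableD.
Qed.

Lemma integZ (k : R) u : integ u -> integ (fun x => k * u x).
Proof.
move=> iu; rewrite /integ (_ : _ \o _ = (fun x => k%:E * (EFin \o u) x)%E)//.
exact: integrableZl.
Qed.

Lemma integN u : integ u -> integ (fun x => - u x).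
Proof.
by move=> iu; under eq_fun do rewrite -mulN1r; exact: integZ.
Qed.

Lemma integB u v : integ u -> integ v -> integ (fun x => u x - v x).
Proof. by move=> iu iv; apply: integD => //; exact: integN. Qed.

Lemma integ_norm u : integ u -> integ (fun x => `|u x|).
Proof. by move=> iu; have := integrable_abse iu. Qed.

Lemma integ_cst (k : R) : integ (fun=> k).
Proof.
apply/integrableP; split; first exact: measurable_cst.
rewrite (_ : (fun=> _) = cst `|k|%:E)// integral_cst// [X in (_ * X)%E]circle_measure.
by rewrite -EFinM ltry.
Qed.

Lemma rintD u v : integ u -> integ v -> rint (fun x => u x + v x) = rint u + rint v.
Proof. by move=> iu iv; exact: RintegralD. Qed.

Lemma rintZ (k : R) u : integ u -> rint (fun x => k * u x) = k * rint u.
Proof. by move=> iu; exact: RintegralZl. Qed.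

Lemma rintN u : integ u -> rint (fun x => - u x) = - rint u.
Proof. by move=> iu; under eq_fun do rewrite -mulN1r; rewrite rintZ// mulN1r. Qed.

Lemma rintB u v : integ u -> integ v -> rint (fun x => u x - v x) = rint u - rint v.
Proof. by move=> iu iv; rewrite rintD ?rintN//; exact: integN. Qed.

Lemma rint_cst (k : R) : rint (fun=> k) = 2 * pi * k.
Proof. by rewrite /rint Rintegral_cst// [X in fine X]circle_measure /= mulrC. Qed.

Lemma rint_ge0 u : (forall x, circle x -> 0 <= u x) -> 0 <= rint u.
Proof. by move=> u0; exact: Rintegral_ge0. Qed.

Lemma rint_eq_ae u v : measurable_fun circle u -> measurable_fun circle v ->
  aecirc (fun x => u x = v x) -> rint u = rint v.
Proof.
move=> mu_ mv_ uv; rewrite /rint /Rintegral; congr fine.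
apply: ae_eq_integral => //; [exact/measurable_EFinP|exact/measurable_EFinP|].
by move: uv; rewrite /aecirc; apply: filterS => x h cx; rewrite /= h.
Qed.

Lemma integ_dom u w : measurable_fun circle u -> integ w ->
  aecirc (fun x => `|u x| <= w x) -> integ u.
Proof.
move=> mu_ iw uw; apply/integrableP; split; first exact/measurable_EFinP.
apply: (@le_lt_trans _ _ (\int[mu]_(x in circle) `|(EFin \o w) x|)%E).
  apply: ae_ge0_le_integral => //.
  - by apply/measurable_EFinP/measurableT_comp.
  - by apply/measurable_EFinP/measurableT_comp => //; exact: integ_meas.
  - move: uw; rewrite /aecirc; apply: filterS => x h cx.
    by rewrite lee_fin (le_trans (h cx))// ler_norm.
by case/integrableP: iw.
Qed.

Lemma integ_bounded u (k : R) : measurable_fun circle u ->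
  aecirc (fun x => `|u x| <= k) -> integ u.
Proof. by move=> mu_; apply: integ_dom => //; exact: integ_cst. Qed.

Lemma rint_ge0_ae u : integ u -> aecirc (fun x => 0 <= u x) -> 0 <= rint u.
Proof.
move=> iu u0; rewrite -[X in _ <= X](@rint_eq_ae (fun x => `|u x|)).
- exact: rint_ge0.
- exact: integ_meas (integ_norm iu).
- exact: integ_meas.
- by apply: aecirc1 u0 => x _ /ger0_norm.
Qed.

Lemma rint_le_ae u v : integ u -> integ v ->
  aecirc (fun x => u x <= v x) -> rint u <= rint v.
Proof.
move=> iu iv uv; rewrite -subr_ge0 -rintB//; apply: rint_ge0_ae; first exact: integB.
by apply: aecirc1 uv => x _; rewrite subr_ge0.
Qed.

Lemma rint_le u v : integ u -> integ v ->
  (forall x, circle x -> u x <= v x) -> rint u <= rint v.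
Proof. by move=> iu iv uv; apply: rint_le_ae => //; exact: aecirc_all. Qed.

Lemma rint_le0_ae0 u : integ u -> aecirc (fun x => 0 <= u x) -> rint u <= 0 ->
  aecirc (fun x => u x = 0).
Proof.
move=> iu u0 ru.
have e : rint (fun x => `|u x|) = 0.
  apply/eqP; rewrite eq_le rint_ge0// andbT; apply: le_trans ru.
  apply: rint_le_ae => //; first exact: integ_norm.
  by apply: aecirc1 u0 => x _ /ger0_norm ->.
have := (ae_eq_integral_abs mu measurable_circle (measurable_int _ iu)).1.
rewrite (integral_EFin (integ_norm iu)) e => /(_ erefl).
by rewrite /aecirc; apply: filterS => x h cx; have [] := h cx.
Qed.

Lemma measurable_invr : measurable_fun setT (fun x : R => x^-1).
Proof.
(* The factor [x] restores the sign lost in the square, and both sides are 0 at [x = 0]. *)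
have -> : (fun x : R => x^-1) = fun x => x * (x ^+ 2) `^ (-1).
  apply/funext => x; rewrite powR_inv1 ?sqr_ge0//.
  have [->|x0] := eqVneq x 0; first by rewrite mul0r invr0.
  by rewrite expr2 invfM mulrA divff// mul1r.
apply: measurable_funM => //.
apply: (measurableT_comp (@measurable_powR R (-1))); exact: measurable_funX.
Qed.

Lemma measurable_sqrtr : measurable_fun setT (@Num.sqrt R).
Proof. by apply: continuous_measurable_fun; exact: sqrt_continuous. Qed.

End RealIntegral.

(** * Complex integrals over the circle *)

Section ComplexIntegral.
Context {R : realType}.
Implicit Types (u v : R -> R[i]) (f w : R -> R).

Lemma cmeas_real f : measurable_fun circle f -> cmeasurable (fun x => (f x)%:C).
Proof. by move=> mf; split=> //=; exact: measurable_cst. Qed.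

Lemma cmeas_cst (z : R[i]) : cmeasurable (fun=> z).
Proof. by split; exact: measurable_cst. Qed.

Lemma cmeasD u v : cmeasurable u -> cmeasurable v -> cmeasurable (fun x => u x + v x).
Proof.
case=> u1 u2 [v1 v2]; split; [under eq_fun do rewrite ReD|under eq_fun do rewrite ImD];
exact: measurable_funD.
Qed.

Lemma cmeasM u v : cmeasurable u -> cmeasurable v -> cmeasurable (fun x => u x * v x).
Proof.
case=> u1 u2 [v1 v2]; split; [under eq_fun do rewrite ReM|under eq_fun do rewrite ImM].
  by apply: measurable_funB; exact: measurable_funM.
by apply: measurable_funD; exact: measurable_funM.
Qed.

Lemma cmeasN u : cmeasurable u -> cmeasurable (fun x => - u x).
Proof.
by move=> mu_; under eq_fun do rewrite -mulN1r; exact: cmeasM (cmeas_cst _) mu_.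
Qed.

Lemma cmeasB u v : cmeasurable u -> cmeasurable v -> cmeasurable (fun x => u x - v x).
Proof. by move=> mu_ mv_; apply: cmeasD => //; exact: cmeasN. Qed.

Lemma cmeas_conj u : cmeasurable u -> cmeasurable (fun x => conjc (u x)).
Proof.
case=> u1 u2; split; [under eq_fun do rewrite ReJ|under eq_fun do rewrite ImJ] => //.
exact: measurable_funN.
Qed.

Lemma cmeas_sum n (F : 'I_n -> R -> R[i]) : (forall j, cmeasurable (F j)) ->
  cmeasurable (fun x => \sum_(j < n) F j x).
Proof.
move=> mF; elim: n F mF => [|n ih] F mF.
  by under eq_fun do rewrite big_ord0; exact: cmeas_cst.
by under eq_fun do rewrite big_ord_recr /=; apply: cmeasD => //; exact: ih.
Qed.

Lemma cmeas_expi (r : R) : cmeasurable (fun x => expi (r * x)).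
Proof.
split; rewrite /expi /=.
  apply: (@measurableT_comp _ _ _ _ _ _ (@cos R)).
    by apply: continuous_measurable_fun; exact: continuous_cos.
  exact: mulrl_measurable.
apply: (@measurableT_comp _ _ _ _ _ _ (@sin R)).
  by apply: continuous_measurable_fun; exact: continuous_sin.
exact: mulrl_measurable.
Qed.

Lemma cmeas_cmod u : cmeasurable u -> measurable_fun circle (fun x => cmod (u x)).
Proof.
case=> u1 u2; have -> : (fun x => cmod (u x)) =
    fun x => Num.sqrt (complex.Re (u x) ^+ 2 + complex.Im (u x) ^+ 2).
  by apply/funext => x; case: (u x).
apply: (measurableT_comp (@measurable_sqrtr R)).
by apply: measurable_funD; exact: measurable_funX.
Qed.

Definition cinteg u := cmeasurable u /\ integ (fun x => cmod (u x)).

Lemma cinteg_dom u w : cmeasurable u -> integ w ->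
  aecirc (fun x => cmod (u x) <= w x) -> cinteg u.
Proof.
move=> mu_ iw uw; split=> //; apply: integ_dom iw _; first exact: cmeas_cmod.
by apply: aecirc1 uw => x _; rewrite ger0_norm// cmod_ge0.
Qed.

Lemma cinteg_bounded u (k : R) : cmeasurable u ->
  aecirc (fun x => cmod (u x) <= k) -> cinteg u.
Proof. by move=> mu_; apply: cinteg_dom => //; exact: integ_cst. Qed.

Lemma cinteg_Re u : cinteg u -> integ (fun x => complex.Re (u x)).
Proof.
case=> -[mr _] iu; apply: integ_dom mr iu _; apply: aecirc_all => x _.
exact: Re_le_cmod.
Qed.

Lemma cinteg_Im u : cinteg u -> integ (fun x => complex.Im (u x)).
Proof.
case=> -[_ mr] iu; apply: integ_dom mr iu _; apply: aecirc_all => x _.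
exact: Im_le_cmod.
Qed.

Lemma cinteg_real f : integ f -> cinteg (fun x => (f x)%:C).
Proof.
move=> f1; split; first exact: cmeas_real (integ_meas f1).
by under eq_fun do rewrite cmod_real; exact: integ_norm.
Qed.

Lemma cinteg_cst (z : R[i]) : cinteg (fun=> z).
Proof. by split; [exact: cmeas_cst|exact: integ_cst]. Qed.

Lemma cintegD u v : cinteg u -> cinteg v -> cinteg (fun x => u x + v x).
Proof.
case=> mu_ iu [mv_ iv]; apply: (cinteg_dom _ (integD iu iv)); first exact: cmeasD.
by apply: aecirc_all => x _; exact: cmodD.
Qed.

Lemma cintegZ (z : R[i]) u : cinteg u -> cinteg (fun x => z * u x).
Proof.
case=> mu_ iu; apply: (cinteg_dom _ (integZ (cmod z) iu)).
  exact: cmeasM (cmeas_cst _) mu_.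
by apply: aecirc_all => x _; rewrite cmodM.
Qed.

Lemma cintegB u v : cinteg u -> cinteg v -> cinteg (fun x => u x - v x).
Proof.
move=> iu iv; apply: cintegD => //.
by under eq_fun do rewrite -mulN1r; exact: cintegZ.
Qed.

Lemma cinteg_conj u : cinteg u -> cinteg (fun x => conjc (u x)).
Proof.
case=> mu_ iu; split; first exact: cmeas_conj.
by under eq_fun do rewrite cmod_conj.
Qed.

Lemma cinteg_sum n (F : 'I_n -> R -> R[i]) : (forall j, cinteg (F j)) ->
  cinteg (fun x => \sum_(j < n) F j x).
Proof.
move=> mF; elim: n F mF => [|n ih] F mF.
  by under eq_fun do rewrite big_ord0; exact: cinteg_cst.
by under eq_fun do rewrite big_ord_recr /=; apply: cintegD => //; exact: ih.
Qed.

Lemma cinteg_mul_bounded u v (k : R) : cmeasurable u -> cinteg v ->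
  aecirc (fun x => cmod (u x) <= k) -> cinteg (fun x => u x * v x).
Proof.
move=> mu_ [mv_ iv] uk; apply: (cinteg_dom _ (integZ k iv)); first exact: cmeasM.
by apply: aecirc1 uk => x _ uk; rewrite cmodM ler_wpM2r ?cmod_ge0.
Qed.

Lemma cinteg_expi (r : R) u : cinteg u -> cinteg (fun x => expi (r * x) * u x).
Proof.
move=> iu; apply: (@cinteg_mul_bounded _ _ 1) => //; first exact: cmeas_expi.
by apply: aecirc_all => x _; rewrite cmod_expi.
Qed.

Lemma cintegralE u : cintegral u =
  rint (fun x => complex.Re (u x)) +i* rint (fun x => complex.Im (u x)).
Proof. by []. Qed.

Lemma cintegralD u v : cinteg u -> cinteg v ->
  cintegral (fun x => u x + v x) = cintegral u + cintegral v.
Proof.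
move=> iu iv; rewrite !cintegralE; apply: complexP => /=.
  by under eq_fun do rewrite ReD; apply: rintD; exact: cinteg_Re.
by under eq_fun do rewrite ImD; apply: rintD; exact: cinteg_Im.
Qed.

Lemma cintegralZ (z : R[i]) u : cinteg u ->
  cintegral (fun x => z * u x) = z * cintegral u.
Proof.
move=> iu; rewrite !cintegralE; apply: complexP.
  rewrite ReM /=; under eq_fun do rewrite ReM.
  by rewrite rintB ?rintZ//; do ?apply: integZ;
    first [exact: cinteg_Re|exact: cinteg_Im].
rewrite ImM /=; under eq_fun do rewrite ImM.
by rewrite rintD ?rintZ//; do ?apply: integZ;
    first [exact: cinteg_Re|exact: cinteg_Im].
Qed.

Lemma cintegralB u v : cinteg u -> cinteg v ->
  cintegral (fun x => u x - v x) = cintegral u - cintegral v.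
Proof.
move=> iu iv; under eq_fun do rewrite -mulN1r.
by rewrite cintegralD ?cintegralZ ?mulN1r//; exact: cintegZ.
Qed.

Lemma cintegral_conj u : cinteg u ->
  cintegral (fun x => conjc (u x)) = conjc (cintegral u).
Proof.
move=> iu; rewrite !cintegralE; apply: complexP => /=.
  by under eq_fun do rewrite ReJ.
by under eq_fun do rewrite ImJ; rewrite rintN//; exact: cinteg_Im.
Qed.

Lemma cintegral_cst (z : R[i]) : cintegral (fun=> z) = (2 * pi)%:C * z.
Proof.
rewrite cintegralE !rint_cst; apply: complexP; rewrite ?ReM ?ImM /=;
by rewrite !mul0r ?subr0 ?addr0.
Qed.

Lemma cintegral_sum n (F : 'I_n -> R -> R[i]) : (forall j, cinteg (F j)) ->
  cintegral (fun x => \sum_(j < n) F j x) = \sum_(j < n) cintegral (F j).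
Proof.
move=> mF; elim: n F mF => [|n ih] F mF.
  by under eq_fun do rewrite big_ord0; rewrite cintegral_cst mulr0 big_ord0.
under eq_fun do rewrite big_ord_recr /=; rewrite cintegralD//; last exact: cinteg_sum.
by rewrite ih// big_ord_recr.
Qed.

Lemma cintegral_eq_ae u v : cmeasurable u -> cmeasurable v ->
  aecirc (fun x => u x = v x) -> cintegral u = cintegral v.
Proof.
case=> u1 u2 [v1 v2] uv; rewrite !cintegralE; congr Complex.
  by apply: rint_eq_ae => //; apply: aecirc1 uv => x _ ->.
by apply: rint_eq_ae => //; apply: aecirc1 uv => x _ ->.
Qed.

(** Multiplication by the conjugate of the integral makes the integral real, and a real part is at
    most the modulus. *)
Lemma cmod_cintegral u : cinteg u -> cmod (cintegral u) <= rint (fun x => cmod (u x)).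
Proof.
move=> iu; set z := cintegral u.
have [z0|z0] := eqVneq (cmod z) 0.
  by rewrite z0; apply: rint_ge0 => x _; exact: cmod_ge0.
have iz : cinteg (fun x => conjc z * u x) by exact: cintegZ.
have h : cmod z ^+ 2 = rint (fun x => complex.Re (conjc z * u x)).
  have : complex.Re (cintegral (fun x => conjc z * u x)) = cmod z ^+ 2.
    by rewrite cintegralZ// -/z mulrC mulcJ.
  by [].
have : cmod z ^+ 2 <= cmod z * rint (fun x => cmod (u x)).
  rewrite h -rintZ; last by case: iu.
  apply: rint_le; [exact: cinteg_Re|by apply: integZ; case: iu|move=> x _].
  by apply: (le_trans (ler_norm _)); apply: (le_trans (Re_le_cmod _)); rewrite cmodM cmod_conj.
by rewrite expr2 ler_pM2l// lt_neqAle eq_sym z0 cmod_ge0.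
Qed.

Lemma cintegral_real f : integ f -> cintegral (fun x => (f x)%:C) = (rint f)%:C.
Proof. by move=> f1; rewrite cintegralE /= rint_cst mulr0. Qed.

End ComplexIntegral.

(** * Fourier coefficients, Toeplitz action, Parseval and Bessel *)

Section FourierCoefficients.
Context {R : realType}.
Implicit Types (u v m C : R -> R[i]) (f w : R -> R) (c : nat -> R[i]).
Local Notation mu := (@lebesgue_measure R).

Lemma rint_derive (F f : R -> R) : (forall x : R, is_derive x 1 F (f x)) ->
  continuous f -> rint f = F pi - F (- pi).
Proof.
move=> dF cf; have pp : - pi < pi :> R by rewrite gtrN// pi_gt0.
have cF x : {for x, continuous F}.
  by apply: differentiable_continuous; apply/derivable1_diffP; apply: ex_derive.
rewrite /rint /Rintegral /circle (@continuous_FTC2 _ f F)//.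
- exact: continuous_subspaceT.
- split.
  + by move=> x _; apply: ex_derive.
  + by apply: cvg_at_right_filter; exact: cF.
  + by apply: cvg_at_left_filter; exact: cF.
- by move=> x _; rewrite derive1E derive_val.
Qed.

Lemma sin_nat_pi n : sin (n%:R * pi) = 0 :> R.
Proof.
elim: n => [|n ih]; first by rewrite mul0r sin0.
by rewrite -natr1 mulrDl mul1r sinDpi ih oppr0.
Qed.

Lemma is_derive_scale (r x : R) : is_derive x 1 (fun y => r * y) r.
Proof.
by apply: is_derive_eq; rewrite [LHS]mulr1.
Qed.

(** The primitives are [sin(rx)/r] and [-cos(rx)/r]. The boundary terms cancel by the hypothesis on
    the sine and by parity of the cosine. *)
Lemma cintegral_expi (r : R) : r != 0 -> sin (r * pi) = 0 ->
  cintegral (fun x => expi (r * x)) = 0.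
Proof.
move=> r0 srp.
have dZ (F f : R -> R) : (forall x : R, is_derive x 1 F (f x)) ->
    forall x : R, is_derive x 1 (fun y => r^-1 * F (r * y)) (f (r * x)).
  move=> dF x.
  have h := @is_deriveZ _ _ _ (F \o (fun y => r * y)) r^-1 x 1 _
    (is_derive1_comp (dF (r * x)) (is_derive_scale r x)).
  apply: is_derive_eq h _.
  by rewrite [LHS]mulrCA mulVf// mulr1.
have cr : continuous (fun x : R => r * x) by exact: mulrl_continuous.
have dsin : forall x : R, is_derive x 1 (fun y => r^-1 * sin (r * y)) (cos (r * x)).
  by apply: (dZ sin cos).
have dcos : forall x : R, is_derive x 1 (fun y => r^-1 * - cos (r * y)) (sin (r * x)).
  apply: (dZ (fun y => - cos y) sin) => x.
  have h := @is_deriveN _ _ _ cos x 1 _ (is_derive_cos x).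
  by apply: is_derive_eq h _; rewrite opprK.
have h1 : rint (fun x => cos (r * x)) = r^-1 * sin (r * pi) - r^-1 * sin (r * - pi).
  apply: (rint_derive dsin) => x.
  by apply: continuous_comp; [exact: cr|exact: continuous_cos].
have h2 : rint (fun x => sin (r * x)) = r^-1 * - cos (r * pi) - r^-1 * - cos (r * - pi).
  apply: (rint_derive dcos) => x.
  by apply: continuous_comp; [exact: cr|exact: continuous_sin].
rewrite cintegralE /= h1 h2 mulrN sinN cosN srp oppr0 mulr0 !subrr.
by [].
Qed.

Definition avg u : R[i] := ((2 * pi)^-1)%:C * cintegral u.

(** With a real frequency [r], the entry [toeplitz phi j k] is by mere unfolding the coefficient of
    [phi] at [j%:R - k%:R], and negative frequencies need no integer type. *)
Definition FC u (r : R) : R[i] := avg (fun x => expi (- (r * x)) * u x).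

Definition trig (c : nat -> R[i]) n (x : R) : R[i] :=
  \sum_(j < n) c j * expi (j%:R * x).

Lemma pi2_gt0 : 0 < (2 * pi)^-1 :> R.
Proof. by rewrite invr_gt0 mulr_gt0// pi_gt0. Qed.

Lemma avgD u v : cinteg u -> cinteg v -> avg (fun x => u x + v x) = avg u + avg v.
Proof. by move=> iu iv; rewrite /avg cintegralD// mulrDr. Qed.

Lemma avgZ (z : R[i]) u : cinteg u -> avg (fun x => z * u x) = z * avg u.
Proof. by move=> iu; rewrite /avg cintegralZ// mulrCA. Qed.

Lemma avgB u v : cinteg u -> cinteg v -> avg (fun x => u x - v x) = avg u - avg v.
Proof. by move=> iu iv; rewrite /avg cintegralB// mulrBr. Qed.

Lemma avg_conj u : cinteg u -> avg (fun x => conjc (u x)) = conjc (avg u).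
Proof. by move=> iu; rewrite /avg cintegral_conj// conjcM conjc_real. Qed.

Lemma avg_sum n (F : 'I_n -> R -> R[i]) : (forall j, cinteg (F j)) ->
  avg (fun x => \sum_(j < n) F j x) = \sum_(j < n) avg (F j).
Proof. by move=> iF; rewrite /avg cintegral_sum// mulr_sumr. Qed.

Lemma avg_eq_ae u v : cmeasurable u -> cmeasurable v ->
  aecirc (fun x => u x = v x) -> avg u = avg v.
Proof. by move=> mu_ mv_ uv; rewrite /avg (cintegral_eq_ae mu_ mv_). Qed.

Lemma cmod_avg u : cinteg u -> cmod (avg u) <= (2 * pi)^-1 * rint (fun x => cmod (u x)).
Proof.
move=> iu; rewrite cmodM cmod_real gtr0_norm ?pi2_gt0//.
by rewrite ler_pM2l ?pi2_gt0// cmod_cintegral.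
Qed.

Lemma avg_real f : integ f -> avg (fun x => (f x)%:C) = ((2 * pi)^-1 * rint f)%:C.
Proof. by move=> f1; rewrite /avg cintegral_real// -rmorphM. Qed.

Lemma cinteg_expiN (r : R) u : cinteg u -> cinteg (fun x => expi (- (r * x)) * u x).
Proof. by move=> iu; under eq_fun do rewrite -mulNr; exact: cinteg_expi. Qed.

Lemma FCD u v r : cinteg u -> cinteg v -> FC (fun x => u x + v x) r = FC u r + FC v r.
Proof.
move=> iu iv; rewrite /FC; under eq_fun do rewrite mulrDr.
by rewrite avgD//; exact: cinteg_expiN.
Qed.

Lemma FCZ (z : R[i]) u r : cinteg u -> FC (fun x => z * u x) r = z * FC u r.
Proof.
move=> iu; rewrite /FC; under eq_fun do rewrite mulrCA.
by rewrite avgZ//; exact: cinteg_expiN.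
Qed.

Lemma FC_eq_ae u v r : cmeasurable u -> cmeasurable v ->
  aecirc (fun x => u x = v x) -> FC u r = FC v r.
Proof.
move=> mu_ mv_ uv; rewrite /FC; apply: avg_eq_ae.
- by under eq_fun do rewrite -mulNr; exact: cmeasM (cmeas_expi _) mu_.
- by under eq_fun do rewrite -mulNr; exact: cmeasM (cmeas_expi _) mv_.
- by apply: aecirc1 uv => x _ ->.
Qed.

Lemma avg_expi (j k : nat) :
  avg (fun x => expi ((j%:R - k%:R) * x)) = (j == k)%:R.
Proof.
have [->|jk] := eqVneq j k.
  rewrite subrr /avg; under eq_fun do rewrite mul0r expi0.
  rewrite cintegral_cst mulr1 -rmorphM mulVf ?rmorph1//.
  by rewrite -invr_eq0 gt_eqF// pi2_gt0.
rewrite /avg cintegral_expi ?mulr0// ?subr_eq0 ?eqr_nat//.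
by rewrite mulrBl sinB !sin_nat_pi mul0r mulr0 subrr.
Qed.

Lemma FC_expi (j k : nat) : FC (fun x => expi (j%:R * x)) k%:R = (j == k)%:R.
Proof.
rewrite /FC -avg_expi; congr avg; apply/funext => x.
by rewrite -expiD; congr expi; ring.
Qed.

Lemma FC_expi_neg (j k : nat) : FC (fun x => expi (j%:R * x)) (- k.+1%:R) = 0.
Proof.
rewrite /FC (_ : (fun x => _) = fun x => expi (((j + k.+1)%:R - 0%:R) * x)).
  by rewrite avg_expi addnS.
by apply/funext => x; rewrite -expiD; congr expi; rewrite natrD; ring.
Qed.

Lemma cinteg_expi1 (r : R) : cinteg (fun x => expi (r * x)).
Proof.
apply: (@cinteg_bounded _ _ 1); first exact: cmeas_expi.
by apply: aecirc_all => x _; rewrite cmod_expi.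
Qed.

Lemma cmeas_trig c n : cmeasurable (trig c n).
Proof. by apply: cmeas_sum => j; apply: cmeasM (cmeas_cst _) (cmeas_expi _). Qed.

Lemma cinteg_trig c n : cinteg (trig c n).
Proof. by apply: cinteg_sum => j; apply: cintegZ; exact: cinteg_expi1. Qed.

Lemma cmod_trig c n x : cmod (trig c n x) <= \sum_(j < n) cmod (c j).
Proof.
apply: (le_trans (cmod_sum _ _ _)); apply: ler_sum => j _.
by rewrite cmodM cmod_expi mulr1.
Qed.

Lemma cinteg_mul_trig m c n : cinteg m -> cinteg (fun x => m x * trig c n x).
Proof.
move=> im; under eq_fun do rewrite mulrC.
apply: (@cinteg_mul_bounded _ _ _ (\sum_(j < n) cmod (c j))) => //.
  exact: cmeas_trig.
by apply: aecirc_all => x _; exact: cmod_trig.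
Qed.

Lemma avg_mul_trig m c n : cinteg m ->
  avg (fun x => m x * trig c n x) =
  \sum_(j < n) c j * avg (fun x => m x * expi (j%:R * x)).
Proof.
move=> im; rewrite /trig; under eq_fun do rewrite mulr_sumr.
have ie (j : nat) : cinteg (fun x => m x * expi (j%:R * x)).
  by under eq_fun do rewrite mulrC; exact: cinteg_expi.
rewrite avg_sum; last first.
  by move=> j; under eq_fun do rewrite mulrCA; exact: cintegZ.
by apply: eq_bigr => j _; under eq_fun do rewrite mulrCA; rewrite avgZ.
Qed.

Lemma avg_conj_trig u c n : cinteg u ->
  avg (fun x => u x * conjc (trig c n x)) = \sum_(j < n) FC u j%:R * conjc (c j).
Proof.
move=> iu.
have -> : (fun x => u x * conjc (trig c n x)) =
    fun x => conjc (conjc (u x) * trig c n x).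
  by apply/funext => x; rewrite conjcM conjcK.
have icu := cinteg_conj iu.
rewrite avg_conj ?avg_mul_trig ?conjc_sum//; last exact: cinteg_mul_trig.
apply: eq_bigr => j _; rewrite conjcM mulrC; congr (_ * _).
rewrite -avg_conj; last first.
  by under eq_fun do rewrite mulrC; exact: cinteg_expi.
congr avg; apply/funext => x.
by rewrite conjcM conjcK conjc_expi mulrC.
Qed.

Lemma FC_trig c n (j : nat) : (j < n)%N -> FC (trig c n) j%:R = c j.
Proof.
move=> jn; rewrite /FC avg_mul_trig; last first.
  by have := cinteg_expiN j%:R (cinteg_cst 1); under eq_fun do rewrite mulr1.
rewrite (bigD1 (Ordinal jn))//= big1 ?addr0.
  have := FC_expi j j; rewrite /FC eqxx => ->; exact: mulr1.
move=> k /negP kj; have := FC_expi k j; rewrite /FC => ->.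
case: eqP => [e|]; last by rewrite mulr0.
by exfalso; apply: kj; apply/eqP/val_inj.
Qed.

(* L1 convergence covers both uses: C = A with m merely integrable, and a mean
   square sum C with m bounded. *)
Definition fourier_cvg m c C := [/\ cinteg m, cinteg (fun x => m x * C x) &
  (fun n => rint (fun x => cmod (m x * trig c n x - m x * C x))) @ \oo --> (0 : R)].

Lemma fourier_cvg_avg m c C : fourier_cvg m c C ->
  ccvg (fun n => \sum_(j < n) c j * avg (fun x => m x * expi (j%:R * x)))
    (avg (fun x => m x * C x)).
Proof.
case=> im imC cv; apply: (@ccvg_le _ _ _ (fun n => (2 * pi)^-1 *
    rint (fun x => cmod (m x * trig c n x - m x * C x)))).
  move=> n; rewrite -avg_mul_trig// -avgB//; last exact: cinteg_mul_trig.
  by apply: cmod_avg; apply: cintegB => //; exact: cinteg_mul_trig.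
by rewrite -[X in _ --> X](mulr0 (2 * pi)^-1); apply: cvgM => //; exact: cvg_cst.
Qed.

Lemma fourier_cvg_expi (r : R) m c C : fourier_cvg m c C ->
  fourier_cvg (fun x => expi (- (r * x)) * m x) c C.
Proof.
case=> im imC cv; split; first exact: cinteg_expiN.
  by under eq_fun do rewrite -mulrA; exact: cinteg_expiN.
apply: cvg_trans cv; apply: near_eq_cvg; apply: nearW => n.
congr rint; apply/funext => x.
rewrite (_ : expi (- (r * x)) * m x * trig c n x - expi (- (r * x)) * m x * C x =
  expi (- (r * x)) * (m x * trig c n x - m x * C x)); last by ring.
by rewrite cmodM cmod_expi mul1r.
Qed.

(** A Toeplitz matrix multiplies by its symbol and keeps the nonnegative frequencies. The row series
    converges because [phi] times the partial sums converges in L1. *)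
Lemma mxact_toeplitz (phi : R -> R) c C :
  fourier_cvg (fun x => (phi x)%:C) c C -> forall j : nat,
  ccvg (fun n => \sum_(k < n) toeplitz phi j k * c k)
    (FC (fun x => (phi x)%:C * C x) j%:R).
Proof.
move=> h j; have := fourier_cvg_avg (fourier_cvg_expi j%:R h).
rewrite /FC; under [X in _ -> ccvg _ (avg X)]eq_fun do rewrite mulrA.
move=> h'; apply: (ccvg_ext h') => n; apply: eq_bigr => k _; rewrite mulrC.
congr (_ * _); rewrite /toeplitz -/(avg _); congr avg; apply/funext => x.
by rewrite mulrAC -expiD; congr (expi _ * _); ring.
Qed.

(** Parseval in one-sided form: only [C] is expanded, while [u] enters through its coefficients, so
    its negative frequencies may be arbitrary. *)
Lemma inner_FC u c C : fourier_cvg (fun x => conjc (u x)) c C -> cinteg u ->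
  inner (fun j => FC u j%:R) c = avg (fun x => u x * conjc (C x)).
Proof.
move=> h iu; apply: csum_eq; case: (h) => _ iC _.
have := ccvg_conj (fourier_cvg_avg h); rewrite -avg_conj//.
have -> : (fun x => conjc (conjc (u x) * C x)) = fun x => u x * conjc (C x).
  by apply/funext => x; rewrite conjcM conjcK.
move=> h'; apply: (ccvg_ext h') => n.
rewrite -avg_conj_trig// -avg_mul_trig; last exact: cinteg_conj.
rewrite -avg_conj; last by apply: cinteg_mul_trig; exact: cinteg_conj.
by congr avg; apply/funext => x; rewrite conjcM conjcK.
Qed.

(** It will place [R0 a] in l2, the domain on which the hypotheses speak about [B0inv]. *)
Lemma bessel u (k : R) : cmeasurable u -> aecirc (fun x => cmod (u x) <= k) ->
  l2 (fun j => FC u j%:R).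
Proof.
move=> mu_ uk; have iu := cinteg_bounded mu_ uk.
have iu2 : integ (fun x => cmod (u x) ^+ 2).
  apply: (@integ_bounded _ _ (k ^+ 2)).
    by apply: measurable_funX; exact: cmeas_cmod.
  apply: aecirc1 uk => x _ uk; rewrite ger0_norm ?sqr_ge0//.
  by rewrite ler_pXn2r ?nnegrE ?cmod_ge0// (le_trans (cmod_ge0 (u x))).
apply: (proj1 (@l2_bounded _ _ ((2 * pi)^-1 * rint (fun x => cmod (u x) ^+ 2)) _)) => n.
set c := fun j : nat => FC u j%:R; set p := trig c n; set S := \sum_(j < n) _.
have ip : cinteg p by exact: cinteg_trig.
have icp := cinteg_conj ip.
have icu := cinteg_conj iu.
have iup : cinteg (fun x => u x * conjc (p x)).
  apply: (cinteg_mul_bounded _ icp uk); exact: mu_.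
have ipu : cinteg (fun x => p x * conjc (u x)).
  have := cinteg_conj iup; congr cinteg; apply/funext => x.
  by rewrite conjcM conjcK mulrC.
have ipp : cinteg (fun x => p x * conjc (p x)).
  by under eq_fun do rewrite mulrC; exact: cinteg_mul_trig.
(* The two cross terms and the square of the partial sum [p] all have mean [S], so the mean of
   [|u - p|^2] is that of [|u|^2] minus [S]. *)
have e1 : avg (fun x => u x * conjc (p x)) = S%:C.
  rewrite avg_conj_trig// /S rmorph_sum; apply: eq_bigr => j _; exact: mulcJ.
have e2 : avg (fun x => p x * conjc (u x)) = S%:C.
  rewrite -[RHS]conjc_real -e1 -avg_conj//; congr avg; apply/funext => x.
  by rewrite conjcM conjcK mulrC.
have e3 : avg (fun x => p x * conjc (p x)) = S%:C.
  rewrite avg_conj_trig// /S rmorph_sum; apply: eq_bigr => j _.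
  by rewrite FC_trig//; exact: mulcJ.
have e : avg (fun x => (cmod (u x - p x) ^+ 2)%:C) =
    ((2 * pi)^-1 * rint (fun x => cmod (u x) ^+ 2) - S)%:C.
  have -> : (fun x => (cmod (u x - p x) ^+ 2)%:C) =
      fun x => (cmod (u x) ^+ 2)%:C - u x * conjc (p x) - p x * conjc (u x)
               + p x * conjc (p x).
    by apply/funext => x; rewrite -!mulcJ conjcB; ring.
  have i1 := cinteg_real iu2; have i2 := cintegB i1 iup.
  rewrite avgD ?avgB ?e1 ?e2 ?e3 ?avg_real//; last by exact: cintegB.
  by rewrite subrK -rmorphB.
have i0 : integ (fun x => cmod (u x - p x) ^+ 2).
  have -> : (fun x => cmod (u x - p x) ^+ 2) =
      fun x => complex.Re ((cmod (u x) ^+ 2)%:C - u x * conjc (p x)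
               - p x * conjc (u x) + p x * conjc (p x)).
    apply/funext => x; transitivity (complex.Re (cmod (u x - p x) ^+ 2)%:C) => //.
    by congr complex.Re; rewrite -!mulcJ conjcB; ring.
  apply: cinteg_Re; apply: cintegD => //; apply: cintegB => //; apply: cintegB => //.
  exact: cinteg_real.
move: e; rewrite avg_real// => /complexI e; rewrite -subr_ge0 -e.
by rewrite mulr_ge0 ?(ltW pi2_gt0)// rint_ge0// => x _; exact: sqr_ge0.
Qed.

End FourierCoefficients.

(** * The Fejer kernel and Fejer means *)

Section FejerMeans.
Context {R : realType}.
Implicit Types (u v : R -> R[i]) (f g w : R -> R).
Local Notation mu := (@lebesgue_measure R).

(** The usual quotient of squared sines, in a form that needs no case distinction at the zeros of
    [sin (s / 2)]. *)
Definition fejer n (s : R) : R := n%:R^-1 * cmod (\sum_(k < n) expi (k%:R * s)) ^+ 2.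

Lemma fejer_ge0 n s : 0 <= fejer n s.
Proof. by rewrite mulr_ge0 ?sqr_ge0. Qed.

Lemma fejer_expi n s :
  (fejer n s)%:C = n%:R^-1%:C * \sum_(j < n) \sum_(k < n) expi ((j%:R - k%:R) * s).
Proof. by rewrite -expi_sum_sqr; exact: rmorphM. Qed.

(** Concentration of the kernel at 0: since [2 - 2 cos s = |1 - e^{is}|^2], the geometric sum
    telescopes and leaves [|1 - e^{ins}|^2 <= 4]. *)
Lemma fejer_small n s : (0 < n)%N -> fejer n s * (2 - 2 * cos s) <= 4 / n%:R.
Proof.
move=> n0.
have tel : (\sum_(k < n) expi (k%:R * s)) * (1 - expi s) = 1 - expi (n%:R * s).
  elim: n {n0} => [|n ih]; first by rewrite big_ord0 !mul0r expi0 subrr.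
  rewrite big_ord_recr /= mulrDl ih -[in RHS]natr1 mulrDl mul1r expiD; ring.
have c2 : cmod (1 - expi s) ^+ 2 = 2 - 2 * cos s.
  rewrite cmod_sqr ReD ImD ReN ImN /=.
  by have := cos2Dsin2 s; move=> h; rewrite -[in RHS](addrK 1 2); nra.
have c4 : cmod (1 - expi (n%:R * s)) <= 2.
  apply: (le_trans (cmodB _ _)); rewrite cmod_expi.
  have -> : (1 : R[i]) = (1 : R)%:C by []. 
  by rewrite cmod_real normr1.
rewrite /fejer -c2 -mulrA -exprMn -cmodM tel [leRHS]mulrC ler_wpM2l ?invr_ge0//.
have := cmod_ge0 (1 - expi (n%:R * s)); nra.
Qed.

(** The Fejer mean written by coefficients, to be read as a Toeplitz quadratic form or a
    trigonometric polynomial; [sigmaE] gives the kernel form used for estimates. *)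
Definition sigma n u (t : R) : R[i] := n%:R^-1%:C *
  \sum_(j < n) \sum_(k < n) expi ((j%:R - k%:R) * t) * FC u (j%:R - k%:R).

Lemma sigmaE n u t : cinteg u ->
  sigma n u t = avg (fun x => (fejer n (t - x))%:C * u x).
Proof.
move=> iu.
have i1 (j k : nat) : cinteg (fun x => expi ((j%:R - k%:R) * (t - x)) * u x).
  have := cintegZ (expi ((j%:R - k%:R) * t)) (cinteg_expi (- (j%:R - k%:R)) iu).
  congr cinteg; apply/funext => x; rewrite mulrA -expiD; congr (expi _ * _); ring.
have i2 (j : 'I_n) : cinteg (fun x => \sum_(k < n) expi ((j%:R - k%:R) * (t - x)) * u x).
  exact: cinteg_sum.
have -> : (fun x => (fejer n (t - x))%:C * u x) = fun x => n%:R^-1%:C *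
    \sum_(j < n) \sum_(k < n) (expi ((j%:R - k%:R) * (t - x)) * u x).
  apply/funext => x; rewrite fejer_expi -mulrA mulr_suml; congr (_ * _).
  by apply: eq_bigr => j _; rewrite mulr_suml.
rewrite avgZ ?avg_sum//; last exact: cinteg_sum.
congr (_ * _); apply: eq_bigr => j _; rewrite avg_sum//; apply: eq_bigr => k _.
rewrite -avgZ; last exact: cinteg_expiN.
congr avg; apply/funext => x; rewrite mulrA -expiD; congr (expi _ * _); ring.
Qed.

Lemma fejer_meas n t : measurable_fun circle (fun x => fejer n (t - x)).
Proof.
apply: measurable_funM => //; apply: measurable_funX; apply: cmeas_cmod.
apply: cmeas_sum => j.
have := cmeasM (cmeas_cst (expi (j%:R * t))) (cmeas_expi (- j%:R)).
by congr cmeasurable; apply/funext => x; rewrite -expiD; congr expi; ring.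
Qed.

Lemma fejer_le n s : fejer n s <= n%:R.
Proof.
rewrite /fejer; case: n => [|n]; first by rewrite invr0 mul0r.
rewrite ler_pdivrMl ?ltr0n// -expr2 ler_pXn2r ?nnegrE ?cmod_ge0//.
apply: (le_trans (cmod_sum _ _ _)).
by under eq_bigr do rewrite cmod_expi; rewrite sumr_const card_ord.
Qed.

Lemma fejer_integ n t f : integ f -> integ (fun x => fejer n (t - x) * f x).
Proof.
move=> f1; apply: (@integ_dom _ _ (fun x => n%:R * `|f x|)).
- by apply: measurable_funM; [exact: fejer_meas|exact: integ_meas].
- exact: integZ (integ_norm f1).
- apply: aecirc_all => x _; rewrite normrM ger0_norm ?fejer_ge0//.
  by rewrite ler_wpM2r// fejer_le.
Qed.

Lemma fejer_cinteg n t u : cinteg u -> cinteg (fun x => (fejer n (t - x))%:C * u x).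
Proof.
move=> iu; apply: (@cinteg_mul_bounded _ _ _ n%:R) => //.
  exact: cmeas_real (fejer_meas _ _).
by apply: aecirc_all => x _; rewrite cmod_real ger0_norm ?fejer_ge0 ?fejer_le.
Qed.

Lemma FC0E u : FC u 0 = avg u.
Proof. by rewrite /FC; congr avg; apply/funext => x; rewrite mul0r oppr0 expi0 mul1r. Qed.

Lemma avg_cst (z : R[i]) : avg (fun=> z) = z.
Proof.
rewrite /avg cintegral_cst mulrA -rmorphM mulVf ?rmorph1 ?mul1r//.
by rewrite -invr_eq0 gt_eqF// pi2_gt0.
Qed.

Lemma mean_const n (z : R[i]) : (0 < n)%N -> n%:R^-1%:C * (z *+ n) = z.
Proof.
move=> n0; have -> : z *+ n = (n%:R : R)%:C * z by rewrite rmorph_nat mulr_natl.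
by rewrite mulrA -rmorphM mulVf ?rmorph1 ?mul1r// pnatr_eq0 -lt0n.
Qed.

(** The mass of the kernel is the Fejer mean of the constant 1, in which only the [n] diagonal terms
    survive. *)
Lemma rint_fejer n t : (0 < n)%N -> (2 * pi)^-1 * rint (fun x => fejer n (t - x)) = 1.
Proof.
move=> n0; have i1 := fejer_integ n t (integ_cst (1 : R)).
have e : (fun x => fejer n (t - x) * 1) = fun x => fejer n (t - x).
  by apply/funext => x; rewrite mulr1.
rewrite e in i1; apply: complexI; rewrite -avg_real//.
have -> : (fun x => (fejer n (t - x))%:C) = fun x => (fejer n (t - x))%:C * 1.
  by apply/funext => x; rewrite mulr1.
rewrite -sigmaE; last exact: cinteg_cst.
rewrite /sigma (eq_bigr (fun=> 1)); last first.
  move=> j _; rewrite (bigD1 j)//= big1 ?addr0.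
    by rewrite subrr mul0r expi0 FC0E avg_cst mulr1.
  move=> k kj; suff -> : FC (fun=> 1 : R[i]) (j%:R - k%:R) = 0 by rewrite mulr0.
  transitivity (avg (fun x : R => expi ((k%:R - j%:R) * x))).
    by rewrite /FC; congr avg; apply/funext => x; rewrite mulr1; congr expi; ring.
  by rewrite avg_expi val_eqE (negbTE kj).
by rewrite sumr_const card_ord mean_const.
Qed.

Lemma cmod_sigma n u t : cinteg u ->
  cmod (sigma n u t) <= (2 * pi)^-1 * rint (fun x => fejer n (t - x) * cmod (u x)).
Proof.
move=> iu; rewrite sigmaE//; apply: (le_trans (cmod_avg (fejer_cinteg n t iu))).
under eq_fun do rewrite cmodM cmod_real ger0_norm ?fejer_ge0//.
exact: lexx.
Qed.

Lemma sigma_bounded n u t (k : R) : (0 < n)%N -> cinteg u ->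
  aecirc (fun x => cmod (u x) <= k) -> cmod (sigma n u t) <= k.
Proof.
move=> n0 iu uk; apply: (le_trans (cmod_sigma n t iu)).
have -> : k = (2 * pi)^-1 * (rint (fun x => fejer n (t - x)) * k).
  by rewrite mulrA rint_fejer// mul1r.
rewrite ler_pM2l ?pi2_gt0//.
have i1 := fejer_integ n t (integ_cst k).
rewrite [leRHS]mulrC -rintZ; last first.
  have := fejer_integ n t (integ_cst (1 : R)).
  by congr integ; apply/funext => x; rewrite mulr1.
apply: rint_le_ae.
- by apply: fejer_integ; case: iu.
- by have := i1; congr integ; apply/funext => x; rewrite mulrC.
- by apply: aecirc1 uk => x _ uk; rewrite [leRHS]mulrC ler_wpM2l ?fejer_ge0.
Qed.

Lemma sigmaB n u v t : cinteg u -> cinteg v ->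
  sigma n (fun x => u x - v x) t = sigma n u t - sigma n v t.
Proof.
move=> iu iv; rewrite !sigmaE//; last exact: cintegB.
under eq_fun do rewrite mulrBr.
by rewrite avgB//; exact: fejer_cinteg.
Qed.

Lemma sigmaD n u v t : cinteg u -> cinteg v ->
  sigma n (fun x => u x + v x) t = sigma n u t + sigma n v t.
Proof.
move=> iu iv; rewrite !sigmaE//; last exact: cintegD.
under eq_fun do rewrite mulrDr.
by rewrite avgD//; exact: fejer_cinteg.
Qed.

Lemma sigmaZ n u (z : R[i]) t : cinteg u ->
  sigma n (fun x => z * u x) t = z * sigma n u t.
Proof.
move=> iu; rewrite !sigmaE//; last exact: cintegZ.
under eq_fun do rewrite mulrCA.
by rewrite avgZ//; exact: fejer_cinteg.
Qed.

Lemma sigma_cinteg n u : cinteg (sigma n u).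
Proof.
apply: cintegZ; apply: cinteg_sum => j; apply: cinteg_sum => k.
by under eq_fun do rewrite mulrC; apply: cintegZ; exact: cinteg_expi1.
Qed.

Lemma avg_sigma n u : (0 < n)%N -> cinteg u -> avg (sigma n u) = avg u.
Proof.
move=> n0 iu; rewrite /sigma.
have i1 (j k : nat) : cinteg (fun x => expi ((j%:R - k%:R) * x) * FC u (j%:R - k%:R)).
  by under eq_fun do rewrite mulrC; apply: cintegZ; exact: cinteg_expi1.
have i2 (j : 'I_n) : cinteg (fun x =>
    \sum_(k < n) expi ((j%:R - k%:R) * x) * FC u (j%:R - k%:R)) by exact: cinteg_sum.
rewrite avgZ ?avg_sum//; last exact: cinteg_sum.
rewrite (eq_bigr (fun=> avg u)); last first.
  move=> j _; rewrite avg_sum// (bigD1 j)//= big1 ?addr0.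
    rewrite subrr; under eq_fun do rewrite mul0r expi0 mul1r.
    by rewrite avg_cst FC0E.
  move=> k kj; under eq_fun do rewrite mulrC.
  rewrite avgZ ?avg_expi; last exact: cinteg_expi1.
  by rewrite eq_sym val_eqE (negbTE kj) mulr0.
by rewrite sumr_const card_ord mean_const.
Qed.

(* The integral of the trigonometric polynomial sigma n |u| is known, so no
   Fubini theorem is needed. *)
Lemma sigma_l1 n u : (0 < n)%N -> cinteg u ->
  rint (fun x => cmod (sigma n u x)) <= rint (fun x => cmod (u x)).
Proof.
move=> n0 iu; have icu : integ (fun x => cmod (u x)) by case: iu.
have icc := cinteg_real icu.
have h t : cmod (sigma n u t) <= complex.Re (sigma n (fun x => (cmod (u x))%:C) t).
  apply: (le_trans (cmod_sigma n t iu)); rewrite sigmaE//.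
  have -> : (fun x => (fejer n (t - x))%:C * (cmod (u x))%:C) =
      fun x => (fejer n (t - x) * cmod (u x))%:C.
    by apply/funext => x; rewrite realcM.
  by rewrite avg_real//; exact: fejer_integ.
have is1 := sigma_cinteg n (fun x => (cmod (u x))%:C).
apply: (@le_trans _ _ (rint (fun t => complex.Re (sigma n (fun x => (cmod (u x))%:C) t)))).
  apply: rint_le => //; first by case: (sigma_cinteg n u).
  exact: cinteg_Re.
have := congr1 (@complex.Re R) (avg_sigma n0 icc).
have pn0 : (2 * pi)^-1 != 0 :> R by rewrite gt_eqF// pi2_gt0.
by rewrite avg_real// /avg ReM /= mul0r subr0 => /(mulfI pn0) h'; rewrite /rint h'.
Qed.

(** The factor of [K] in the hypothesis is the one absorbed by [fejer_small], which gives [4K/n];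
    the term [e] is met with total mass 1. *)
Lemma sigma_close n g t (e K : R) : (0 < n)%N -> integ g ->
  (forall x, circle x -> `|g x - g t| <= e + K * (2 - 2 * cos (t - x))) -> 0 <= K ->
  cmod (sigma n (fun x => (g x)%:C) t - (g t)%:C) <= e + 4 * K / n%:R.
Proof.
move=> n0 ig gK K0; have n0' : 0 < n%:R :> R by rewrite ltr0n.
have i1 : integ (fun x => fejer n (t - x)).
  by have := fejer_integ n t (integ_cst (1 : R)); congr integ; apply/funext => x; rewrite mulr1.
have e1 : (g t)%:C = sigma n (fun=> (g t)%:C) t.
  rewrite sigmaE; last exact: cinteg_cst.
  under eq_fun do rewrite mulrC.
  by rewrite avgZ ?avg_real ?rint_fejer ?rmorph1 ?mulr1//; exact: cinteg_real.
rewrite [X in _ - X]e1 -sigmaB; [|exact: cinteg_real|exact: cinteg_cst].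
have i2 : cinteg (fun x => (g x)%:C - (g t)%:C).
  by apply: cintegB; [exact: cinteg_real|exact: cinteg_cst].
apply: (le_trans (cmod_sigma n t i2)).
have -> : e + 4 * K / n%:R = (2 * pi)^-1 *
    rint (fun x => e * fejer n (t - x) + 4 * K / n%:R).
  rewrite rintD; [|exact: integZ|exact: integ_cst].
  rewrite rintZ// rint_cst mulrDr mulrCA rint_fejer// mulr1 mulKf//.
  by rewrite -invr_eq0 gt_eqF// pi2_gt0.
rewrite ler_pM2l ?pi2_gt0//; apply: rint_le => [||x cx].
- by apply: fejer_integ; case: i2.
- by apply: integD; [exact: integZ|exact: integ_cst].
- rewrite -rmorphB cmod_real; apply: (le_trans (ler_wpM2l (fejer_ge0 _ _) (gK x cx))).
  rewrite mulrDr [X in X + _ <= _]mulrC lerD2l.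
  have := ler_wpM2l K0 (fejer_small (t - x) n0).
  rewrite (_ : K * (fejer n (t - x) * _) = fejer n (t - x) * (K * (2 - 2 * cos (t - x)))); last by ring.
  by move=> /le_trans; apply; rewrite le_eqVlt; apply/orP; left; apply/eqP; ring.
Qed.

End FejerMeans.

(** * Approximation in L1 by continuous functions vanishing at both ends *)

Section L1Density.
Context {R : realType}.
Implicit Types (f g w : R -> R).
Local Notation mu := (@lebesgue_measure R).

Lemma rint_dct (u_ : nat -> R -> R) f w :
  (forall n, measurable_fun circle (u_ n)) -> measurable_fun circle f -> integ w ->
  aecirc (fun x => u_ ^~ x @ \oo --> f x) ->
  (forall n x, circle x -> `|u_ n x| <= w x) ->
  (fun n => rint (fun x => `|u_ n x - f x|)) @ \oo --> (0 : R).
Proof.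
move=> mu_ mu0 iw cu uw.
have [] := @dominated_convergence _ _ _ mu circle (measurable_circle)
  (fun n => EFin \o u_ n) (EFin \o f) (EFin \o w).
- by move=> n; apply/measurable_EFinP; exact: mu_.
- by apply/measurable_EFinP.
- move: cu; rewrite /aecirc; apply: filterS => x h cx.
  by apply/fine_cvgP; split; [exact: nearW|exact: h].
- exact: iw.
- by apply: aeW => x n cx; rewrite lee_fin uw.
by move=> _ /fine_cvgP[_ c0] _; exact: c0.
Qed.

Lemma cos_lt1 (s : R) : - (2 * pi) < s < 2 * pi -> s != 0 -> cos s < 1.
Proof.
wlog s_gt0 : s / 0 < s.
  move=> wl s1 s0; have [|] := ltP 0 s; first by move=> sp; exact: wl.
  rewrite le_eqVlt (negbTE s0)/= => sn; rewrite -cosN; apply: wl; rewrite ?oppr_eq0 ?oppr_gt0//.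
  by move: s1 => /andP[? ?]; apply/andP; split; lra.
move=> /andP[s1 s2] _.
have e : cos s = 1 - 2 * sin (s / 2) ^+ 2.
  rewrite [in LHS](_ : s = s / 2 + s / 2); last by field.
  by rewrite cosD -!expr2 cos2sin2; ring.
have : 0 < sin (s / 2) by rewrite sin_gt0_pi//; apply/andP; split; lra.
by move=> sp; rewrite e; nra.
Qed.

(** Uniform continuity with the two ends glued together: [2 - 2 cos (t - x)] vanishes only on the
    diagonal and at pairs of opposite ends, where [g x = g t] as well. *)
Lemma periodic_modulus g : continuous g -> g (- pi) = 0 -> g pi = 0 ->
  forall e, 0 < e -> exists2 K : R, 0 <= K & forall x t, circle x -> circle t ->
    `|g x - g t| <= e + K * (2 - 2 * cos (t - x)).
Proof.
move=> cg g1 g2 e e0.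
have cc : compact (circle `*` circle : set (R * R)).
  by apply: compact_setX; exact: segment_compact.
have cG : continuous (fun p : R * R => `|g p.1 - g p.2|).
  move=> p; apply: cvg_norm; apply: cvgB.
    by apply: (@continuous_comp _ _ _ fst g); [exact: cvg_fst|exact: cg].
  by apply: (@continuous_comp _ _ _ snd g); [exact: cvg_snd|exact: cg].
have cC : continuous (fun p : R * R => 2 - 2 * cos (p.2 - p.1)).
  move=> p; apply: cvgB; first exact: cvg_cst.
  apply: cvgM; first exact: cvg_cst.
  apply: (@continuous_comp _ _ _ (fun p : R * R => p.2 - p.1) cos).
    by apply: cvgB; [exact: cvg_snd|exact: cvg_fst].
  exact: continuous_cos.
have c0 s : 0 <= 2 - 2 * cos s :> R by have := cos_le1 s; lra.
(* [K] is sought among the naturals: near each point of the square every large [n] works, and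
   compactness makes the threshold uniform. *)
have := (@compact_near_coveringP _ _).1 cc nat \oo
  (fun n p => `|g p.1 - g p.2| <= e + n%:R * (2 - 2 * cos (p.2 - p.1))) _.
case=> [[x t] [/= cx ct]|N _ h].
  have [lte|gee] := ltP `|g x - g t| e.
    exists ([set p : R * R | `|g p.1 - g p.2| < e], setT) => /=.
      by split; [exact: (@cvgr_lt _ _ _ _ _ _ (cG (x, t)) _ lte)|exact: filterT].
    move=> [p n] /= [pe _]; apply: (le_trans (ltW pe)); rewrite lerDl.
    by rewrite mulr_ge0.
  set c := 2 - 2 * cos (t - x).
  have cp : 0 < c.
    suff : cos (t - x) < 1 by rewrite /c => ?; lra.
    have xt : x != t.
      by apply/eqP => xt; move: gee; rewrite xt subrr normr0 leNgt e0.
    move: cx ct; rewrite /circle /= !in_itv /= => /andP[x1 x2] /andP[t1 t2].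
    apply: cos_lt1; last by rewrite subr_eq0 eq_sym.
    (* A difference of exactly [2 pi] in absolute value occurs only between opposite ends, excluded
       because [g] takes the same value there. *)
    rewrite !lt_neqAle; apply/andP; split; (apply/andP; split; last lra).
      apply/eqP => h; have hx : x = pi by lra.
      have ht : t = - pi by lra.
      by move: gee; rewrite hx ht g1 g2 subrr normr0 leNgt e0.
    apply/eqP => h; have hx : x = - pi by lra.
    have ht : t = pi by lra.
    by move: gee; rewrite hx ht g1 g2 subrr normr0 leNgt e0.
  (* Near [(x, t)] the left side stays below [B] and the cosine term above [c / 2], so every
     [n >= 2B/c] works. *)
  set B := `|g x - g t| + 1.
  have B0 : 0 < B by rewrite /B ltr_wpDl.
  exists ([set p : R * R | `|g p.1 - g p.2| < B /\ c / 2 < 2 - 2 * cos (p.2 - p.1)],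
          [set n | (2 * B / c) <= n%:R]) => /=.
    split.
      apply: filterI.
        by apply: (@cvgr_lt _ _ _ _ _ _ (cG (x, t))); rewrite /B ltrDl.
      by apply: (@cvgr_gt _ _ _ _ _ _ (cC (x, t))); rewrite -/c; lra.
    exact: nbhs_infty_ger.
  move=> [p n] /= [[pB pc] nB]; apply: (le_trans (ltW pB)).
  have h1 : 2 * B <= n%:R * c by rewrite -ler_pdivrMr.
  have n0 : 0 <= n%:R :> R by [].
  nra.
exists N%:R => // x t cx ct.
by have := h N (leqnn N) (x, t) (conj cx ct).
Qed.

Lemma circle_interior_ae : aecirc (fun x : R => `|x| < pi).
Proof.
exists [set -pi; pi]; split.
- by apply: measurableU; exact: measurable_set1.
- by rewrite (@null_set_setU _ _ _ mu)//; exact: lebesgue_measure_set1.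
- move=> x /= /not_implyP[cx /negP]; rewrite -leNgt => h.
  move: cx; rewrite /circle /= in_itv /= => /andP[x1 x2].
  by have [x0|x0] := lerP 0 x; move: h; [rewrite ger0_norm//|rewrite ltr0_norm//] => h;
    [right|left]; apply/eqP; rewrite eq_le; apply/andP; split; lra.
Qed.

(** A continuous approximation need not agree at the two ends, as [periodic_modulus] demands; a
    cut-off repairs this at small cost in L1. *)
Lemma periodic_dense f : integ f -> forall e, 0 < e -> exists g,
  [/\ continuous g, g (- pi) = 0, g pi = 0, integ g & rint (fun x => `|f x - g x|) < e].
Proof.
move=> f1 e e0.
have fin : (mu circle < +oo)%E by rewrite circle_measure ltry.
have [g_ [cg ig /fine_cvgP[_ h]]] :=
  approximation_continuous_integrable measurable_circle fin f1.
have h' : (fun n => rint (fun x => `|f x - g_ n x|)) @ \oo --> (0 : R) by exact: h.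
have e2 : 0 < e / 2 by lra.
have [N _ hN] := @cvgr_lt _ _ _ _ _ _ h' _ e2.
set g := g_ N; have iG : integ g by exact: ig.
(* The cut-off is 0 at both ends for every [n] and tends to 1 strictly inside; the ends form a null
   set, so dominated convergence applies. *)
pose chi n (x : R) : R := 1 - ((x / pi) ^+ 2) ^+ n.
have pi0 : pi != 0 :> R by rewrite gt_eqF// pi_gt0.
have chi01 n x : circle x -> 0 <= chi n x <= 1.
  rewrite /circle /= in_itv /= => /andP[x1 x2].
  have h1 : (x / pi) ^+ 2 <= 1.
    have hx : `|x / pi| <= 1.
      by rewrite normrM normfV (gtr0_norm (pi_gt0 R)) ler_pdivrMr ?pi_gt0// mul1r ler_norml x1.
    by rewrite -real_normK ?num_real// exprn_ile1.
  have h0 : 0 <= (x / pi) ^+ 2 by exact: sqr_ge0.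
  rewrite /chi subr_ge0 lerBlDr lerDl exprn_ge0// andbT.
  by rewrite exprn_ile1.
have cchi n : continuous (chi n).
  move=> x; apply: cvgB; first exact: cvg_cst.
  apply: (@continuous_comp _ _ _ (fun x : R => (x / pi) ^+ 2) (fun y => y ^+ n)).
    apply: (@continuous_comp _ _ _ (fun x : R => x / pi) (fun y => y ^+ 2)).
      exact: mulrr_continuous.
    exact: exprn_continuous.
  exact: exprn_continuous.
have mchi n : measurable_fun circle (chi n).
  by apply: measurable_funTS; exact: continuous_measurable_fun.
have hb n x : circle x -> `|g x * chi n x| <= `|g x|.
  move=> cx; rewrite normrM -[leRHS]mulr1 ler_wpM2l//.
  by have /andP[? ?] := chi01 n x cx; rewrite ger0_norm.
have hc : (fun n => rint (fun x => `|g x * chi n x - g x|)) @ \oo --> (0 : R).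
  apply: (@rint_dct _ _ (fun x => `|g x|)) => //.
  - by move=> n; apply: measurable_funM => //; exact: integ_meas.
  - exact: integ_meas.
  - exact: integ_norm.
  - apply: aecirc1 circle_interior_ae => x _ xp.
    rewrite -[X in _ --> X]mulr1; apply: cvgM; first exact: cvg_cst.
    rewrite -[X in _ --> X]subr0; apply: cvgB; first exact: cvg_cst.
    apply: cvg_expr; rewrite normrX normrM normfV (gtr0_norm (pi_gt0 R)).
    rewrite expr_lt1// ?mulr_ge0 ?invr_ge0 ?(ltW (pi_gt0 R))//.
    by rewrite ltr_pdivrMr ?pi_gt0// mul1r.
have [M _ hM] := @cvgr_lt _ _ _ _ _ _ hc _ e2.
have iM : integ (fun x => g x * chi M x).
  apply: (integ_dom _ (integ_norm iG)); last by apply: aecirc_all => x; exact: hb.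
  by apply: measurable_funM => //; exact: integ_meas.
exists (fun x => g x * chi M x); split => //.
- by move=> x; apply: cvgM; [exact: cg|exact: cchi].
- by rewrite /chi mulNr divff// sqrrN !expr1n subrr mulr0.
- by rewrite /chi divff// !expr1n subrr mulr0.
- apply: (@le_lt_trans _ _ (rint (fun x => `|f x - g x|) +
      rint (fun x => `|g x * chi M x - g x|))); last first.
    by have := hN N (leqnn N); have := hM M (leqnn M); rewrite /= /g; lra.
  have i1 := integ_norm (integB f1 iG); have i2 := integ_norm (integB iM iG).
  rewrite -rintD//; apply: rint_le => [||x _].
  + exact: integ_norm (integB f1 iM).
  + exact: integD.
  + rewrite (distrC (g x * chi M x)); apply: le_trans (ler_normD _ _).
    by rewrite addrA subrK.
Qed.

End L1Density.

(** * Fejer's theorem in L1 and boundedness of Toeplitz symbols *)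

Section FejerTheorem.
Context {R : realType}.
Implicit Types (u v h : R -> R[i]) (f g w : R -> R).
Local Notation mu := (@lebesgue_measure R).

Lemma l1_triangle (u v h : R -> R[i]) : cinteg u -> cinteg v -> cinteg h ->
  rint (fun x => cmod (u x - h x)) <=
  rint (fun x => cmod (u x - v x)) + rint (fun x => cmod (v x - h x)).
Proof.
move=> iu iv ih.
have [_ i1] := cintegB iu iv; have [_ i2] := cintegB iv ih; have [_ i3] := cintegB iu ih.
rewrite -rintD//; apply: rint_le => // [|x _]; first exact: integD.
by apply: le_trans (cmodD _ _); rewrite addrA subrK.
Qed.

(** With [g] close to [f], the error splits into three parts: [sigma_l1] carries closeness over to
    the means, and [sigma_close] treats [g] itself. *)
Lemma fejer_real f : integ f -> forall e, 0 < e -> exists N, forall n, (N < n)%N ->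
  rint (fun x => cmod (sigma n (fun x => (f x)%:C) x - (f x)%:C)) < e.
Proof.
move=> f1 e e0; have e3 : 0 < e / 4 by lra.
have [g [cg g1 g2 ig fg]] := periodic_dense f1 e3.
have d0 : 0 < e / 4 / (2 * pi) / 2 by rewrite !divr_gt0// mulr_gt0// pi_gt0.
(* The constant [d + d] integrates to [e / 4] over the circle: one [d] for the modulus of [g], one
   for [4K/n]. *)
set d := e / 4 / (2 * pi) / 2 in d0.
have [K K0 gK] := periodic_modulus cg g1 g2 d0.
have [N _ hN] : \forall n \near \oo, 4 * K / d <= n%:R by exact: nbhs_infty_ger.
exists N => n Nn; have n0 : (0 < n)%N by exact: leq_trans Nn.
have if_ := cinteg_real f1; have ig_ := cinteg_real ig.
have s1 := sigma_cinteg n (fun x => (f x)%:C); have s2 := sigma_cinteg n (fun x => (g x)%:C).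
have t1 := l1_triangle s1 s2 if_; have t2 := l1_triangle s2 ig_ if_.
have b1 : rint (fun x => cmod (sigma n (fun x => (f x)%:C) x -
    sigma n (fun x => (g x)%:C) x)) < e / 4.
  under eq_fun do rewrite -sigmaB//.
  apply: (le_lt_trans (sigma_l1 n0 (cintegB if_ ig_))).
  by under eq_fun do rewrite -realcB cmod_real.
have b2 : rint (fun x => cmod (sigma n (fun x => (g x)%:C) x - (g x)%:C)) <= e / 4.
  apply: (@le_trans _ _ (rint (fun=> d + d))).
    apply: rint_le => [||x cx]; [by case: (cintegB s2 ig_)|exact: integ_cst|].
    apply: (le_trans (sigma_close n0 ig (fun t ct => gK t x ct cx) K0)).
    rewrite lerD2l ler_pdivrMr ?ltr0n// [leRHS]mulrC -ler_pdivrMr//.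
    exact: (hN n (ltnW Nn)).
  rewrite rint_cst /d le_eqVlt; apply/orP; left; apply/eqP.
  have pi0 : pi != 0 :> R by rewrite gt_eqF// pi_gt0.
  by move: (@pi R) pi0 => p p0; field.
have b3 : rint (fun x => cmod ((g x)%:C - (f x)%:C)) < e / 4.
  by under eq_fun do rewrite cmodBC -realcB cmod_real.
have e4 : e / 4 + (e / 4 + e / 4) < e by clear -e0; lra.
apply: (le_lt_trans t1); apply: lt_trans e4; apply: ltr_leD b1 _.
exact: le_trans t2 (lerD b2 (ltW b3)).
Qed.

Lemma fejer_cvg u : cinteg u -> forall e, 0 < e -> exists n, (0 < n)%N /\
  rint (fun x => cmod (sigma n u x - u x)) < e.
Proof.
move=> iu e e0; have e2 : 0 < e / 2 by lra.
have [N1 h1] := fejer_real (cinteg_Re iu) e2.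
have [N2 h2] := fejer_real (cinteg_Im iu) e2.
set n := (N1 + N2).+1; exists n; split=> //.
have := h1 n; rewrite ltnS leq_addr => /(_ isT) {}h1.
have := h2 n; rewrite ltnS leq_addl => /(_ isT) {}h2.
have ir := cinteg_real (cinteg_Re iu); have ii := cinteg_real (cinteg_Im iu).
set fr := fun x => (complex.Re (u x))%:C in ir h1.
set fi := fun x => (complex.Im (u x))%:C in ii h2.
have ue : u = fun x => fr x + 'i * fi x.
  by apply/funext => x; rewrite /fr /fi -complexE.
have i2 : cinteg (fun x => 'i * fi x) by exact: cintegZ.
have c1 : cmod 'i = 1 :> R by rewrite /cmod /= expr0n /= expr1n add0r sqrtr1.
have [_ j1] := cintegB (sigma_cinteg n fr) ir.
have [_ j2] := cintegB (sigma_cinteg n fi) ii.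
have [_ j3] := cintegB (sigma_cinteg n u) iu.
apply: (@le_lt_trans _ _ (rint (fun x => cmod (sigma n fr x - fr x)) +
    rint (fun x => cmod (sigma n fi x - fi x)))); last by rewrite [ltRHS]splitr ltrD.
rewrite -rintD//; apply: rint_le => // [|x _]; first exact: integD.
rewrite ue sigmaD// sigmaZ//.
rewrite (_ : _ - _ = sigma n fr x - fr x + 'i * (sigma n fi x - fi x)); last by ring.
by apply: (le_trans (cmodD _ _)); rewrite cmodM c1 mul1r.
Qed.

Lemma toeplitz_bounded_symbol f T : integ f -> bounded_operator T ->
  has_matrix T (toeplitz f) -> exists K : R, aecirc (fun x => `|f x| <= K).
Proof.
move=> f1 Tb TM; have [K K0 h] := bop_quad Tb TM.
have if_ := cinteg_real f1.
have sK n t : (0 < n)%N -> cmod (sigma n (fun x => (f x)%:C) t) <= K.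
  move=> n0; rewrite /sigma cmodM cmod_real ger0_norm ?invr_ge0//.
  rewrite mulrC ler_pdivrMr ?ltr0n//.
  (* At this unimodular vector the quadratic form is [n] times the Fejer mean at [t]. *)
  apply: le_trans (h n (fun k => expi (- (k%:R * t))) (fun k => cmod_expi _)).
  rewrite le_eqVlt; apply/orP; left; apply/eqP; congr cmod.
  apply: eq_bigr => j _; apply: eq_bigr => k _.
  rewrite conjc_expi -[toeplitz f j k]/(FC (fun x => (f x)%:C) (j%:R - k%:R)).
  by rewrite [RHS]mulrA [RHS]mulrAC -expiD; congr (expi _ * _); ring.
exists K.
(* Twice the positive part of [|f| - K]. As the means stay below [K], it is at most twice their
   distance to [f], which is small in L1. *)
pose p x := (`|f x| - K) + Num.norm (`|f x| - K).
have ip0 : integ (fun x => `|f x| - K) by apply: integB (integ_norm f1) (integ_cst K).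
have ip : integ p by apply: integD ip0 (integ_norm ip0).
have p0 x : 0 <= p x by have := ler_norm (- (`|f x| - K)); rewrite normrN /p -subr_ge0 opprK addrC.
have rp : rint p <= 0.
  rewrite leNgt; apply/negP => rp.
  have rp2 : 0 < rint p / 2 by lra.
  have [n [n0 hn]] := fejer_cvg if_ rp2.
  have [_ i1] := cintegB (sigma_cinteg n (fun x => (f x)%:C)) if_.
  suff : rint p <= 2 * rint (fun x => cmod (sigma n (fun x => (f x)%:C) x - (f x)%:C)).
    by move=> ?; lra.
  rewrite -rintZ//; apply: rint_le => // [|x _]; first exact: integZ.
  have h1 : `|f x| - K <= cmod (sigma n (fun x => (f x)%:C) x - (f x)%:C).
    rewrite lerBlDr -cmod_real cmodBC; apply: le_trans (lerD (lexx _) (sK n x n0)).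
    by apply: le_trans (cmodD _ _); rewrite subrK.
  have h0 := cmod_ge0 (sigma n (fun x => (f x)%:C) x - (f x)%:C).
  by rewrite /p; have [y0|y0] := ger0P (`|f x| - K); lra.
have := rint_le0_ae0 ip (aecirc_all (fun x _ => p0 x)) rp.
apply: aecirc1 => x _; rewrite /p -subr_le0.
by have [y0|y0] := ger0P (`|f x| - K) => pe; lra.
Qed.

End FejerTheorem.

(** * Bounded functions in the weighted space of negative frequencies *)

Section SquareIntegral.
Context {R : realType}.
Implicit Types (u v h : R -> R[i]) (f g w : R -> R).
Local Notation mu := (@lebesgue_measure R).

Lemma integ_of_finite f : measurable_fun circle f -> (forall x, circle x -> 0 <= f x) ->
  (\int[mu]_(x in circle) (f x)%:E < +oo)%E -> integ f.
Proof.
move=> mf f0 fin; apply/integrableP; split; first exact/measurable_EFinP.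
apply: le_lt_trans fin; rewrite le_eqVlt; apply/orP; left; apply/eqP.
by apply: eq_integral => x /set_mem cx; rewrite gee0_abs// lee_fin f0.
Qed.

(** Fejer means converge in L1 while staying bounded, which upgrades to the weighted square norm:
    against [min(w, k)] one factor of the square and the weight are bounded, and [w - min(w, k)] has
    small integral. *)
Lemma L20_bounded h (M : R) w : cmeasurable h -> aecirc (fun x => cmod (h x) <= M) ->
  (forall j : nat, FC h j%:R = 0) -> integ w -> (forall x, circle x -> 0 <= w x) ->
  L20 w h.
Proof.
move=> mh hM h0 iw w0; have ih := cinteg_bounded mh hM.
have iq p (L : R) : cmeasurable p -> aecirc (fun x => cmod (p x) <= L) ->
    integ (fun x => cmod (p x) ^+ 2 * w x).
  move=> mp pL; apply: (integ_dom _ (integZ (L ^+ 2) iw)).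
    apply: measurable_funM; last exact: integ_meas.
    by apply: measurable_funX; exact: cmeas_cmod.
  apply: aecirc2 pL (aecirc_all w0) => x _ pL wx.
  rewrite ger0_norm; last by rewrite mulr_ge0// sqr_ge0.
  apply: ler_wpM2r => //.
  by rewrite ler_pXn2r ?nnegrE ?cmod_ge0// (le_trans (cmod_ge0 (p x))).
split=> //; first by rewrite integral_EFin ?ltry//; exact: iq mh hM.
move=> e e0.
(* [L] bounds [|h - sigma n h|], both terms being at most [|M|]; the added 1 makes it a legitimate
   divisor. *)
set L := `|M| + `|M| + 1; have L0 : 0 < L by rewrite ltr_wpDl// addr_ge0.
have hL : aecirc (fun x => cmod (h x) <= `|M|).
  by apply: aecirc1 hM => x _ /le_trans; apply; exact: ler_norm.
pose wk (k : nat) x := Num.min (w x) k%:R.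
have mwk k : measurable_fun circle (wk k).
  have -> : wk k = fun x => (w x + k%:R) / 2 - `|w x - k%:R| / 2.
    by apply/funext => x; rewrite /wk; case: (lerP (w x) k%:R) => _; field.
  have mw := integ_meas iw.
  apply: measurable_funB; apply: measurable_funM => //.
    exact: measurable_funD.
  by apply: measurableT_comp => //; exact: measurable_funB.
have wkw k x : circle x -> 0 <= wk k x <= w x.
  by move=> cx; rewrite /wk le_min w0// ler0n ge_min lexx.
have ck : (fun k => rint (fun x => `|wk k x - w x|)) @ \oo --> (0 : R).
  apply: (@rint_dct _ _ w w) => //; first exact: integ_meas.
    apply: aecirc_all => x cx.
    apply: (@cvg_trans _ (w x @[_ --> \oo])); last exact: cvg_cst.
    apply: near_eq_cvg; near=> k; rewrite /wk min_l//.
    by near: k; exact: nbhs_infty_ger.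
  by move=> k x cx; have /andP[? ?] := wkw k x cx; rewrite ger0_norm.
have eL : 0 < e / 2 / L ^+ 2 by rewrite !divr_gt0// exprn_gt0.
have [k _ hk] := @cvgr_lt _ _ _ _ _ _ ck _ eL.
have {}hk := hk k (leqnn k); rewrite /= in hk.
(* The successor keeps the divisor positive when [k = 0]. *)
have ek : 0 < e / 2 / (L * k.+1%:R) by rewrite !divr_gt0// mulr_gt0.
have [n [n0 hn]] := fejer_cvg ih ek.
set F := fun m : nat => FC h (- m.+1%:R).
(* Index [m] stands for frequency [-(m + 1)]; the inner sums count the pairs [i, j] with
   [j = i + m + 1]. *)
pose c (m : nat) : R[i] := n%:R^-1%:C *
  \sum_(i < n) \sum_(j < n) ((j : nat) == (i + m.+1)%N)%:R * F m.
have sE x : sigma n h x = \sum_(m < n) c m * expi (- (m.+1%:R * x)).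
  rewrite /sigma /c; under [RHS]eq_bigr do rewrite -mulrA.
  rewrite -mulr_sumr; congr (_ * _).
  under [RHS]eq_bigr do rewrite mulr_suml.
  rewrite [RHS]exchange_big /=; apply: eq_bigr => i _.
  under [RHS]eq_bigr do rewrite mulr_suml.
  rewrite [RHS]exchange_big /=; apply: eq_bigr => j _.
  (* Pairs with [i < j] go to index [j - i - 1]; the others carry a nonnegative frequency, whose
     coefficient is 0. *)
  have [ij|ji] := ltnP i j.
    have jl : (j - i.+1 < n)%N by rewrite (leq_ltn_trans (leq_subr _ _)).
    rewrite (bigD1 (Ordinal jl))//= big1 ?addr0.
      have je : (i + (j - i.+1).+1)%N = j by rewrite -addSnnS subnKC.
      rewrite je eqxx mul1r mulrC /F.
      have -> : i%:R - j%:R = - (j - i.+1).+1%:R :> R by rewrite -[in LHS]je natrD; ring.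
      by rewrite mulNr.
    move=> m mj; case: eqP => [jm|]; last by rewrite mul0r mul0r.
    exfalso; move/negP: mj; apply; apply/eqP/val_inj => /=.
    by rewrite jm addnS -addSn addKn.
  rewrite -natrB// h0 mulr0 big1// => m _.
  by rewrite ltn_eqF ?mul0r// addnS ltnS (leq_trans ji)// leq_addr.
exists n, c; set p := fun x => _.
have pe : (fun x => (cmod (h x - \sum_(j < n) c j * expi (- (j.+1%:R * x))) ^+ 2 * w x)%:E)
    = fun x => (cmod (h x - sigma n h x) ^+ 2 * w x)%:E.
  by apply/funext => x; rewrite sE.
rewrite {}/p pe.
have is1 := sigma_cinteg n h.
have md : cmeasurable (fun x => h x - sigma n h x) by apply: cmeasB => //; case: is1.
have dL : aecirc (fun x => cmod (h x - sigma n h x) <= L).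
  apply: aecirc1 (hL) => x _ hx; apply: (le_trans (cmodB _ _)).
  by have := sigma_bounded x n0 ih hL; rewrite /L; lra.
have id := iq _ _ md dL.
rewrite integral_EFin// lte_fin.
have [_ i1] := cintegB is1 ih.
have i2 : integ (fun x => `|wk k x - w x|).
  apply: integ_norm; apply: integB => //; apply: (integ_dom (mwk k) iw).
  by apply: aecirc_all => x cx; have /andP[? ?] := wkw k x cx; rewrite ger0_norm.
apply: (@le_lt_trans _ _ (rint (fun x => L * k.+1%:R * cmod (sigma n h x - h x) +
    L ^+ 2 * `|wk k x - w x|))).
  apply: rint_le_ae => //; first by apply: integD; exact: integZ.
  apply: aecirc1 dL => x cx dx; rewrite (cmodBC (sigma n h x)).
  have /andP[k0 kw] := wkw k x cx; rewrite ler0_norm ?subr_le0// opprB.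
  set d := cmod _ in dx *; have d0 : 0 <= d := cmod_ge0 _.
  rewrite [X in _ * X <= _](_ : w x = wk k x + (w x - wk k x)); last by ring.
  rewrite mulrDr lerD//; last first.
    by rewrite ler_wpM2r ?subr_ge0// ler_pXn2r ?nnegrE// ltW.
  have kk : wk k x <= k.+1%:R.
    by rewrite /wk ge_min ler_nat leqnSn orbT.
  rewrite expr2 mulrAC -[leRHS]mulrA [leRHS]mulrA -[leRHS]mulrA.
  apply: (@le_trans _ _ (L * (k.+1%:R * d))); last by rewrite le_eqVlt; apply/orP; left; apply/eqP; ring.
  rewrite -mulrA [d * (wk k x * d)]mulrC mulrC.
  apply: ler_pM => //; first by rewrite mulr_ge0.
  by rewrite ler_wpM2r.
rewrite rintD ?rintZ//; [|exact: integZ|exact: integZ].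
have h1 : L * k.+1%:R * rint (fun x => cmod (sigma n h x - h x)) < e / 2.
  by rewrite mulrC -ltr_pdivlMr ?mulr_gt0.
have h2 : L ^+ 2 * rint (fun x => `|wk k x - w x|) < e / 2.
  by rewrite mulrC -ltr_pdivlMr ?exprn_gt0.
by lra.
Unshelve. all: by end_near. Qed.

End SquareIntegral.

(** * The functions [A] (uniform sum) and [C] (mean square sum) *)

Section SpectralFunctions.
Context {R : realType}.
Implicit Types (m C : R -> R[i]) (a c : nat -> R[i]).
Local Notation mu := (@lebesgue_measure R).

Section AbsolutelySummable.
Variable a : nat -> R[i].
Hypothesis a_abs : cvgn (series (fun j => cmod (a j))).

Lemma Afun_trig x : ccvg (fun n => trig a n x) (Afun a x) /\
  forall n, cmod (Afun a x - trig a n x) <=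
    limn (series (fun j => cmod (a j))) - \sum_(j < n) cmod (a j).
Proof.
have e : (fun j => cmod (a j * expi (j%:R * x))) = fun j => cmod (a j).
  by apply/funext => j; rewrite cmodM cmod_expi mulr1.
have := @csum_cvg R (fun j => a j * expi (j%:R * x)); rewrite e => /(_ a_abs)[h1 h2].
split=> // n; apply: (le_trans (h2 n)); rewrite lerD2l lerN2.
by apply: ler_sum => j _; rewrite cmodM cmod_expi mulr1.
Qed.

Lemma Afun_bounded x : cmod (Afun a x) <= limn (series (fun j => cmod (a j))).
Proof.
have [_ /(_ 0%N)] := Afun_trig x.
by rewrite /trig !big_ord0 !subr0.
Qed.

Lemma cmeas_Afun : cmeasurable (Afun a).
Proof.
split.
  apply: (@measurable_fun_cvg _ _ _ _ (fun n x => complex.Re (trig a n x))).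
    by move=> n; case: (cmeas_trig a n).
  by move=> x _; exact: ccvg_Re (Afun_trig x).1.
apply: (@measurable_fun_cvg _ _ _ _ (fun n x => complex.Im (trig a n x))).
  by move=> n; case: (cmeas_trig a n).
by move=> x _; exact: ccvg_Im (Afun_trig x).1.
Qed.

Lemma cinteg_mul_Afun m : cinteg m -> cinteg (fun x => m x * Afun a x).
Proof.
move=> im; under eq_fun do rewrite mulrC.
apply: (cinteg_mul_bounded cmeas_Afun im).
by apply: aecirc_all => x _; exact: Afun_bounded.
Qed.

(** The series of [A] converges uniformly, so any integrable factor is admissible. *)
Lemma fourier_cvg_Afun m : cinteg m -> fourier_cvg m a (Afun a).
Proof.
move=> im; split=> //; first exact: cinteg_mul_Afun.
apply: (@squeeze_cvgr _ _ _ _ (fun=> 0) (fun n =>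
  (limn (series (fun j => cmod (a j))) - \sum_(j < n) cmod (a j)) *
  rint (fun x => cmod (m x)))); last 2 first.
- exact: cvg_cst.
- rewrite -[X in _ --> X](mul0r (rint (fun x => cmod (m x)))).
  by apply: cvgM; [exact: series_tail_cvg0|exact: cvg_cst].
apply: nearW => n; rewrite rint_ge0/=; last by move=> x _; exact: cmod_ge0.
have [_ i1] := cintegB (cinteg_mul_trig a n im) (cinteg_mul_Afun im).
have [_ i2] := im.
rewrite -rintZ//; apply: rint_le => // [|x _]; first exact: integZ.
by rewrite -mulrBr cmodM mulrC ler_wpM2r ?cmod_ge0// cmodBC; exact: (Afun_trig x).2.
Qed.

Lemma FC_Afun (j : nat) : FC (Afun a) j%:R = a j.
Proof.
have i1 : cinteg (fun x : R => expi (- (j%:R * x)) * 1).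
  exact: cinteg_expiN (cinteg_cst 1).
have e : (fun x : R => expi (- (j%:R * x)) * 1) = fun x => expi (- (j%:R * x)).
  by apply/funext => x; rewrite mulr1.
rewrite e in i1; have h := fourier_cvg_avg (fourier_cvg_Afun i1).
apply: (ccvg_unique h); rewrite /ccvg.
apply: (@cvg_trans _ ((0 : R) @[_ --> \oo])); last exact: cvg_cst.
apply: near_eq_cvg; exists j.+1 => // n /= jn.
rewrite (bigD1 (Ordinal jn))//= big1 ?addr0.
  by have := FC_expi j j; rewrite /FC eqxx => ->; rewrite mulr1 subrr cmod0.
move=> k /negP kj; have := FC_expi k j; rewrite /FC => ->.
case: eqP => [e'|]; last by rewrite mulr0.
by exfalso; apply: kj; apply/eqP/val_inj.
Qed.

End AbsolutelySummable.

(** A mean square sum calls for a bounded factor. For the factor [1 / (f0 + g0)] the bound comes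
    from [toeplitz_bounded_symbol]. *)
Lemma fourier_sum_cvg c C m (k : R) : fourier_sum c C -> cinteg C ->
  cmeasurable m -> aecirc (fun x => cmod (m x) <= k) -> fourier_cvg m c C.
Proof.
move=> [mC cC] iC mm mk.
have mk' : aecirc (fun x => cmod (m x) <= `|k| + 1).
  apply: aecirc1 mk => x _ /le_trans; apply.
  by rewrite (le_trans (ler_norm k))// lerDl.
set k' := `|k| + 1 in mk'; have k0 : 0 < k' by rewrite /k' ltr_wpDl.
have im := cinteg_bounded mm mk.
have imC : cinteg (fun x => m x * C x) by exact: cinteg_mul_bounded mm iC mk.
split=> //; apply/cvgr0Pnorm_lt => e e0.
(* From [k' |C - S_n| <= k' t |C - S_n|^2 + k'/t]: this [t] makes the constant [k'/t] integrate to
   [e/2]. *)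
set t := 2 * (2 * pi) * k' / e.
have t0 : 0 < t by rewrite /t !mulr_gt0 ?invr_gt0// pi_gt0.
have /fine_cvgP[fin lim0] := cC.
have q0 : 0 < e / 2 / (k' * t) by rewrite !divr_gt0// mulr_gt0.
have near_q := @cvgr_lt _ _ _ _ _ _ lim0 _ q0.
near=> n.
have fn : (\int[mu]_(x in circle) (cmod (C x - trig c n x) ^+ 2)%:E \is a fin_num)%E.
  by near: n; exact: fin.
have qn : fine (\int[mu]_(x in circle) (cmod (C x - trig c n x) ^+ 2)%:E)%E < e / 2 / (k' * t).
  by near: n; exact: near_q.
have icd : cinteg (fun x => C x - trig c n x) by apply: cintegB => //; exact: cinteg_trig.
have i2 : integ (fun x => cmod (C x - trig c n x) ^+ 2).
  apply: integ_of_finite.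
  - by apply: measurable_funX; apply: cmeas_cmod; case: icd.
  - by move=> x _; exact: sqr_ge0.
  - by rewrite -(fineK fn) ltry.
have [_ i1] := icd.
have [_ i3] := cintegB (cinteg_mul_trig c n im) imC.
rewrite ger0_norm ?rint_ge0//; last by move=> x _; exact: cmod_ge0.
apply: (@le_lt_trans _ _ (rint (fun x => k' * t * cmod (C x - trig c n x) ^+ 2 + k' * t^-1))).
  apply: rint_le_ae => //; first by apply: integD; [exact: integZ|exact: integ_cst].
  apply: aecirc1 mk' => x _ mx.
  rewrite -mulrBr cmodM (cmodBC (trig c n x)) -mulrA -mulrDr ler_pM ?cmod_ge0//.
  by have := mulr_le_sqr (cmod (C x - trig c n x)) 1 t0; rewrite !mulr1 expr1n mulr1.
rewrite rintD; [|exact: integZ|exact: integ_cst].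
rewrite rintZ// rint_cst.
have -> : 2 * pi * (k' * t^-1) = e / 2.
  rewrite /t; move: (@pi R) (pi_gt0 R) => p p0.
  by field; rewrite !gt_eqF.
rewrite -ltrBrDr (_ : e - e / 2 = e / 2); last by field.
by rewrite [ltLHS]mulrC -ltr_pdivlMr; [exact: qn|exact: mulr_gt0 k0 t0].
Unshelve. all: by end_near. Qed.

Lemma fourier_sum_neg c C (j : nat) : fourier_sum c C -> cinteg C ->
  FC C (- j.+1%:R) = 0.
Proof.
move=> fC iC.
have mm : cmeasurable (fun x : R => expi (j.+1%:R * x)) by exact: cmeas_expi.
have mk : aecirc (fun x : R => cmod (expi (j.+1%:R * x)) <= 1).
  by apply: aecirc_all => x _; rewrite cmod_expi.
have h := fourier_cvg_avg (fourier_sum_cvg fC iC mm mk).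
have -> : FC C (- j.+1%:R) = avg (fun x => expi (j.+1%:R * x) * C x).
  by rewrite /FC; congr avg; apply/funext => x; rewrite mulNr opprK.
apply: (ccvg_unique h); apply: (ccvg_ext (@ccvg_cst R 0)) => n.
rewrite big1// => k _.
rewrite (_ : avg _ = FC (fun x => expi (k%:R * x)) (- j.+1%:R)).
  by rewrite FC_expi_neg mulr0.
by rewrite /FC; congr avg; apply/funext => x; rewrite mulNr opprK.
Qed.

End SpectralFunctions.

(** * The minimality condition in real terms *)

Section Minimality.
Context {R : realType}.
Implicit Types (f g w : R -> R).
Local Notation mu := (@lebesgue_measure R).

Lemma measurable_inve w : measurable_fun circle w ->
  measurable_fun circle (fun x => ((w x)%:E^-1)%E).
Proof.
move=> mw; have mi : measurable_fun [set: R] (fun y => ((y%:E)^-1)%E).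
  under eq_fun do rewrite inver.
  apply: measurable_fun_ifT; first by apply: measurable_fun_eqr.
    exact: measurable_cst.
  by apply/measurable_EFinP; exact: measurable_invr.
exact: measurableT_comp mi mw.
Qed.

(** The real inverse is 0 at 0, so its integrability alone says nothing about zeros of [f + g];
    positivity comes from the extended inverse being finite almost everywhere. *)
Lemma minimalityP f g : spectral_density f -> spectral_density g ->
  minimality f g <->
  aecirc (fun x => 0 < f x + g x) /\ integ (fun x => (f x + g x)^-1).
Proof.
move=> [if_ f0] [ig g0]; set w := fun x => f x + g x.
have iw : integ w by exact: integD.
have mw := integ_meas iw; have mi := measurable_inve mw.
have w0 x : circle x -> 0 <= w x by move=> cx; rewrite addr_ge0 ?f0 ?g0.
have mv : measurable_fun circle (fun x => (w x)^-1).
  exact: measurableT_comp (@measurable_invr R) mw.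
have i0 x : circle x -> (0 <= ((w x)%:E)^-1)%E.
  move=> cx; rewrite inver; case: eqP => // _.
  by rewrite lee_fin invr_ge0 w0.
split=> [fin|[wp iv]].
  split; last first.
    apply: integ_of_finite => //; first by move=> x cx; rewrite invr_ge0 w0.
    apply: le_lt_trans fin; apply: ae_ge0_le_integral.
    - exact: measurable_circle.
    - by move=> x cx; rewrite lee_fin invr_ge0 w0.
    - exact/measurable_EFinP.
    - exact: i0.
    - exact: mi.
    - apply: aeW => x _; rewrite inver; case: eqP => // _; exact: leey.
  have : mu.-integrable circle (fun x => ((w x)%:E^-1)%E).
    apply/integrableP; split=> //; apply: le_lt_trans fin.
    rewrite le_eqVlt; apply/orP; left; apply/eqP.
    by apply: eq_integral => x /set_mem cx; rewrite gee0_abs// i0.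
  move=> ii; have : {ae mu, forall x, circle x -> ((w x)%:E^-1)%E \is a fin_num}.
    by apply: integrable_ae ii; exact: measurable_circle.
  rewrite /aecirc; apply: filterS => x h cx; have := h cx; rewrite inver.
  by case: eqP => // /eqP wx _; rewrite lt_neqAle eq_sym wx w0.
apply: (@le_lt_trans _ _ (\int[mu]_(x in circle) ((w x)^-1)%:E)%E); last first.
  by rewrite integral_EFin// ltry.
apply: ae_ge0_le_integral.
- exact: measurable_circle.
- exact: i0.
- exact: mi.
- by move=> x cx; rewrite lee_fin invr_ge0 w0.
- exact/measurable_EFinP.
- move: wp; rewrite /aecirc; apply: filterS => x h cx.
  by rewrite inver gt_eqF// h.
Qed.

End Minimality.

(** * Scalar multiples of boundedly invertible operators *)

Section Scaling.
Context {R : realType}.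
Implicit Types (T S : (nat -> R[i]) -> (nat -> R[i])) (x y : nat -> R[i]).

Lemma l2_scale (z : R[i]) x : l2 x -> l2 (fun k => z * x k).
Proof.
move=> lx; have := @l2_lin R z x _ lx (@l2_zero R).
by congr l2; apply/funext => k; rewrite addr0.
Qed.

Lemma bop_scale T (z : R[i]) x : bounded_operator T -> l2 x ->
  T (fun k => z * x k) = fun j => z * T x j.
Proof.
move=> Tb lx; have := bop_lin Tb z lx (@l2_zero R); rewrite (bop_zero Tb).
have -> : (fun k => z * x k + 0) = fun k => z * x k by apply/funext => k; rewrite addr0.
by move=> ->; apply/funext => j; rewrite addr0.
Qed.

Lemma bounded_operator_scale T (z : R[i]) : bounded_operator T ->
  bounded_operator (fun x j => z * T x j).
Proof.
move=> Tb; split.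
- move=> x /[!inE] lx; exact: l2_scale (bop_l2 Tb lx).
- move=> c x y /[!inE] lx ly j; rewrite (bop_lin Tb)//; ring.
- have [K K0 TK] := bop_bound Tb; exists (cmod z ^+ 2 * K) => x /[!inE] lx.
  apply: (proj2 (l2_bounded _)) => n.
  under eq_bigr do rewrite cmodM exprMn.
  rewrite -mulr_sumr -mulrA ler_wpM2l ?sqr_ge0//.
  exact: le_trans (l2_partial n (bop_l2 Tb lx)) (TK _ lx).
Qed.

Lemma boundedly_invertible_scale M T S (z : R[i]) : z != 0 ->
  boundedly_invertible M T S ->
  boundedly_invertible (fun j k => z * M j k) (fun x j => z * T x j)
    (fun x j => z^-1 * S x j).
Proof.
move=> z0 [Tb TM Sb TS]; split.
- exact: bounded_operator_scale.
- by move=> j k; rewrite TM.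
- exact: bounded_operator_scale.
- move=> x lx; have [h1 h2] := TS x lx; rewrite inE in lx; split.
    rewrite bop_scale//; last exact: bop_l2 lx.
    by rewrite h1; apply/funext => j; rewrite mulrA divff// mul1r.
  rewrite (bop_scale z Sb)//; last exact: bop_l2 lx.
  by rewrite h2; apply/funext => j; rewrite mulrA mulVf// mul1r.
Qed.

Lemma boundedly_invertible_ext M M' T S : (forall j k, M j k = M' j k) ->
  boundedly_invertible M T S -> boundedly_invertible M' T S.
Proof. by move=> e [Tb TM Sb TS]; split=> // j k; rewrite -e TM. Qed.

End Scaling.

(** * Orthogonality to negative frequencies in a weighted space *)

Section Orthogonality.
Context {R : realType}.
Implicit Types (h u C : R -> R[i]) (w : R -> R).
Local Notation mu := (@lebesgue_measure R).

Lemma cmod_sqrD (z1 z2 : R[i]) : cmod (z1 + z2) ^+ 2 <= 2 * cmod z1 ^+ 2 + 2 * cmod z2 ^+ 2.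
Proof.
apply: (@le_trans _ _ ((cmod z1 + cmod z2) ^+ 2)).
  by rewrite ler_pXn2r ?nnegrE ?addr_ge0 ?cmod_ge0// cmodD.
have := sqr_ge0 (cmod z1 - cmod z2); nra.
Qed.

Lemma integ_sqr_weight h w : L20 w h -> integ w -> (forall x, circle x -> 0 <= w x) ->
  integ (fun x => cmod (h x) ^+ 2 * w x).
Proof.
move=> [mh fin _] iw w0; apply: integ_of_finite => //.
  apply: measurable_funM; last exact: integ_meas.
  by apply: measurable_funX; exact: cmeas_cmod.
by move=> x cx; rewrite mulr_ge0 ?sqr_ge0 ?w0.
Qed.

Lemma integ_weight h w : cmeasurable h -> integ (fun x => cmod (h x) ^+ 2 * w x) -> integ w ->
  (forall x, circle x -> 0 <= w x) -> integ (fun x => cmod (h x) * w x).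
Proof.
move=> mh ih iw w0; apply: (integ_dom _ (integD ih iw)).
  by apply: measurable_funM; [exact: cmeas_cmod|exact: integ_meas].
apply: aecirc_all => x cx; have := w0 x cx => wx.
rewrite ger0_norm ?mulr_ge0 ?cmod_ge0// -[X in _ + X]mul1r -mulrDl ler_wpM2r//.
have := mulr_le_sqr (cmod (h x)) 1 ltr01.
by rewrite mulr1 mul1r invr1 expr1n mulr1.
Qed.

(** The bound [|C| <= b w] makes the pairing with [C] continuous for the norm of L2(w), and it
    vanishes on the exponentials that span [L20 w]. *)
Lemma L20_orthogonal h C w (b : R) : L20 w h -> integ w ->
  (forall x, circle x -> 0 <= w x) -> cmeasurable C ->
  aecirc (fun x => cmod (C x) <= b * w x) ->
  (forall j : nat, FC C (- j.+1%:R) = 0) ->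
  cinteg (fun x => conjc (h x) * C x) /\ avg (fun x => conjc (h x) * C x) = 0.
Proof.
move=> Lh iw w0 mC Cw C0; have [mh _ hp] := Lh.
have dom u : cmeasurable u -> integ (fun x => cmod (u x) ^+ 2 * w x) ->
    cinteg (fun x => conjc (u x) * C x).
  move=> mu_ iu; have iuw := integ_weight mu_ iu iw w0.
  apply: (cinteg_dom _ (integZ b iuw)).
    by apply: cmeasM => //; exact: cmeas_conj.
  apply: aecirc1 Cw => x _ Cx; rewrite cmodM cmod_conj mulrCA.
  by rewrite ler_wpM2l ?cmod_ge0.
have ih := integ_sqr_weight Lh iw w0; have ihC := dom h mh ih.
split=> //; apply/cmod0_eq0/eqP; rewrite eq_le cmod_ge0 andbT.
apply: (@le0_inv_bound _ _ ((2 * pi)^-1 * (`|b| * (1 + rint w)))) => t t0.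
(* With squared distance below [t^-2], the term [t |h - p|^2 w] integrates to at most [t^-1], the
   same order as [t^-1 w]. *)
have t2 : 0 < t^-1 / t by rewrite !divr_gt0 ?invr_gt0.
have [n [c hc]] := hp _ t2.
pose p x := \sum_(j < n) c j * expi (- (j.+1%:R * x)).
have mp : cmeasurable p.
  apply: cmeas_sum => j; apply: cmeasM (cmeas_cst _) _.
  by under eq_fun do rewrite -mulNr; exact: cmeas_expi.
have pb x : cmod (p x) <= \sum_(j < n) cmod (c j).
  by apply: (le_trans (cmod_sum _ _ _)); apply: ler_sum => j _; rewrite cmodM cmod_expi mulr1.
have mhp : cmeasurable (fun x => h x - p x) by exact: cmeasB.
have ip2 : integ (fun x => cmod (p x) ^+ 2 * w x).
  apply: (integ_dom _ (integZ ((\sum_(j < n) cmod (c j)) ^+ 2) iw)).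
    apply: measurable_funM; last exact: integ_meas.
    by apply: measurable_funX; exact: cmeas_cmod.
  apply: aecirc_all => x cx; rewrite ger0_norm; last by rewrite mulr_ge0 ?sqr_ge0 ?w0.
  apply: ler_wpM2r; first exact: w0.
  by rewrite ler_pXn2r ?nnegrE ?cmod_ge0// (le_trans (cmod_ge0 (p x))).
have iq : integ (fun x => cmod (h x - p x) ^+ 2 * w x).
  apply: integ_of_finite.
  - apply: measurable_funM; last exact: integ_meas.
    by apply: measurable_funX; exact: cmeas_cmod.
  - by move=> x cx; rewrite mulr_ge0 ?sqr_ge0 ?w0.
  - by apply: lt_trans hc _; rewrite ltry.
have iC : cinteg C.
  apply: (cinteg_dom mC (integZ b iw)); exact: Cw.
have pC : avg (fun x => conjc (p x) * C x) = 0.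
  have e : (fun x => conjc (p x) * C x) =
      fun x => \sum_(j < n) conjc (c j) * (expi (j.+1%:R * x) * C x).
    apply/funext => x; rewrite /p conjc_sum mulr_suml; apply: eq_bigr => j _.
    by rewrite conjcM conjc_expi opprK mulrA.
  rewrite e avg_sum => [|j]; last by apply: cintegZ; exact: cinteg_expi.
  rewrite big1// => j _; rewrite avgZ; last exact: cinteg_expi.
  have := C0 j; rewrite /FC.
  have -> : (fun x => expi (- (- j.+1%:R * x)) * C x) = fun x => expi (j.+1%:R * x) * C x.
    by apply/funext => x; rewrite mulNr opprK.
  by move=> ->; rewrite mulr0.
have ipC := dom p mp ip2; have ihpC := dom _ mhp iq.
rewrite -[X in cmod X]subr0 -pC -avgB//.
have -> : (fun x => conjc (h x) * C x - conjc (p x) * C x) =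
    fun x => conjc (h x - p x) * C x by apply/funext => x; rewrite conjcB mulrBl.
apply: (le_trans (cmod_avg ihpC)); rewrite [leRHS]mulrCA ler_pM2l ?pi2_gt0//.
have iqw := integD (integZ t iq) (integZ t^-1 iw).
apply: (@le_trans _ _ (rint (fun x => `|b| * (t * (cmod (h x - p x) ^+ 2 * w x) + t^-1 * w x)))).
  apply: rint_le_ae; [by case: ihpC|exact: integZ|].
  apply: aecirc2 Cw (aecirc_all w0) => x _ Cx wx.
  rewrite cmodM cmod_conj; apply: (le_trans (ler_wpM2l (cmod_ge0 _) Cx)).
  rewrite mulrCA; apply: (@le_trans _ _ (`|b| * (cmod (h x - p x) * w x))).
    by rewrite ler_wpM2r ?ler_norm// mulr_ge0 ?cmod_ge0.
  rewrite ler_wpM2l// mulrA -mulrDl ler_wpM2r//.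
  by have := mulr_le_sqr (cmod (h x - p x)) 1 t0; rewrite mulr1 expr1n mulr1.
rewrite rintZ// rintD; [|exact: integZ|exact: integZ].
rewrite !rintZ// [leRHS]mulrCA ler_wpM2l// mulrDr mulr1 lerD2r.
have : rint (fun x => cmod (h x - p x) ^+ 2 * w x) < t^-1 / t.
  by rewrite -lte_fin -integral_EFin.
by rewrite ltr_pdivlMr// mulrC => /ltW.
Qed.

End Orthogonality.

(** * The error functional and its minimisation *)

Section DeltaTheory.
Context {R : realType}.
Variables (a : nat -> R[i]).
Hypothesis a_abs : cvgn (series (fun j => cmod (a j))).
Implicit Types (h C : R -> R[i]) (f g : R -> R).
Local Notation A := (Afun a).

Definition mean f : R := (2 * pi)^-1 * rint f.

Lemma Delta_real h f g : integ (fun x => cmod (A x - h x) ^+ 2 * f x) ->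
  integ (fun x => cmod (h x) ^+ 2 * g x) ->
  Delta a h f g = (mean (fun x => cmod (A x - h x) ^+ 2 * f x) +
                   mean (fun x => cmod (h x) ^+ 2 * g x))%:E.
Proof. by move=> i1 i2; rewrite /Delta !integral_EFin. Qed.

Lemma mean_cst_sqr h f (k : R) : cmeasurable h -> integ f ->
  aecirc (fun x => cmod (h x) = k) ->
  integ (fun x => cmod (h x) ^+ 2 * f x) /\
  mean (fun x => cmod (h x) ^+ 2 * f x) = k ^+ 2 * mean f.
Proof.
move=> mh if_ hk.
have m1 : measurable_fun circle (fun x => cmod (h x) ^+ 2 * f x).
  apply: measurable_funM; last exact: integ_meas.
  by apply: measurable_funX; exact: cmeas_cmod.
have i1 : integ (fun x => k ^+ 2 * f x) by exact: integZ.
split.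
  apply: (integ_dom m1 (integ_norm i1)).
  by apply: aecirc1 hk => x _ ->.
have e : rint (fun x => cmod (h x) ^+ 2 * f x) = rint (fun x => k ^+ 2 * f x).
  apply: rint_eq_ae => //; first exact: integ_meas.
  by apply: aecirc1 hk => x _ ->.
by rewrite /mean e rintZ// mulrCA.
Qed.

(* With C := (A - h0) f - h0 g, expanding the squares around h0 leaves the cross
   term 2 Re ((h - h0)^* C), which integrates to zero. *)
Lemma Delta_min f g h0 h C (b : R) : spectral_density f -> spectral_density g ->
  L20 (fun x => f x + g x) h0 -> L20 (fun x => f x + g x) h ->
  cmeasurable C -> aecirc (fun x => cmod (C x) <= b * (f x + g x)) ->
  (forall j : nat, FC C (- j.+1%:R) = 0) ->
  aecirc (fun x => (A x - h0 x) * (f x)%:C - h0 x * (g x)%:C = C x) ->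
  (Delta a h0 f g <= Delta a h f g)%E.
Proof.
move=> [if_ f0] [ig g0] L0 L mC Cb Cn CE; set w := fun x => f x + g x in L0 L Cb.
have iw : integ w by exact: integD.
have w0 x : circle x -> 0 <= w x by move=> cx; rewrite addr_ge0 ?f0 ?g0.
have mA := cmeas_Afun a_abs.
set Sa := limn (series (fun j => cmod (a j))).
have i2 u : L20 w u -> integ (fun x => cmod (u x) ^+ 2 * g x).
  move=> Lu; case: (Lu) => mu_ _ _; apply: (integ_dom _ (integ_sqr_weight Lu iw w0)).
    apply: measurable_funM; last exact: integ_meas ig.
    by apply: measurable_funX; exact: cmeas_cmod.
  apply: aecirc_all => x cx; rewrite ger0_norm; last by rewrite mulr_ge0 ?sqr_ge0 ?g0.
  by rewrite ler_wpM2l ?sqr_ge0// lerDr f0.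
have i1 u : L20 w u -> integ (fun x => cmod (A x - u x) ^+ 2 * f x).
  move=> Lu; case: (Lu) => mu_ _ _.
  apply: (integ_dom _ (integD (integZ (2 * Sa ^+ 2) iw)
    (integZ 2 (integ_sqr_weight Lu iw w0)))).
    apply: measurable_funM; last exact: integ_meas if_.
    by apply: measurable_funX; apply: cmeas_cmod; exact: cmeasB.
  apply: aecirc_all => x cx; rewrite ger0_norm; last by rewrite mulr_ge0 ?sqr_ge0 ?f0.
  rewrite (mulrA 2 _ (w x)) -mulrDl; apply: ler_pM; rewrite ?sqr_ge0 ?f0//; last first.
    by rewrite lerDl g0.
  apply: (le_trans (cmod_sqrD _ _)); rewrite cmodN lerD2r ler_wpM2l//.
  by rewrite ler_pXn2r ?nnegrE ?cmod_ge0 ?Afun_bounded// (le_trans (cmod_ge0 (A x)))// Afun_bounded.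
have [j1 e1] := L20_orthogonal L iw w0 mC Cb Cn.
have [j0 e0] := L20_orthogonal L0 iw w0 mC Cb Cn.
have jd : cinteg (fun x => conjc (h x) * C x - conjc (h0 x) * C x) by exact: cintegB.
have rd : rint (fun x => complex.Re (conjc (h x) * C x - conjc (h0 x) * C x)) = 0.
  have := congr1 (@complex.Re R) (avgB j1 j0); rewrite e1 e0 subrr /avg ReM /= mul0r subr0.
  by move/eqP; rewrite mulf_eq0 gt_eqF ?pi2_gt0//= => /eqP.
rewrite !Delta_real ?i1 ?i2// lee_fin /mean -!mulrDr ler_pM2l ?pi2_gt0//.
rewrite -!rintD ?i1 ?i2//; rewrite -[leLHS]subr0 -(mulr0 2) -rd -rintZ; last exact: cinteg_Re.
have i10 := i1 _ L0; have i20 := i2 _ L0; have i11 := i1 _ L; have i21 := i2 _ L.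
have iR := integZ 2 (cinteg_Re jd).
have iD0 := integD i10 i20.
rewrite -rintB//; apply: rint_le_ae; [exact: integB|exact: integD|].
apply: aecirc1 CE => x cx <-; rewrite -subr_ge0.
have -> : cmod (A x - h x) ^+ 2 * f x + cmod (h x) ^+ 2 * g x -
   (cmod (A x - h0 x) ^+ 2 * f x + cmod (h0 x) ^+ 2 * g x -
    2 * complex.Re (conjc (h x) * ((A x - h0 x) * (f x)%:C - h0 x * (g x)%:C) -
       conjc (h0 x) * ((A x - h0 x) * (f x)%:C - h0 x * (g x)%:C))) =
   cmod (h x - h0 x) ^+ 2 * w x.
  rewrite /w !cmod_sqr; case: (A x) => a1 a2; case: (h x) => h1 h2; case: (h0 x) => k1 k2.
  rewrite /=; ring.
by rewrite mulr_ge0 ?sqr_ge0 ?w0.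
Qed.

End DeltaTheory.

(** * Sesquilinearity and the passage to first order *)

Section InnerAlgebra.
Context {R : realType}.
Implicit Types (x y w : nat -> R[i]) (z : R[i]).

Lemma inner_scalel z x w : l2 x -> l2 w -> inner (fun k => z * x k) w = z * inner x w.
Proof.
move=> lx lw; apply: csum_eq; apply: (ccvg_ext (ccvgM z (inner_cvg lx lw).1)) => n.
by rewrite mulr_sumr; apply: eq_bigr => k _; rewrite mulrA.
Qed.

Lemma inner_linr z x y w : l2 x -> l2 y -> l2 w ->
  inner w (fun k => z * x k + y k) = conjc z * inner w x + inner w y.
Proof.
move=> lx ly lw; have lz := @l2_lin R z x y lx ly.
rewrite (inner_conj lz lw) inner_linl// conjcD conjcM.
by rewrite -(inner_conj lx lw) -(inner_conj ly lw).
Qed.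

(** If [X > 0], a step [eps] below [e0] with [eps (|Y| + 1) <= X/2] leaves [X + eps Y] positive. *)
Lemma le0_small_slope (X Y e0 : R) : 0 < e0 ->
  (forall eps, 0 < eps < e0 -> X + eps * Y <= 0) -> X <= 0.
Proof.
move=> e00 h; rewrite leNgt; apply/negP => X0.
have Y0 : 0 < 2 * (`|Y| + 1) by rewrite mulr_gt0// ltr_wpDl.
set m := Num.min (e0 / 2) (X / (2 * (`|Y| + 1))).
have m0 : 0 < m by rewrite lt_min !divr_gt0.
have me : m < e0 by rewrite gt_min; apply/orP; left; lra.
have mX : m <= X / (2 * (`|Y| + 1)) by rewrite ge_min lexx orbT.
have := h m; rewrite m0 me => /(_ isT).
move: mX; rewrite ler_pdivlMr// => mX.
have : - Y <= `|Y| by rewrite -normrN ler_norm.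
by move=> Yn; nra.
Qed.

End InnerAlgebra.

(** * The pair [(f0, g0)], the function [h0] and the perturbed objective *)

Section LeastFavourable.
Context {R : realType}.
Variables (a : nat -> R[i]) (f0 g0 : R -> R) (B0 B0inv : (nat -> R[i]) -> (nat -> R[i])).
Variables (C0 : R -> R[i]) (alpha1 alpha2 : R).
Hypothesis a_abs : cvgn (series (fun j => cmod (a j))).
Hypotheses (f0S : spectral_density f0) (g0S : spectral_density g0).
Hypothesis min0 : minimality f0 g0.
Hypothesis B0P : boundedly_invertible (Bmx f0 g0) B0 B0inv.
Hypothesis C0P : fourier_sum (B0inv (mxact (Rmx f0 g0) a)) C0.
Hypothesis eq1 : aecirc (fun x =>
  cmod (Afun a x * (g0 x)%:C + C0 x) = alpha1 * (f0 x + g0 x)).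
Hypothesis eq2 : aecirc (fun x =>
  cmod (Afun a x * (f0 x)%:C - C0 x) = alpha2 * (f0 x + g0 x)).

Local Notation A := (Afun a).
(** Of the functions that follow, [v], [rho] and [q] are the symbols of the matrices [B], [R] and
    [Q] at [(f0, g0)]. *)
Let w x := f0 x + g0 x.
Let v x := (w x)^-1.
Let rho x := f0 x / w x.
Let q x := f0 x * g0 x / w x.
Let Ra := mxact (Rmx f0 g0) a.
Let c0 := B0inv Ra.
Let Sa := limn (series (fun j => cmod (a j))).
Let h0 x := (A x * (f0 x)%:C - C0 x) / (w x)%:C.

Lemma mxact_symbol (phi : R -> R) : integ phi ->
  mxact (toeplitz phi) a = fun j : nat => FC (fun x => (phi x)%:C * A x) j%:R.
Proof.
move=> ip; apply/funext => j; apply: csum_eq.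
exact: mxact_toeplitz (fourier_cvg_Afun a_abs (cinteg_real ip)) j.
Qed.

Lemma cinteg_AA (phi : R -> R) : integ phi ->
  cinteg (fun x => (phi x)%:C * A x * conjc (A x)).
Proof.
move=> ip; under eq_fun do rewrite mulrC.
apply: (@cinteg_mul_bounded _ _ _ Sa).
- exact: (cmeas_conj (cmeas_Afun a_abs)).
- exact: (cinteg_mul_Afun a_abs (cinteg_real ip)).
- by apply: aecirc_all => x _; rewrite cmod_conj Afun_bounded.
Qed.

Lemma inner_symbol (phi : R -> R) : integ phi ->
  inner (mxact (toeplitz phi) a) a = avg (fun x => (phi x)%:C * A x * conjc (A x)).
Proof.
move=> ip; have ipA := cinteg_mul_Afun a_abs (cinteg_real ip).
by rewrite mxact_symbol//; apply: inner_FC => //; apply: fourier_cvg_Afun => //; exact: cinteg_conj.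
Qed.

Let if0 : integ f0. Proof. by case: f0S. Qed.
Let ig0 : integ g0. Proof. by case: g0S. Qed.
Let f0_ge0 x : circle x -> 0 <= f0 x. Proof. by case: f0S => _; exact. Qed.
Let g0_ge0 x : circle x -> 0 <= g0 x. Proof. by case: g0S => _; exact. Qed.
Let iw : integ w. Proof. exact: integD. Qed.
Let w_ge0 x : circle x -> 0 <= w x.
Proof. by move=> cx; rewrite addr_ge0 ?f0_ge0 ?g0_ge0. Qed.
Let w_gt0 : aecirc (fun x => 0 < w x).
Proof. by have [] := (minimalityP f0S g0S).1 min0. Qed.
Let iv : integ v. Proof. by have [] := (minimalityP f0S g0S).1 min0. Qed.
Let mv : measurable_fun circle v. Proof. exact: integ_meas iv. Qed.
Let mA : cmeasurable A. Proof. exact: (cmeas_Afun a_abs). Qed.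

Let rho01 x : circle x -> 0 <= rho x <= 1.
Proof.
move=> cx; rewrite /rho divr_ge0 ?f0_ge0 ?w_ge0//=.
have := w_ge0 cx; rewrite le_eqVlt => /predU1P[<-|w0]; first by rewrite invr0 mulr0.
by rewrite ler_pdivrMr// mul1r lerDl g0_ge0.
Qed.

Let irho : integ rho.
Proof.
apply: (@integ_bounded _ _ 1); first by apply: measurable_funM => //; exact: integ_meas if0.
by apply: aecirc_all => x cx; have /andP[? ?] := rho01 cx; rewrite ger0_norm.
Qed.

Let iq : integ q.
Proof.
apply: (@integ_dom _ _ g0) => //.
  by do ?apply: measurable_funM => //; exact: integ_meas.
apply: aecirc_all => x cx; have /andP[r0 r1] := rho01 cx.
have -> : q x = rho x * g0 x by rewrite /q /rho mulrAC.
rewrite ger0_norm; last by rewrite mulr_ge0// g0_ge0.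
by rewrite -[leRHS]mul1r; apply: ler_wpM2r => //; exact: g0_ge0.
Qed.

Let mC0 : cmeasurable C0. Proof. by case: C0P. Qed.

(** The second modulus equation turns [C0], given only as a mean square sum, into a function
    dominated by [w]. *)
Let C0_le : aecirc (fun x => cmod (C0 x) <= (Sa + alpha2) * w x).
Proof.
apply: aecirc1 eq2 => x cx e2.
have -> : C0 x = A x * (f0 x)%:C - (A x * (f0 x)%:C - C0 x) by ring.
apply: (le_trans (cmodB _ _)); rewrite e2 mulrDl lerD2r cmodM cmod_real ger0_norm ?f0_ge0//.
by apply: ler_pM; rewrite ?cmod_ge0 ?f0_ge0 ?Afun_bounded// lerDl g0_ge0.
Qed.

Let iC0 : cinteg C0. Proof. exact: cinteg_dom mC0 (integZ _ iw) C0_le. Qed.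

Let rhoA_le : aecirc (fun x => cmod ((rho x)%:C * A x) <= Sa).
Proof.
apply: aecirc_all => x cx; have /andP[r0 r1] := rho01 cx.
rewrite cmodM cmod_real ger0_norm// -[leRHS]mul1r ler_pM ?cmod_ge0//.
exact: Afun_bounded.
Qed.

Let mrhoA : cmeasurable (fun x => (rho x)%:C * A x).
Proof. by apply: cmeasM => //; exact: cmeas_real (integ_meas irho). Qed.

Let vC_le : aecirc (fun x => cmod ((v x)%:C * C0 x) <= Sa + alpha2).
Proof.
apply: aecirc2 C0_le w_gt0 => x _ Cx wx.
rewrite cmodM cmod_real ger0_norm; last by rewrite /v invr_ge0 ltW.
by rewrite [leLHS]mulrC /v ler_pdivrMr.
Qed.

Let mvC : cmeasurable (fun x => (v x)%:C * C0 x).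
Proof. by apply: cmeasM => //; exact: cmeas_real. Qed.

Let RaE : Ra = fun j : nat => FC (fun x => (rho x)%:C * A x) j%:R.
Proof. by rewrite /Ra /Rmx mxact_symbol//; exact: irho. Qed.

Let Ra_l2 : l2 Ra. Proof. by rewrite RaE; exact: bessel mrhoA rhoA_le. Qed.
Let a_l2 : l2 a. Proof. exact: (l1_l2 a_abs). Qed.
Let Bb : bounded_operator B0. Proof. by case: B0P. Qed.
Let Bib : bounded_operator B0inv. Proof. by case: B0P. Qed.
Let BM : has_matrix B0 (Bmx f0 g0). Proof. by case: B0P. Qed.
Let c0_l2 : l2 c0. Proof. exact: (bop_l2 Bib Ra_l2). Qed.
Let Bc0 : B0 c0 = Ra.
Proof. by case: B0P => _ _ _ /(_ Ra (mem_set Ra_l2))[]. Qed.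

(** The row series of [B0 c0] has two limits to be identified: the l2 value [Ra j] by [bop_row], and
    a coefficient of [v C0], since [v] is bounded. *)
Let vC_FC (j : nat) : FC (fun x => (v x)%:C * C0 x) j%:R = Ra j.
Proof.
have [K vK] := toeplitz_bounded_symbol iv Bb BM.
have vK' : aecirc (fun x => cmod (v x)%:C <= K).
  by apply: aecirc1 vK => x _; rewrite cmod_real.
have h := mxact_toeplitz (fourier_sum_cvg C0P iC0 (cmeas_real mv) vK') j.
by apply: (ccvg_unique h); rewrite -Bc0; exact: (bop_row Bb BM j c0_l2).
Qed.

Let ivC : cinteg (fun x => (v x)%:C * C0 x). Proof. exact: cinteg_bounded mvC vC_le. Qed.
Let irhoA : cinteg (fun x => (rho x)%:C * A x). Proof. exact: cinteg_bounded mrhoA rhoA_le. Qed.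

Let h0E x : h0 x = (rho x)%:C * A x - (v x)%:C * C0 x.
Proof.
have e : ((w x)%:C)^-1 = (v x)%:C :> R[i] by rewrite /v fmorphV.
by rewrite /h0 e /rho realcM -/(v x); ring.
Qed.

Let mh0 : cmeasurable h0.
Proof. by rewrite (funext h0E); exact: cmeasB. Qed.

Let h0_FC (j : nat) : FC h0 j%:R = 0.
Proof.
have -> : h0 = fun x => (rho x)%:C * A x + (-1) * ((v x)%:C * C0 x).
  by apply/funext => x; rewrite h0E mulN1r.
rewrite FCD//; last exact: cintegZ.
by rewrite FCZ// vC_FC RaE mulN1r subrr.
Qed.

Let h0_mod : aecirc (fun x => cmod (h0 x) = alpha2).
Proof.
apply: aecirc2 eq2 w_gt0 => x _ e wx.
by rewrite /h0 cmodM cmodV cmod_real gtr0_norm// e mulfK// gt_eqF.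
Qed.

Let Ah0_mod : aecirc (fun x => cmod (A x - h0 x) = alpha1).
Proof.
apply: aecirc2 eq1 w_gt0 => x _ e wx.
have wn : (w x)%:C != 0 :> R[i] by rewrite (inj_eq (@complexI R)) gt_eqF.
have -> : A x - h0 x = (A x * (g0 x)%:C + C0 x) / (w x)%:C.
  apply: (mulIf wn); rewrite mulfVK// mulrBl /h0 mulfVK// /w realcD; ring.
by rewrite cmodM cmodV cmod_real gtr0_norm// e mulfK// gt_eqF.
Qed.

Lemma robust_L20 f g : spectral_density f -> spectral_density g ->
  L20 (fun x => f x + g x) h0.
Proof.
move=> [if_ f_ge0] [ig g_ge0]; apply: (@L20_bounded _ _ alpha2) => //.
- by apply: aecirc1 h0_mod => x _ ->.
- exact: integD.
- by move=> x cx; rewrite addr_ge0 ?f_ge0 ?g_ge0.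
Qed.

Lemma robust_Delta f g : spectral_density f -> spectral_density g ->
  Delta a h0 f g = (alpha1 ^+ 2 * mean f + alpha2 ^+ 2 * mean g)%:E.
Proof.
move=> [if_ f_ge0] [ig g_ge0].
have [i1 e1] := mean_cst_sqr (cmeasB mA mh0) if_ Ah0_mod.
have [i2 e2] := mean_cst_sqr mh0 ig h0_mod.
by rewrite Delta_real// e1 e2.
Qed.

Lemma robust_spectral_characteristic : spectral_characteristic a f0 g0 h0.
Proof.
split=> [|h Lh]; first exact: robust_L20.
apply: (Delta_min a_abs f0S g0S (robust_L20 f0S g0S) Lh mC0 C0_le).
  by move=> j; exact: fourier_sum_neg C0P iC0.
apply: aecirc1 w_gt0 => x _ wx.
have wn : (w x)%:C != 0 :> R[i] by rewrite (inj_eq (@complexI R)) gt_eqF.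
have -> : (A x - h0 x) * (f0 x)%:C - h0 x * (g0 x)%:C = A x * (f0 x)%:C - h0 x * (w x)%:C.
  by rewrite /w realcD; ring.
by rewrite /h0 mulfVK//; ring.
Qed.

(** Both the slope of the objective and the constants [alpha1^2], [alpha2^2] are expressed through
    [T1], [T2] and [T], which is how they are compared. *)
Let T1 := inner a c0.
Let T2 := inner Ra c0.
Let T (phi : R -> R) := avg (fun x : R => (phi x)%:C * A x * conjc (A x)).

Let AC_inner : T1 = avg (fun x : R => A x * conjc (C0 x)).
Proof.
have -> : T1 = inner (fun j : nat => FC A j%:R) c0.
  by rewrite /T1; congr inner; apply/funext => j; rewrite FC_Afun.
have bA : aecirc (fun x => cmod (A x) <= Sa) by apply: aecirc_all => x _; exact: Afun_bounded.
apply: inner_FC; last exact: cinteg_bounded mA bA.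
apply: (fourier_sum_cvg C0P iC0 (cmeas_conj mA)).
by apply: aecirc1 bA => x _; rewrite cmod_conj; exact.
Qed.

Let inner_c0 (u : R -> R[i]) (k : R) : cmeasurable u -> aecirc (fun x => cmod (u x) <= k) ->
  inner (fun j : nat => FC u j%:R) c0 = avg (fun x => u x * conjc (C0 x)).
Proof.
move=> mu_ uk; apply: inner_FC; last exact: cinteg_bounded mu_ uk.
apply: (fourier_sum_cvg C0P iC0 (cmeas_conj mu_)).
by apply: aecirc1 uk => x _; rewrite cmod_conj; exact.
Qed.

Let T2_rho : T2 = avg (fun x : R => (rho x)%:C * A x * conjc (C0 x)).
Proof. by rewrite /T2 RaE; exact: inner_c0 mrhoA rhoA_le. Qed.

(** [rho A] and [v C0] share their nonnegative coefficients, hence their pairing with [C0]. This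
    second form of [T2] is what closes the square expansions. *)
Let T2_v : T2 = avg (fun x : R => (v x)%:C * C0 x * conjc (C0 x)).
Proof.
rewrite -(inner_c0 mvC vC_le) /T2; congr inner.
by apply/funext => j; rewrite vC_FC.
Qed.

Let iuC (u : R -> R[i]) (k : R) : cmeasurable u -> aecirc (fun x => cmod (u x) <= k) ->
  cinteg (fun x => u x * conjc (C0 x)).
Proof. by move=> mu_ uk; exact: cinteg_mul_bounded mu_ (cinteg_conj iC0) uk. Qed.

Let Re_scale (z : R[i]) (k : R) : complex.Re (k%:C * z) = k * complex.Re z.
Proof. by rewrite ReM /= mul0r subr0. Qed.

Let mean_Re (u : R -> R[i]) (f : R -> R) : cinteg u -> integ f -> aecirc (fun x => f x = complex.Re (u x)) ->
  mean f = complex.Re (avg u).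
Proof.
move=> iu if_ fu; rewrite /avg Re_scale /mean; congr (_ * _).
by apply: rint_eq_ae fu; [exact: integ_meas|exact: integ_meas (cinteg_Re iu)].
Qed.

(** Expand [|A g0 + C0|^2 / w] using [g0^2/w = g0 - q] and [g0/w = 1 - rho]. The cross term gives
    [2 T1 - 2 T2], and the square of [C0] returns one [T2]. *)
Lemma alpha1_mean : alpha1 ^+ 2 * mean w =
  2 * complex.Re T1 + complex.Re (T g0) - (complex.Re T2 + complex.Re (T q)).
Proof.
have bA : aecirc (fun x => cmod (A x) <= Sa) by apply: aecirc_all => x _; exact: Afun_bounded.
have i1 := iuC mA bA; have i2 := iuC mrhoA rhoA_le; have i3 := iuC mvC vC_le.
have i4 := cinteg_AA ig0; have i5 := cinteg_AA iq.
pose s1 := fun x => (2 : R)%:C * (A x * conjc (C0 x)).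
pose s2 := fun x => (2 : R)%:C * ((rho x)%:C * A x * conjc (C0 x)).
have is1 : cinteg s1 by exact: cintegZ.
have is2 : cinteg s2 by exact: cintegZ.
pose u1 := fun x => (g0 x)%:C * A x * conjc (A x) - (q x)%:C * A x * conjc (A x).
have iu1 : cinteg u1 by exact: cintegB.
pose u2 := fun x => s1 x - s2 x.
have iu2 : cinteg u2 by exact: cintegB.
pose u3 := fun x => u1 x + u2 x.
have iu3 : cinteg u3 by exact: cintegD.
pose u := fun x => u3 x + (v x)%:C * C0 x * conjc (C0 x).
have iu : cinteg u by exact: cintegD.
have -> : alpha1 ^+ 2 * mean w = mean (fun x => alpha1 ^+ 2 * w x).
  by rewrite /mean rintZ// mulrCA.
rewrite (mean_Re iu); last 2 first.
- exact: integZ.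
- apply: aecirc2 eq1 w_gt0 => x _ e wx.
  have -> : alpha1 ^+ 2 * w x = cmod (A x * (g0 x)%:C + C0 x) ^+ 2 / w x.
    by rewrite e -/(w x); field; rewrite gt_eqF.
  rewrite /u /u3 /u2 /u1 /s1 /s2 /q /rho /v cmod_sqr.
  have wn : w x != 0 by rewrite gt_eqF.
  move: wn; rewrite /w; case: (A x) => a1 a2; case: (C0 x) => b1 b2 wn /=.
  by field.
rewrite avgD// avgD// avgB// avgB// avgZ// avgZ// -T2_rho -T2_v -AC_inner.
by rewrite !ReD !ReN !Re_scale /T; ring.
Qed.

(** Here [f0^2/w = f0 - q] and [f0/w = rho], so the cross term is [- 2 T2] and [T1] does not
    occur. *)
Lemma alpha2_mean : alpha2 ^+ 2 * mean w =
  complex.Re (T f0) - (complex.Re T2 + complex.Re (T q)).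
Proof.
have i2 := iuC mrhoA rhoA_le; have i3 := iuC mvC vC_le.
have i4 := cinteg_AA if0; have i5 := cinteg_AA iq.
pose s2 := fun x => (2 : R)%:C * ((rho x)%:C * A x * conjc (C0 x)).
have is2 : cinteg s2 by exact: cintegZ.
pose u1 := fun x => (f0 x)%:C * A x * conjc (A x) - (q x)%:C * A x * conjc (A x).
have iu1 : cinteg u1 by exact: cintegB.
pose u3 := fun x => u1 x - s2 x.
have iu3 : cinteg u3 by exact: cintegB.
pose u := fun x => u3 x + (v x)%:C * C0 x * conjc (C0 x).
have iu : cinteg u by exact: cintegD.
have -> : alpha2 ^+ 2 * mean w = mean (fun x => alpha2 ^+ 2 * w x).
  by rewrite /mean rintZ// mulrCA.
rewrite (mean_Re iu); last 2 first.
- exact: integZ.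
- apply: aecirc2 eq2 w_gt0 => x _ e wx.
  have -> : alpha2 ^+ 2 * w x = cmod (A x * (f0 x)%:C - C0 x) ^+ 2 / w x.
    by rewrite e -/(w x); field; rewrite gt_eqF.
  rewrite /u /u3 /u1 /s2 /q /rho /v cmod_sqr.
  have wn : w x != 0 by rewrite gt_eqF.
  move: wn; rewrite /w; case: (A x) => a1 a2; case: (C0 x) => b1 b2 wn /=.
  by field.
rewrite avgD// avgB// avgB// avgZ// -T2_rho -T2_v.
by rewrite !ReD !ReN !Re_scale /T; ring.
Qed.

Lemma objective0 : objective a f0 g0 B0inv = complex.Re T2 + complex.Re (T q).
Proof. by rewrite /objective ReD -/Ra -/c0 -/T2 /Qmx inner_symbol. Qed.

Lemma mean_w_gt0 : 0 < mean w.
Proof.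
rewrite mulr_gt0 ?pi2_gt0// lt_neqAle rint_ge0// andbT eq_sym.
apply/eqP => w0.
have w0' : rint w <= 0 by rewrite w0.
have h : aecirc (fun x => w x = 0).
  exact: (rint_le0_ae0 iw (aecirc_all (fun x cx => w_ge0 cx)) w0').
have hF : aecirc (fun _ : R => (1 : R) <= 0).
  by apply: aecirc2 h w_gt0 => x _ ->; rewrite ltxx.
have := rint_le_ae (integ_cst (1 : R)) (integ_cst 0) hF.
rewrite !rint_cst mulr0 mulr1 leNgt.
by rewrite mulr_gt0// pi_gt0.
Qed.

Let B_hermitian (j k : nat) : conjc (Bmx f0 g0 j k) = Bmx f0 g0 k j.
Proof.
have ivc := cinteg_real iv.
rewrite -[Bmx f0 g0 j k]/(FC (fun x => (v x)%:C) (j%:R - k%:R)).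
rewrite -[Bmx f0 g0 k j]/(FC (fun x => (v x)%:C) (k%:R - j%:R)).
rewrite /FC -avg_conj; last exact: cinteg_expiN.
congr avg; apply/funext => x; rewrite conjcM conjc_real conjc_expi.
by congr (expi _ * _); ring.
Qed.

(** Adding [eps w] to [f0] adds [eps] to the numerator of [rho], hence [eps a] to [R a]; [y] is the
    image of this increment. *)
Let y := B0inv a.
Let y_l2 : l2 y. Proof. exact: (bop_l2 Bib a_l2). Qed.

(** Writing [Ra] as [B0 c0] moves [B0] across instead of its inverse, so symmetry is used for the
    operator whose matrix is known. *)
Let Ra_y : inner Ra y = conjc T1.
Proof.
rewrite -Bc0 (bop_sym Bb BM B_hermitian c0_l2 y_l2).
have -> : B0 y = a by case: B0P => _ _ _ /(_ a (mem_set a_l2))[].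
exact: inner_conj a_l2 c0_l2.
Qed.

(** One computation for both perturbations: [d = 1], [p = g0] when [eps w] is added to [f0], and
    [d = 0], [p = f0] when it is added to [g0]. The result is exact in [eps], with no remainder. *)
Lemma objective_perturbed (f g p : R -> R) (d eps : R) : 0 < eps -> integ p ->
  spectral_density f -> spectral_density g ->
  (forall x, f x + g x = (1 + eps) * w x) ->
  aecirc (fun x => f x / ((1 + eps) * w x) = (1 + eps)^-1 * (rho x + eps * d)) ->
  aecirc (fun x => f x * g x / ((1 + eps) * w x) = (1 + eps)^-1 * (q x + eps * p x)) ->
  minimality f g /\ exists B Binv, boundedly_invertible (Bmx f g) B Binv /\
    (1 + eps) * objective a f g Binv =
    complex.Re T2 + complex.Re (T q) + eps * (2 * d * complex.Re T1 + complex.Re (T p)) +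
    eps ^+ 2 * (d ^+ 2 * complex.Re (inner a y)).
Proof.
move=> eps0 ip fS gS fg frho fq; have s0 : 0 < 1 + eps by rewrite addr_gt0.
set s := 1 + eps in s0 fg frho fq *.
have [if_ f_ge0] := fS; have [ig g_ge0] := gS.
have invE x : (f x + g x)^-1 = s^-1 * v x by rewrite fg invfM.
split.
  apply/(minimalityP fS gS); split.
    by apply: aecirc1 w_gt0 => x _ wx; rewrite fg mulr_gt0.
  by rewrite (funext invE); exact: integZ.
pose z : R[i] := (s^-1)%:C.
have zn : z != 0 by rewrite (inj_eq (@complexI R)) invr_eq0 gt_eqF.
exists (fun x j => z * B0 x j), (fun x j => z^-1 * B0inv x j); split.
  apply: boundedly_invertible_ext (boundedly_invertible_scale zn B0P) => j k.
  have ivc := cinteg_real iv.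
  rewrite -[Bmx f0 g0 j k]/(FC (fun x => (v x)%:C) (j%:R - k%:R)).
  rewrite -[Bmx f g j k]/(FC (fun x => ((f x + g x)^-1)%:C) (j%:R - k%:R)).
  rewrite -(FCZ z (j%:R - k%:R) ivc).
  have -> : (fun x => ((f x + g x)^-1)%:C) = fun x => z * (v x)%:C.
    by apply/funext => x; rewrite invE realcM.
  exact: erefl.
have ir : integ (fun x => s^-1 * (rho x + eps * d)).
  by apply: integZ; apply: integD; [exact: irho|exact: integ_cst].
have iq' : integ (fun x => s^-1 * (q x + eps * p x)).
  by apply: integZ; apply: integD; [exact: iq|exact: integZ].
have minv : measurable_fun circle (fun x => (f x + g x)^-1).
  by rewrite (funext invE); exact: integ_meas (integZ _ iv).
have mr' : measurable_fun circle (fun x => f x / (f x + g x)).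
  by apply: measurable_funM => //; exact: integ_meas if_.
have mq' : measurable_fun circle (fun x => f x * g x / (f x + g x)).
  by do 2?apply: measurable_funM => //; exact: integ_meas.
have er : aecirc (fun x => f x / (f x + g x) = s^-1 * (rho x + eps * d)).
  by apply: aecirc1 frho => x _; rewrite fg.
have eq' : aecirc (fun x => f x * g x / (f x + g x) = s^-1 * (q x + eps * p x)).
  by apply: aecirc1 fq => x _; rewrite fg.
have ifr : integ (fun x => f x / (f x + g x)).
  by apply: (integ_dom mr' (integ_norm ir)); apply: aecirc1 er => x _ ->.
have ifq : integ (fun x => f x * g x / (f x + g x)).
  by apply: (integ_dom mq' (integ_norm iq')); apply: aecirc1 eq' => x _ ->.
have iA : cinteg A.
  by apply: (cinteg_bounded mA); apply: aecirc_all => x _; exact: Afun_bounded.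
pose ed : R[i] := (eps * d)%:C.
pose r := fun k => ed * a k + Ra k.
have r_l2 : l2 r by exact: l2_lin.
(* The new symbol is [z (rho + eps d)], and the nonnegative coefficients of [A] are [a] itself. *)
have RE : mxact (Rmx f g) a = fun k => z * r k.
  rewrite /Rmx mxact_symbol//; apply/funext => j.
  rewrite (@FC_eq_ae _ _ (fun x => z * (ed * A x + (rho x)%:C * A x))).
  - have ied := cintegZ ed iA.
    rewrite FCZ; last exact: cintegD.
    by rewrite FCD// FCZ// FC_Afun// /r RaE.
  - by apply: cmeasM => //; exact: cmeas_real.
  - apply: cmeasM (cmeas_cst _) _; apply: cmeasD => //.
    exact: cmeasM (cmeas_cst _) mA.
  - apply: aecirc1 er => x _ ->; rewrite /z /ed !(realcM, realcD); ring.
(* The scalings of [R] and of the inverse of [B] cancel, so a single factor [z] remains in the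
   objective; [1 + eps] removes it. *)
have BE : (fun j => z^-1 * B0inv (mxact (Rmx f g) a) j) = fun k => ed * y k + c0 k.
  rewrite RE (bop_scale z Bib r_l2) (bop_lin Bib ed a_l2 Ra_l2).
  by apply/funext => j; rewrite mulKf.
have QE : inner (mxact (Qmx f g) a) a = z * (eps%:C * T p + T q).
  rewrite /Qmx inner_symbol//.
  rewrite (@avg_eq_ae _ _ (fun x => z * (eps%:C * ((p x)%:C * A x * conjc (A x)) +
     (q x)%:C * A x * conjc (A x)))).
  - have i1 := cinteg_AA ip; have i2 := cinteg_AA iq; have i3 := cintegZ eps%:C i1.
    by rewrite avgZ ?avgD ?avgZ//; exact: cintegD.
  - by case: (cinteg_AA ifq).
  - have i1 := cinteg_AA ip; have i2 := cinteg_AA iq; have i3 := cintegZ eps%:C i1.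
    by case: (cintegZ z (cintegD i3 i2)).
  - apply: aecirc1 eq' => x _ ->; rewrite /z !(realcM, realcD); ring.
have ey_l2 : l2 (fun k => ed * y k) by exact: l2_scale.
have eyc_l2 : l2 (fun k => ed * y k + c0 k) by exact: l2_lin.
rewrite /objective BE QE RE.
rewrite (inner_scalel _ r_l2 eyc_l2) (inner_linl _ a_l2 Ra_l2 eyc_l2).
rewrite !(inner_linr _ y_l2 c0_l2)// Ra_y -/T1 -/T2 -mulrDr Re_scale mulrA divff ?mul1r ?gt_eqF//.
rewrite /ed conjc_real !ReD !Re_scale !ReD !Re_scale ReJ; ring.
Qed.

(** * Complementary slackness and the saddle point *)

Section Optimality.
Variables P1 P2 : R.
Hypotheses (f0D : power_class P1 f0) (g0D : power_class P2 g0).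
Hypothesis optimal : forall (f g : R -> R) (B Binv : (nat -> R[i]) -> (nat -> R[i])),
    power_class P1 f -> power_class P2 g -> minimality f g ->
    boundedly_invertible (Bmx f g) B Binv ->
    objective a f g Binv <= objective a f0 g0 B0inv.

(** The right side is the optimal value [J0]: optimality says that [(1 + eps) J <= (1 + eps) J0],
    and after subtracting [J0] and dividing by [eps] the term [J0] remains against the slope. *)
Lemma first_order (d e0 : R) (p : R -> R) (F G : R -> R -> R) : 0 < e0 -> integ p ->
  (forall eps, 0 < eps < e0 -> [/\ power_class P1 (F eps), power_class P2 (G eps),
    forall x, F eps x + G eps x = (1 + eps) * w x,
    aecirc (fun x => F eps x / ((1 + eps) * w x) = (1 + eps)^-1 * (rho x + eps * d)) &
    aecirc (fun x => F eps x * G eps x / ((1 + eps) * w x) =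
      (1 + eps)^-1 * (q x + eps * p x))]) ->
  2 * d * complex.Re T1 + complex.Re (T p) <= complex.Re T2 + complex.Re (T q).
Proof.
move=> e00 ip h; rewrite -subr_le0.
apply: (@le0_small_slope R _ (d ^+ 2 * complex.Re (inner a y)) e0) => // eps /[dup] ee /andP[eps0 _].
have [FD GD FG h1 h2] := h eps ee.
have [mFG [B [Binv [BB]]]] := objective_perturbed eps0 ip FD.1 GD.1 FG h1 h2.
have := optimal FD GD mFG BB; rewrite objective0.
set J := objective _ _ _ _; set X := 2 * d * _ + _; set Y := _ * complex.Re (inner a y).
set J0 := complex.Re T2 + _ => JJ0 e.
rewrite -(pmulr_rle0 _ eps0).
have -> : eps * (X - J0 + eps * Y) = (1 + eps) * J - (1 + eps) * J0 by rewrite e; ring.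
by rewrite subr_le0 ler_pM2l// addr_gt0.
Qed.



Let mean_perturb f eps : integ f -> mean (fun x => f x + eps * w x) = mean f + eps * mean w.
Proof.
move=> if_; rewrite /mean rintD//; last exact: integZ.
by rewrite rintZ//; ring.
Qed.

Let perturb_spectral f eps : spectral_density f -> 0 < eps ->
  spectral_density (fun x => f x + eps * w x).
Proof.
move=> [if_ f_ge0] eps0; split; first exact: integD if_ (integZ _ iw).
by move=> x cx; rewrite addr_ge0 ?f_ge0// mulr_ge0 ?w_ge0// ltW.
Qed.

Let slack f P : 0 < P - mean f -> 0 < (P - mean f) / mean w.
Proof. by move=> h; rewrite divr_gt0// mean_w_gt0. Qed.

Let slack_le f P eps : integ f -> eps < (P - mean f) / mean w ->
  mean (fun x => f x + eps * w x) <= P.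
Proof.
by move=> if_; rewrite mean_perturb// ltr_pdivlMr ?mean_w_gt0// => h; lra.
Qed.

(** The product form covers both cases of complementary slackness, an active constraint and
    [alpha1 = 0]. *)
Lemma alpha1_slack : alpha1 ^+ 2 * mean f0 = alpha1 ^+ 2 * P1.
Proof.
have [_ fP] := f0D; rewrite -/(rint f0) -/(mean f0) in fP.
have [e|] := eqVneq (mean f0) P1; first by rewrite e.
move=> ne; have sl : 0 < P1 - mean f0 by rewrite subr_gt0 lt_neqAle ne.
have fo := @first_order 1 _ g0 (fun eps x => f0 x + eps * w x) (fun _ => g0) (slack sl) ig0.
have {fo} : 2 * 1 * complex.Re T1 + complex.Re (T g0) <= complex.Re T2 + complex.Re (T q).
  apply: fo => eps /andP[eps0 epsl].
  have s0 : 1 + eps != 0 by rewrite gt_eqF// addr_gt0.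
  split=> //.
  - by split; [exact: perturb_spectral|exact: slack_le].
  - by move=> x; rewrite /w; ring.
  - apply: aecirc1 w_gt0 => x _ wx; rewrite /rho.
    by field; rewrite s0 gt_eqF.
  - apply: aecirc1 w_gt0 => x _ wx; rewrite /q.
    by field; rewrite s0 gt_eqF.
rewrite mulr1 -subr_le0 -alpha1_mean => h.
have /eqP -> : alpha1 ^+ 2 == 0.
  by rewrite eq_le sqr_ge0 andbT -(pmulr_lle0 _ mean_w_gt0).
by rewrite !mul0r.
Qed.

Lemma alpha2_slack : alpha2 ^+ 2 * mean g0 = alpha2 ^+ 2 * P2.
Proof.
have [_ gP] := g0D; rewrite -/(rint g0) -/(mean g0) in gP.
have [e|] := eqVneq (mean g0) P2; first by rewrite e.
move=> ne; have sl : 0 < P2 - mean g0 by rewrite subr_gt0 lt_neqAle ne.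
have fo := @first_order 0 _ f0 (fun _ => f0) (fun eps x => g0 x + eps * w x) (slack sl) if0.
have {fo} : 2 * 0 * complex.Re T1 + complex.Re (T f0) <= complex.Re T2 + complex.Re (T q).
  apply: fo => eps /andP[eps0 epsl].
  have s0 : 1 + eps != 0 by rewrite gt_eqF// addr_gt0.
  split=> //.
  - by split; [exact: perturb_spectral|exact: slack_le].
  - by move=> x; rewrite /w; ring.
  - apply: aecirc1 w_gt0 => x _ wx; rewrite /rho.
    by field; rewrite s0 gt_eqF.
  - apply: aecirc1 w_gt0 => x _ wx; rewrite /q.
    by field; rewrite s0 gt_eqF.
rewrite mulr0 mul0r add0r -subr_le0 -alpha2_mean => h.
have /eqP -> : alpha2 ^+ 2 == 0.
  by rewrite eq_le sqr_ge0 andbT -(pmulr_lle0 _ mean_w_gt0).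
by rewrite !mul0r.
Qed.

Lemma saddle_point : least_favourable a (power_class P1 `*` power_class P2) f0 g0 /\
  minimax_robust a (power_class P1 `*` power_class P2) h0.
Proof.
have hmax f g : power_class P1 f -> power_class P2 g ->
    (Delta a h0 f g <= Delta a h0 f0 g0)%E.
  (* By slackness the value at [(f0, g0)] is [alpha1^2 P1 + alpha2^2 P2], the most that the power
     bounds permit. *)
  move=> [fS fP] [gS gP]; rewrite !robust_Delta// alpha1_slack alpha2_slack lee_fin.
  by apply: lerD; rewrite ler_wpM2l ?sqr_ge0.
split.
  split; first by split.
  exists h0; first exact: robust_spectral_characteristic.
  (* As [h0] belongs to [L20] for [f + g] too, it competes with the minimizer [h] for that pair. *)
  move=> f g h [fD gD] [_ hmin]; apply: le_trans (hmax f g fD gD).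
  exact: hmin (robust_L20 fD.1 gD.1).
split; first by move=> f g [[fS _] [gS _]]; exact: robust_L20.
(* Both worst errors are compared with the saddle value: that of [h0] does not exceed it, and that
   of [h] is at least the error of [h] at [(f0, g0)]. *)
move=> h hH; apply: (@le_trans _ _ (Delta a h0 f0 g0)).
  by apply: ge_ereal_sup => _ [[f g] [/= fD gD] <-]; exact: hmax.
apply: (@le_trans _ _ (Delta a h f0 g0)).
  by apply: robust_spectral_characteristic.2; apply: hH; split.
by apply: ereal_sup_ubound; exists (f0, g0) => //; split.
Qed.

End Optimality.

End LeastFavourable.

Theorem theorem5p2 (R : realType) (a : nat -> R[i]) (P1 P2 : R)
  (a_abs : cvgn (series (fun j => cmod (a j))))
  (a_sq : cvgn (series (fun j => (j%:R + 1) * cmod (a j) ^+ 2)))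
  (P1_gt0 : 0 < P1) (P2_gt0 : 0 < P2)
  (f0 g0 : R -> R)
  (f0D : power_class P1 f0) (g0D : power_class P2 g0)
  (min0 : minimality f0 g0)
  (B0 B0inv : (nat -> R[i]) -> (nat -> R[i]))
  (B0P : boundedly_invertible (Bmx f0 g0) B0 B0inv)
  (C0 : R -> R[i])
  (C0P : fourier_sum (B0inv (mxact (Rmx f0 g0) a)) C0)
  (hf_bounded : exists M : R,
    {ae @lebesgue_measure R, forall x, circle x ->
      cmod (Afun a x * (g0 x)%:C + C0 x) ^+ 2 / (f0 x + g0 x) ^+ 2 <= M})
  (hg_bounded : exists M : R,
    {ae @lebesgue_measure R, forall x, circle x ->
      cmod (Afun a x * (f0 x)%:C - C0 x) ^+ 2 / (f0 x + g0 x) ^+ 2 <= M})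
  (alpha1 alpha2 : R) (alpha1_ge0 : 0 <= alpha1) (alpha2_ge0 : 0 <= alpha2)
  (eq1 : {ae @lebesgue_measure R, forall x, circle x ->
    cmod (Afun a x * (g0 x)%:C + C0 x) = alpha1 * (f0 x + g0 x)})
  (eq2 : {ae @lebesgue_measure R, forall x, circle x ->
    cmod (Afun a x * (f0 x)%:C - C0 x) = alpha2 * (f0 x + g0 x)})
  (optimal : forall (f g : R -> R) (B Binv : (nat -> R[i]) -> (nat -> R[i])),
    power_class P1 f -> power_class P2 g -> minimality f g ->
    boundedly_invertible (Bmx f g) B Binv ->
    objective a f g Binv <= objective a f0 g0 B0inv) :
  least_favourable a (power_class P1 `*` power_class P2) f0 g0 /\
  minimax_robust a (power_class P1 `*` power_class P2)
    (fun x => (Afun a x * (f0 x)%:C - C0 x) / (f0 x + g0 x)%:C).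
Proof.
exact: (saddle_point a_abs f0D.1 g0D.1 min0 B0P C0P eq1 eq2 f0D g0D optimal).
Qed.
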